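(* Let $N\sim N(\mu,\Sigma)$ and $N^*\sim N(\mu^*,\Sigma^* )$ be $d$-dimensional normal random vectors. 1. If $\mu\le\mu^*$ and $\Sigma=\Sigma^*$, then $N\le_{\mathrm{st}}N^*$. 2. If $\mu=\mu^*$ and $\Sigma\le_{\mathrm{psd}}\Sigma^*$, then $N\le_{\mathrm{cx}}N^*$. 3. If $\mu=\mu^*$ and $\Sigma^{ij}\le\Sigma^{*ij}$ for all $i,j\le d$, then $N\le_{\mathrm{dcx}}N^*$. 4. If $\mu\le\mu^*$ and $\Sigma\le_{\mathrm{psd}}\Sigma^*$, then $N\le_{\mathrm{icx}}N^*$. 5. If $\mu\le\mu^*$ and $\Sigma^{ij}\le\Sigma^{*ij}$ for all $i,j\le d$, then $N\le_{\mathrm{idcx}}N^*$.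
   Context: $N(\mu,\Sigma)$ is the $d$-dimensional normal distribution with mean $\mu$ and covariance matrix $\Sigma$. $\mathbb R^d$ carries the componentwise order; $A\le_{\mathrm{psd}}B$ means $B-A$ is positive semidefinite. For a class $\mathcal F$ of functions $\mathbb R^d\to\mathbb R$, $X\le_{\mathcal F}Y$ means $Ef(X)\le Ef(Y)$ for all $f\in\mathcal F$ such that $f(X)$ and $f(Y)$ are integrable. The orders $\le_{\mathrm{st}},\le_{\mathrm{cx}},\le_{\mathrm{dcx}},\le_{\mathrm{icx}},\le_{\mathrm{idcx}}$ are those generated by: increasing (nondecreasing) functions; convex functions; directionally convex functions (supermodular, i.e. $f(x\wedge y)+f(x\vee y)\ge f(x)+f(y)$, and convex in each coordinate); increasing convex functions; increasing directionally convex functions. *)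

(* Defs.v *)
From HB Require Import structures.
From mathcomp Require Import all_boot all_order all_algebra.
From mathcomp Require Import all_classical all_reals all_analysis.

Set Implicit Arguments.
Unset Strict Implicit.
Unset Printing Implicit Defensive.

Import Order.TTheory GRing.Theory Num.Theory.
Import numFieldNormedType.Exports.

Local Open Scope classical_set_scope.
Local Open Scope ring_scope.

(* Vectors of R^n are columns 'cV[R]_n. They carry the sigma-algebra generated
   by the coordinate projections (as n.-tuple T does in measurable_structure.v);
   for T := R this is the Borel sigma-algebra of R^n. *)
Definition measure_cV_display : measure_display -> measure_display.
Proof. exact. Qed.

Section measurable_cV.
Context {disp} {T : sigmaRingType disp}.
Variable n : nat.

Let coors : 'I_n -> 'cV[T]_n -> T := fun i x => x i ord0.

Let cV_set0 : g_sigma_preimage coors set0.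
Proof. exact: sigma_algebra0. Qed.

Let cV_setC A : g_sigma_preimage coors A -> g_sigma_preimage coors (~` A).
Proof. exact: sigma_algebraC. Qed.

Let cV_bigcup (F : (set 'cV[T]_n)^nat) :
  (forall i, g_sigma_preimage coors (F i)) ->
  g_sigma_preimage coors (\bigcup_i (F i)).
Proof. exact: sigma_algebra_bigcup. Qed.

HB.instance Definition _ := @isMeasurable.Build (measure_cV_display disp)
  'cV[T]_n (g_sigma_preimage coors) cV_set0 cV_setC cV_bigcup.

End measurable_cV.

Section normal_vectors.
Context {R : realType}.

Definition standard_normal k (g : probability 'cV[R]_k R) : Prop :=
  forall B : 'I_k -> set R, (forall i, measurable (B i)) ->
    g [set z | forall i, B i (z i ord0)] =
      (\prod_(i < k) normal_prob (0 : R) 1 (B i))%E.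

(* X has the law of A Z + b with Z a vector of independent standard normal
   variables; A is an arbitrary matrix, so the law may be degenerate. *)
Definition gaussian_vector d disp (T : measurableType disp)
    (P : probability T R) (X : {RV P >-> 'cV[R]_d}) : Prop :=
  exists (k : nat) (A : 'M[R]_(d, k)) (b : 'cV[R]_d)
         (g : probability 'cV[R]_k R),
    standard_normal g /\
    forall B : set 'cV[R]_d, measurable B ->
      distribution P X B = g [set z | B (A *m z + b)].

(* X ~ N(mu, Sigma) *)
Definition normal_vector d disp (T : measurableType disp)
    (P : probability T R) (X : {RV P >-> 'cV[R]_d})
    (mu : 'cV[R]_d) (Sigma : 'M[R]_d) : Prop :=
  [/\ gaussian_vector X,
      forall i, ('E_P[fun t => X t i ord0] = (mu i ord0)%:E)%E
    & forall i j,
        covariance P (fun t => X t i ord0) (fun t => X t j ord0)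
          = (Sigma i j)%:E].

End normal_vectors.

Section stochastic_orders.
Context {R : realType} {d : nat}.
Implicit Types (x y : 'cV[R]_d) (f : 'cV[R]_d -> R).

Definition le_vec x y : Prop := forall i, x i ord0 <= y i ord0.

Definition psd (M : 'M[R]_d) : Prop :=
  M^T = M /\ forall x, 0 <= (x^T *m M *m x) ord0 ord0.

Definition le_psd (A B : 'M[R]_d) : Prop := psd (B - A).

Definition increasing_fct f : Prop := forall x y, le_vec x y -> f x <= f y.

Definition convex_fct f : Prop := @convex_function R 'cV[R]_d setT f.

Definition supermodular f : Prop := forall x y,
  f x + f y <= f (map2_mx Num.min x y) + f (map2_mx Num.max x y).

Definition set_coord x (i : 'I_d) (t : R) : 'cV[R]_d :=
  \col_j (if j == i then t else x j ord0).

Definition coordinatewise_convex f : Prop := forall x i,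
  @convex_function R R^o setT (fun t => f (set_coord x i t)).

Definition dir_convex f : Prop := supermodular f /\ coordinatewise_convex f.

(* Borel measurability of f is explicit: an increasing f need not be Borel,
   and if only f \o X and f \o Y were required to be measurable, then E f(X)
   would not be determined by f and the law of X. *)
Definition le_generated (F : ('cV[R]_d -> R) -> Prop)
    dT (T : measurableType dT) (P : probability T R) (X : {RV P >-> 'cV[R]_d})
    dU (U : measurableType dU) (Q : probability U R) (Y : {RV Q >-> 'cV[R]_d})
    : Prop :=
  forall f, F f -> measurable_fun setT f ->
    P.-integrable setT (fun t => (f (X t))%:E) ->
    Q.-integrable setT (fun u => (f (Y u))%:E) ->
    ('E_P[fun t => f (X t)] <= 'E_Q[fun u => f (Y u)])%E.

Definition le_st := le_generated increasing_fct.
Definition le_cx := le_generated convex_fct.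
Definition le_dcx := le_generated dir_convex.
Definition le_icx := le_generated (fun f => increasing_fct f /\ convex_fct f).
Definition le_idcx := le_generated (fun f => increasing_fct f /\ dir_convex f).

End stochastic_orders.
Arguments le_st {R d dT T P} X {dU U Q} Y.
Arguments le_cx {R d dT T P} X {dU U Q} Y.
Arguments le_dcx {R d dT T P} X {dU U Q} Y.
Arguments le_icx {R d dT T P} X {dU U Q} Y.
Arguments le_idcx {R d dT T P} X {dU U Q} Y.

(* Main.v *)
(* A normal vector is mu + A z with z standard, and its law depends on A only
   through A A^T.  The monotone and convex comparisons follow by averaging
   pointwise inequalities: if Sigma' - Sigma = C C^T, then
   2 f(A z) <= f(A z + C w) + f(A z - C w).

   For directionally convex f, write A A^T <= A' A'^T entrywise.  If some u has
   (A' u)_i > 0 on all nonzero rows, then A A^T is joined to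
   A' A'^T + eps^2 v v^T, v = A' u, by finitely many elementary moves
   M -> M + p p^T and M + p p^T + q q^T -> M + (p + q)(p + q)^T with p, q >= 0,
   each of which increases E f by increasing differences.  The expectations
   along the chain exist because f(A' .) is integrable and f has increasing
   differences: this forces f(A' y) = O(exp((1 + eta) |y|^2 / 2)) pointwise and
   bounds f from below on the points dominated by the range of A', so that f
   contracted by a factor < 1 has integrable negative part along the chain.  Let
   eps tend to 0 and the contraction factor to 1.
   If there is no such u, Gordan's theorem yields w >= 0, w <> 0 on nonzero rows
   with A'^T w = 0; then A A^T and A' A'^T share a nonzero column, and one
   conditions on a common first coordinate and inducts on the number of nonzero
   rows of A'. *)

Require Import Defs.
From HB Require Import structures.
From mathcomp Require Import all_boot all_order all_algebra.
From mathcomp Require Import all_classical all_reals all_analysis.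
From mathcomp Require Import measurable_realfun ring lra.

Set Implicit Arguments.
Unset Strict Implicit.
Unset Printing Implicit Defensive.

Import Order.TTheory GRing.Theory Num.Theory.
Import numFieldNormedType.Exports.

Local Open Scope classical_set_scope.
Local Open Scope ring_scope.

(** * Standard Gaussian vectors *)

Section measurable_cV.
Context d (T : measurableType d) (R : realType).

(** The obstacle is integrability. Entrywise order of covariances controls quadratic forms only on
    the cone l >= 0, and [f] is assumed integrable under the two end laws only, with no smoothness
    and no growth bound; differentiating along an interpolation of covariances would need both. The
    growth exponent (1 + eta) |y|^2 / 2 extracted from integrability just fails to be integrable,
    and the contraction gives back the missing room. It can be removed afterwards even for merely
    measurable functions, because the dilation can be carried by the Gaussian density. The cone
    condition is what duality turns into domination: each point B w of an intermediate law lies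
    below some A' y with |y| barely larger than |w|, so bounds known on the range of A' reach laws
    that are not supported there. Comparisons are made for pairs f <= g, which absorbs the
    difference of means and survives conditioning. *)

Lemma measurable_coord k (i : 'I_k) :
  measurable_fun [set: 'cV[R]_k] (fun x => x i ord0).
Proof.
move=> _ Y mY; rewrite setTI; apply: sub_sigma_algebra.
rewrite -bigcup_seq/=; exists i => /=; first by rewrite mem_index_enum.
by exists Y => //; rewrite setTI.
Qed.

Lemma measurable_fun_cV k (f : T -> 'cV[R]_k) :
  (forall i, measurable_fun [set: T] (fun t => f t i ord0)) ->
  measurable_fun [set: T] f.
Proof.
move=> mf _ A mA; rewrite setTI; move: A mA.
rewrite [X in forall A, X A -> _]/measurable/=.
apply: (@smallest_sub _ _ _ [set B | measurable (f @^-1` B)]).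
  split; first by rewrite /= preimage_set0.
  - by move=> B /= mB; rewrite setTD; exact: measurableC mB.
  - by move=> F mF; rewrite /= preimage_bigcup; apply: bigcup_measurable => i _; exact: mF.
move=> B; rewrite -bigcup_seq/= => -[i _ [C mC <-]]/=.
rewrite setTI; have := mf i measurableT C mC; by rewrite setTI.
Qed.

End measurable_cV.

Section standard_gaussian.
Context (R : realType).

Lemma measurable_affine d (T : measurableType d) k n (A : 'M[R]_(k, n))
    (b : 'cV[R]_k) (f : T -> 'cV[R]_n) :
  measurable_fun [set: T] f ->
  measurable_fun [set: T] (fun t => A *m f t + b).
Proof.
move=> mf; apply: measurable_fun_cV => i.
under eq_fun do rewrite !mxE.
apply: measurable_funD => //; apply: measurable_sum => j.
apply: measurable_funM => //.
by apply: (measurableT_comp (measurable_coord j)).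
Qed.

Lemma measurable_mulmx d (T : measurableType d) k n (A : 'M[R]_(k, n))
    (f : T -> 'cV[R]_n) :
  measurable_fun [set: T] f -> measurable_fun [set: T] (fun t => A *m f t).
Proof.
move=> mf; have := measurable_affine A 0 mf.
by under eq_fun do rewrite addr0.
Qed.

Lemma measurable_col_mx m n :
  measurable_fun [set: 'cV[R]_m * 'cV[R]_n] (fun p => col_mx p.1 p.2).
Proof.
apply: measurable_fun_cV => i; case: (split_ordP i) => j ->.
  under eq_fun do rewrite col_mxEu.
  exact: (measurableT_comp (measurable_coord j) (@measurable_fst _ _ _ _)).
under eq_fun do rewrite col_mxEd.
exact: (measurableT_comp (measurable_coord j) (@measurable_snd _ _ _ _)).
Qed.

Definition cV1 (x : measurableTypeR R) : 'cV[R]_1 := const_mx x.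

Definition cons_cV k (p : measurableTypeR R * 'cV[R]_k) : 'cV[R]_k.+1 := col_mx (cV1 p.1) p.2.

Lemma measurable_col1 :
  measurable_fun [set: measurableTypeR R] cV1.
Proof.
apply: measurable_fun_cV => i; under eq_fun do rewrite mxE.
exact: measurable_id.
Qed.

Lemma measurable_cons_cV k :
  measurable_fun [set: measurableTypeR R * 'cV[R]_k]
    (@cons_cV k).
Proof.
have h : measurable_fun [set: measurableTypeR R * 'cV[R]_k]
    (fun p : measurableTypeR R * 'cV[R]_k => (cV1 p.1, p.2)).
  apply/measurable_fun_pairP; split; last exact: measurable_snd.
  exact: (measurableT_comp measurable_col1 (@measurable_fst _ _ _ _)).
exact: (measurableT_comp (@measurable_col_mx 1 k) h).
Qed.

HB.instance Definition _ k := isMeasurableFun.Build _ _ _ _ _ (@measurable_cons_cV k).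

(** A concrete law satisfying [standard_normal]. The recursion lets Tonelli peel off one coordinate
    at a time, and [standard_normal_unique] transfers the results to every other such law. *)
Fixpoint gamma k : probability 'cV[R]_k R :=
  if k is k'.+1 then
    distribution (normal_prob (0 : R) 1 \x gamma k')%E
      (@cons_cV k')
  else \d_(0 : 'cV[R]_0).

Lemma measurable_rect k (B : 'I_k -> set R) :
  (forall i, measurable (B i)) ->
  measurable [set z : 'cV[R]_k | forall i, B i (z i ord0)].
Proof.
move=> mB; rewrite [X in measurable X](_ : _ =
  \big[setI/setT]_(i < k) [set z : 'cV[R]_k | B i (z i ord0)]).
  apply: bigsetI_measurable => i _.
  by have := measurable_coord i measurableT (mB i); rewrite setTI.
rewrite -bigcap_seq; apply/seteqP; split => z /= h i.
  by move=> _; exact: h.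
by apply: h; rewrite /= mem_index_enum.
Qed.

Lemma product_standard_normal m n (g : probability 'cV[R]_m R)
    (h : probability 'cV[R]_n R) (B : 'I_(m + n) -> set R) :
  standard_normal g -> standard_normal h -> (forall i, measurable (B i)) ->
  (g \x h)%E [set p | forall i, B i (col_mx p.1 p.2 i ord0)] =
  (\prod_(i < m + n) normal_prob (0 : R) 1 (B i))%E.
Proof.
move=> sg sh mB; rewrite big_split_ord/=.
rewrite [X in (_ \x _)%E X](_ : _ =
    [set z : 'cV[R]_m | forall i, B (lshift n i) (z i ord0)] `*`
    [set z : 'cV[R]_n | forall i, B (rshift m i) (z i ord0)]).
  rewrite product_measure1E.
  - by congr (_ * _)%E; [apply: (sg (fun i => B (lshift n i)))|
                         apply: (sh (fun i => B (rshift m i)))].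
  - exact: (measurable_rect (B := fun i => B (lshift n i))).
  - exact: (measurable_rect (B := fun i => B (rshift m i))).
apply/seteqP; split => -[z w] /= hB.
  by split => i; [have := hB (lshift n i); rewrite col_mxEu|
                  have := hB (rshift m i); rewrite col_mxEd].
by move: hB => [hB1 hB2] i; case: (split_ordP i) => j ->;
  rewrite ?col_mxEu ?col_mxEd.
Qed.

Lemma standard_normal1 (g : probability 'cV[R]_1 R) :
  (forall B, measurable B -> g B = normal_prob (0 : R) 1 [set x | B (cV1 x)]) ->
  standard_normal g.
Proof.
move=> gE B mB; rewrite gE ?big_ord1; last exact: measurable_rect.
congr (normal_prob _ _ _); apply/seteqP; split => x /=.
  by move=> /(_ ord0); rewrite mxE.
by move=> Bx i; rewrite mxE ord1.
Qed.

HB.instance Definition _ := isMeasurableFun.Build _ _ _ _ _ measurable_col1.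

Lemma gamma_standard k : standard_normal (gamma k).
Proof.
elim: k => [|k IH] B mB.
  by rewrite /= big_ord0 diracE mem_set// => -[].
pose g1 := distribution (normal_prob (0 : R) 1) cV1.
have sg1 : standard_normal g1 by apply: standard_normal1.
rewrite -(product_standard_normal (m := 1) sg1 IH mB).
rewrite /= /distribution /pushforward.
have mA : measurable [set p : 'cV[R]_1 * 'cV[R]_k |
    forall i, B i (col_mx p.1 p.2 i ord0)].
  have := @measurable_col_mx 1 k measurableT _ (measurable_rect mB).
  by rewrite setTI.
rewrite /product_measure1 [RHS]ge0_integral_pushforward//=.
exact: measurable_fun_xsection.
Qed.

(** Measurable rectangles are stable under intersection and generate the sigma-algebra, so the
    values on them determine a probability. *)
Lemma standard_normal_unique k (g h : probability 'cV[R]_k R) :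
  standard_normal g -> standard_normal h ->
  forall B, measurable B -> g B = h B.
Proof.
move=> sg sh B mB.
pose C := [set D : set 'cV[R]_k | exists B : 'I_k -> set R,
  (forall i, measurable (B i)) /\ D = [set z | forall i, B i (z i ord0)]].
apply: (measure_unique C (fun=> setT)) => //.
- apply/seteqP; split.
    apply: smallest_sub; first exact: smallest_sigma_algebra.
    move=> D; rewrite -bigcup_seq => -[i _ [E mE <-]].
    apply: sub_sigma_algebra; exists (fun j => if j == i then E else setT).
    split; first by move=> j; case: ifP.
    apply/seteqP; split => z /=.
      by move=> [_ Ez] j; case: eqP => // ->.
    by move=> /(_ i); rewrite eqxx.
  apply: smallest_sub; first exact: sigma_algebra_measurable.
  by move=> _ [E [mE ->]]; exact: measurable_rect.
- move=> _ _ [E [mE ->]] [F [mF ->]]; exists (fun i => E i `&` F i); split.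
    by move=> i; exact: measurableI.
  apply/seteqP; split => z /=; first by move=> [h1 h2] i; split.
  by move=> h1; split => i; case: (h1 i).
- move=> _; exists (fun=> setT); split => //.
  by apply/seteqP; split.
- by apply/seteqP; split => // x _; exists 0%N.
- by move=> _ [E [mE ->]]; exact: etrans (sg E mE) (esym (sh E mE)).
- by move=> _; rewrite (le_lt_trans (probability_le1 _ _))// ltry.
Qed.

(** The image of the product measure under [col_mx] has the right values on rectangles, so
    uniqueness replaces an induction on [m]. Tonelli does the rest. *)
Lemma gammaD m n (F : 'cV[R]_(m + n) -> \bar R) :
  measurable_fun setT F -> (forall z, 0 <= F z)%E ->
  (\int[gamma (m + n)]_z F z =
   \int[gamma m]_x \int[gamma n]_y F (col_mx x y))%E.
Proof.
move=> mF F0.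
pose phi : 'cV[R]_m * 'cV[R]_n -> 'cV[R]_(m + n) := fun p => col_mx p.1 p.2.
have mphi : measurable_fun setT phi by exact: measurable_col_mx.
pose phi' : {mfun ('cV[R]_m * 'cV[R]_n)%type >-> 'cV[R]_(m + n)} :=
  HB.pack phi (isMeasurableFun.Build _ _ _ _ _ mphi).
transitivity (\int[distribution (gamma m \x gamma n)%E phi']_z F z)%E.
  apply: eq_measure_integral => B mB _; apply: standard_normal_unique => //.
    exact: gamma_standard.
  move=> E mE; apply: product_standard_normal => //; exact: gamma_standard.
rewrite ge0_integral_pushforward//=.
rewrite fubini_tonelli1//=; first exact: measurableT_comp.
Qed.

Lemma gamma1 (F : 'cV[R]_1 -> \bar R) :
  measurable_fun setT F -> (forall z, 0 <= F z)%E ->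
  (\int[gamma 1]_z F z = \int[normal_prob 0%R 1%R]_x F (cV1 x))%E.
Proof.
move=> mF F0.
transitivity (\int[distribution (normal_prob 0%R 1%R)
    cV1]_z F z)%E.
  apply: eq_measure_integral => B mB _; apply: standard_normal_unique => //.
    exact: gamma_standard.
  exact: standard_normal1.
by rewrite ge0_integral_pushforward.
Qed.

End standard_gaussian.

(** * One-dimensional densities *)

Section density.
Local Open Scope ereal_scope.
Context d (T : measurableType d) (R : realType).
Variables (nu mu : {measure set T -> \bar R}) (p : T -> R).
Hypotheses (p0 : forall x, (0 <= p x)%R) (mp : measurable_fun setT p)
  (nuE : forall A, measurable A -> nu A = \int[mu]_(x in A) (p x)%:E).

Import HBNNSimple.

Let integral_density_nnsfun (h : {nnsfun T >-> R}) :
  \int[nu]_x (h x)%:E = \int[mu]_x ((h x)%:E * (p x)%:E).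
Proof.
under [LHS]eq_integral do rewrite fimfunE -fsumEFin//.
rewrite [LHS]ge0_integral_fsum//; last 2 first.
  - by move=> r; exact/measurable_EFinP/measurableT_comp.
  - by move=> n x _; rewrite EFinM nnfun_muleindic_ge0.
rewrite [RHS](eq_integral (fun x => \sum_(r \in range h)
    ((r * \1_(h @^-1` [set r]) x)%:E * (p x)%:E))); last first.
  move=> x xD; rewrite fimfunE -fsumEFin// ge0_mule_fsuml// => r.
  by rewrite EFinM nnfun_muleindic_ge0.
have mi r : measurable (h @^-1` [set r]).
  by rewrite -[X in measurable X]setTI; exact: measurable_funPT.
rewrite [RHS]ge0_integral_fsum//; last 2 first.
  - move=> r; apply: emeasurable_funM; last exact/measurable_EFinP.
    by apply/measurable_EFinP; do 2 apply/measurableT_comp => //.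
  - move=> n x _; apply: mule_ge0; last by rewrite lee_fin.
    by rewrite EFinM nnfun_muleindic_ge0.
apply: eq_fsbigr => r _.
rewrite integralZl_indic_nnsfun//= integral_indic// setIT nuE//.
under [RHS]eq_integral do rewrite EFinM -muleA.
have [r0|r0] := leP 0%R r.
  rewrite [RHS]ge0_integralZl//.
  - congr (_ * _); rewrite integral_mkcond; apply: eq_integral => x _.
    rewrite patchE indicE; case: ifPn => _; first by rewrite mul1e.
    by rewrite mul0e.
  - apply: emeasurable_funM; last exact/measurable_EFinP.
    by apply/measurable_EFinP; exact: measurable_indic.
  - by move=> x _; rewrite mule_ge0// lee_fin.
(* A negative [r] is not a value of the nonnegative [h]: its level set is empty. *)
have h0 : h @^-1` [set r] = set0.
  apply/seteqP; split => // x /= hx; have : (0 <= h x)%R by [].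
  by rewrite hx leNgt r0.
rewrite h0 integral_set0 mule0; apply/esym.
by apply: integral0_eq => x _; rewrite indic0 mul0e mule0.
Qed.

Lemma ge0_integral_density (f : T -> \bar R) : measurable_fun setT f ->
    (forall x, 0 <= f x) ->
  \int[nu]_x f x = \int[mu]_x (f x * (p x)%:E).
Proof.
move=> mf f0; pose f_ := nnsfun_approx measurableT mf.
transitivity (limn (fun n => \int[nu]_x (f_ n x)%:E)).
  rewrite -monotone_convergence//=.
  - apply: eq_integral => x _; apply/esym/cvg_lim => //=.
    by apply: cvg_nnsfun_approx.
  - by move=> n; exact/measurable_EFinP/measurable_funTS.
  - by move=> n x _; rewrite lee_fin.
  - by move=> x _ a b ab; rewrite lee_fin//; exact/lefP/nd_nnsfun_approx.
under eq_fun do rewrite integral_density_nnsfun.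
rewrite -monotone_convergence//=.
- apply: eq_integral => x _; apply/cvg_lim => //=.
  under eq_fun do rewrite muleC.
  rewrite muleC; apply: cvgeZl => //.
  exact: cvg_nnsfun_approx.
- move=> n; apply: emeasurable_funM; last exact/measurable_EFinP.
  exact/measurable_EFinP/measurable_funTS.
- by move=> n x _; rewrite mule_ge0// lee_fin.
- move=> x _ a b ab; apply: lee_wpmul2r; first by rewrite lee_fin.
  by rewrite lee_fin//; exact/lefP/nd_nnsfun_approx.
Qed.

End density.

Section lebesgue_affine.
Context (R : realType).
Local Notation lambda := (@lebesgue_measure R).

(** The image of Lebesgue measure under the affine map, scaled by |a|, has the right mass on
    half-open intervals, and these determine Lebesgue measure. *)
Lemma lebesgue_affine (a b : R) (F : measurableTypeR R -> \bar R) : a != 0 ->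
  measurable_fun setT F -> (forall x, 0 <= F x)%E ->
  (\int[lambda]_x F x = `|a|%:E * \int[lambda]_x F (a * x + b)%R)%E.
Proof.
move=> a0 mF F0.
pose phi (x : measurableTypeR R) : measurableTypeR R := a * x + b.
have mphi : measurable_fun setT phi.
  by apply: measurable_funD => //; exact: measurable_funM.
pose phi' : {mfun measurableTypeR R >-> measurableTypeR R} :=
  HB.pack phi (isMeasurableFun.Build _ _ _ _ _ mphi).
transitivity (`|a|%:E * \int[pushforward lambda phi']_x F x)%E; last first.
  by rewrite (ge0_integral_pushforward mphi).
rewrite -(ge0_integral_mscale _ _ (NngNum (normr_ge0 a)))//.
apply: eq_measure_integral => A mA _.
apply: lebesgue_measure_unique => // _ [[p q] _ <-] /=.
rewrite /mscale /= /pushforward lebesgue_measure_itv/=.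
have [a1|a1] := ltP 0 a.
  rewrite (_ : phi @^-1` _ = `](p - b) / a, (q - b) / a]%classic); last first.
    apply/seteqP; split => x /=; rewrite !in_itv/= /phi.
      by rewrite ltr_pdivrMr// ler_pdivlMr// ltrBlDr lerBrDr [x * a]mulrC.
    by rewrite ltr_pdivrMr// ler_pdivlMr// ltrBlDr lerBrDr [x * a]mulrC.
  rewrite lebesgue_measure_itv/= !lte_fin ltr_pM2r ?invr_gt0// ltrD2r.
  case: ifPn => _; last by rewrite mule0.
  rewrite -!EFinD -EFinM gtr0_norm//; congr (_%:E); field; exact: a0.
(* A negative slope exchanges the open and the closed end; lengths are unaffected. *)
have a2 : a < 0 by rewrite lt_neqAle a0.
rewrite (_ : phi @^-1` _ = `[(q - b) / a, (p - b) / a[%classic); last first.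
  apply/seteqP; split => x /=; rewrite !in_itv/= /phi.
    by rewrite ltr_ndivlMr// ler_ndivrMr// ltrBlDr lerBrDr [x * a]mulrC andbC.
  by rewrite ltr_ndivlMr// ler_ndivrMr// ltrBlDr lerBrDr [x * a]mulrC andbC.
rewrite lebesgue_measure_itv/= !lte_fin ltr_nM2r ?invr_lt0// ltrD2r.
case: ifPn => _; last by rewrite mule0.
rewrite -!EFinD -EFinM ltr0_norm//; congr (_%:E); field; exact: a0.
Qed.

Lemma lebesgue_shift (b : R) (F : measurableTypeR R -> \bar R) :
  measurable_fun setT F -> (forall x, 0 <= F x)%E ->
  (\int[lambda]_x F (x + b)%R = \int[lambda]_x F x)%E.
Proof.
move=> mF F0; rewrite [RHS](lebesgue_affine (a := 1) b)//.
by rewrite normr1 mul1e; apply: eq_integral => x _; rewrite mul1r.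
Qed.

Local Notation g1 := (@normal_prob R 0 1).
Local Notation phi := (@normal_pdf R 0 1).

Lemma ge0_integral_normal (F : measurableTypeR R -> \bar R) :
  measurable_fun setT F -> (forall x, 0 <= F x)%E ->
  (\int[g1]_x F x = \int[lambda]_x (F x * (phi x)%:E))%E.
Proof.
move=> mF F0; rewrite -(ge0_integral_density (nu := g1))//.
- by move=> x; exact: normal_pdf_ge0.
- exact: measurable_normal_pdf.
Qed.

Lemma normal_pdf01 x : phi x = normal_peak 1 * expR (- (x ^+ 2 / 2)).
Proof.
by rewrite normal_pdfE ?oner_neq0// /normal_fun subr0 expr1n mulNr.
Qed.

(** The factor is the density of N(b, th^2) divided by that of N(0, 1). *)
Lemma normal_affine (th b : R) (F : measurableTypeR R -> \bar R) : th != 0 ->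
  measurable_fun setT F -> (forall x, 0 <= F x)%E ->
  (\int[g1]_x F (th * x + b)%R =
   \int[g1]_x (F x *
     (`|th|^-1 * expR (x ^+ 2 / 2 - ((x - b) / th) ^+ 2 / 2))%:E))%E.
Proof.
move=> th0 mF F0.
have mexp (h : R -> R) : measurable_fun setT h -> measurable_fun setT (fun x => expR (h x)).
  by move=> mh; exact: measurableT_comp.
have mE : measurable_fun setT (fun x : measurableTypeR R => 
    expR (x ^+ 2 / 2 - ((x - b) / th) ^+ 2 / 2)).
  apply: mexp; apply: measurable_funB; apply: measurable_funM => //.
  apply: measurable_funX; apply: measurable_funM => //.
  exact: measurable_funB.
pose q (x : measurableTypeR R) :=
  (`|th|^-1 * expR (x ^+ 2 / 2 - ((x - b) / th) ^+ 2 / 2))%:E.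
have mq : measurable_fun setT q.
  by apply/measurable_EFinP; apply: measurable_funM => //; exact: mE.
have q0 x : (0 <= q x)%E.
  by rewrite lee_fin mulr_ge0 ?invr_ge0// expR_ge0.
pose h (x : measurableTypeR R) := (phi x)%:E.
have mh : measurable_fun setT h.
  by apply/measurable_EFinP; exact: measurable_normal_pdf.
have h0 x : (0 <= h x)%E by rewrite lee_fin normal_pdf_ge0.
have ma : measurable_fun setT (fun x : measurableTypeR R => th * x + b).
  by apply: measurable_funD => //; exact: measurable_funM.
rewrite ge0_integral_normal//; last exact: (measurableT_comp mF ma).
rewrite [RHS]ge0_integral_normal//; last 2 first.
  exact: emeasurable_funM.
  by move=> x; rewrite mule_ge0.
rewrite [RHS](lebesgue_affine b th0); last 2 first.
  by apply: emeasurable_funM mh; exact: emeasurable_funM.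
  by move=> x; exact: (mule_ge0 (mule_ge0 (F0 x) (q0 x)) (h0 x)).
rewrite -ge0_integralZl//; last 2 first.
  apply: (measurableT_comp (f := fun x => (F x * q x * h x)%E) _ ma).
  by apply: emeasurable_funM mh; exact: emeasurable_funM.
  by move=> x _; exact: (mule_ge0 (mule_ge0 (F0 _) (q0 _)) (h0 _)).
apply: eq_integral => x _; rewrite -muleA [RHS]muleCA; congr (_ * _)%E.
rewrite /q /h -!EFinM; congr (_%:E).
rewrite !normal_pdf01 -[X in `|th| * X]mulrA mulVKf ?normr_eq0// mulrCA -expRD.
congr (_ * expR _); rewrite addrK [th * x]mulrC mulfK//; ring.
Qed.

End lebesgue_affine.

(** * Rotation invariance *)

Section rotation.
Local Open Scope ereal_scope.
Context (R : realType).
Local Notation lambda := (@lebesgue_measure R).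
Local Notation T := (measurableTypeR R).
Local Notation g1 := (@normal_prob R 0 1).
Local Notation phi := (@normal_pdf R 0 1).
Implicit Types H : T * T -> \bar R.

Let measurable_shear1 (a : R) :
  measurable_fun [set: T * T] (fun p : T * T => ((p.1 + a * p.2)%R : T, p.2)).
Proof.
apply/measurable_fun_pairP; split; last exact: measurable_snd.
by apply: measurable_funD => //; exact: measurable_funM.
Qed.

Let measurable_shear2 (a : R) :
  measurable_fun [set: T * T] (fun p : T * T => (p.1, (a * p.1 + p.2)%R : T)).
Proof.
apply/measurable_fun_pairP; split; first exact: measurable_fst.
by apply: measurable_funD => //; exact: measurable_funM.
Qed.

Let shear1 (a : R) H : measurable_fun setT H -> (forall p, 0 <= H p) ->
  \int[lambda]_x \int[lambda]_y H (x + a * y, y)%R =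
  \int[lambda]_x \int[lambda]_y H (x, y).
Proof.
move=> mH H0.
rewrite (fubini_tonelli (fun p : T * T => H (p.1 + a * p.2, p.2)%R))//; last first.
  exact: (measurableT_comp mH (measurable_shear1 a)).
rewrite [RHS]fubini_tonelli//; apply: eq_integral => y _.
by rewrite (lebesgue_shift (a * y) (F := fun x => H (x, y)))//;
  exact: measurableT_comp.
Qed.

Let shear2 (a : R) H : measurable_fun setT H -> (forall p, 0 <= H p) ->
  \int[lambda]_x \int[lambda]_y H (x, a * x + y)%R =
  \int[lambda]_x \int[lambda]_y H (x, y).
Proof.
move=> mH H0; apply: eq_integral => x _.
under eq_integral do rewrite addrC.
by rewrite (lebesgue_shift (a * x) (F := fun y => H (x, y)))//;
  exact: measurableT_comp.
Qed.

Let rot (c s : R) (p : T * T) : T * T :=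
  ((c * p.1 - s * p.2)%R, (s * p.1 + c * p.2)%R).

Let measurable_rot c s : measurable_fun [set: T * T] (rot c s).
Proof.
apply/measurable_fun_pairP; split => /=.
  by apply: measurable_funB; exact: measurable_funM.
by apply: measurable_funD; exact: measurable_funM.
Qed.

(** A rotation is a product of three shears, and a shear is a translation in one variable once
    Tonelli has fixed the other. *)
Let lebesgue_rotation (c s : R) H : measurable_fun setT H ->
    (forall p, 0 <= H p) -> s != 0%R -> (c ^+ 2 + s ^+ 2 = 1)%R ->
  \int[lambda]_x \int[lambda]_y H (c * x - s * y, s * x + c * y)%R =
  \int[lambda]_x \int[lambda]_y H (x, y).
Proof.
(* With c = cos t and s = sin t this is - tan (t / 2), the coefficient of the two outer shears; the
   middle one has coefficient [s]. *)
move=> mH H0 s0 cs; pose a := ((c - 1) / s)%R.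
pose S1 (p : T * T) := ((p.1 + a * p.2)%R : T, p.2).
pose S2 (p : T * T) := (p.1, (s * p.1 + p.2)%R : T).
have mH1 : measurable_fun setT (H \o S1) := measurableT_comp mH (measurable_shear1 a).
have mH2 : measurable_fun setT ((H \o S1) \o S2) := measurableT_comp mH1 (measurable_shear2 s).
apply: etrans (shear1 a mH H0).
apply: etrans (shear2 s mH1 (fun=> H0 _)).
apply: etrans (shear1 a mH2 (fun=> H0 _)).
apply: eq_integral => x _; apply: eq_integral => y _.
rewrite /= /S1 /S2 /=; congr (H (_, _)); rewrite /a; last by field.
have -> : (c * x - s * y = c * x + ((c ^+ 2 - 1) / s) * y)%R.
  by rewrite -cs opprD addNKr mulNr expr2 mulfK// mulNr.
by field.
Qed.

Let g1E H : measurable_fun setT H -> (forall p, 0 <= H p) ->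
  \int[g1]_x \int[g1]_y H (x, y) =
  \int[lambda]_x \int[lambda]_y (H (x, y) * (phi x * phi y)%:E).
Proof.
move=> mH H0.
have mphi : measurable_fun [set: T] (fun y => (phi y)%:E).
  by apply/measurable_EFinP; exact: measurable_normal_pdf.
have phi0 x : 0 <= (phi x)%:E by rewrite lee_fin normal_pdf_ge0.
rewrite ge0_integral_normal//=; last 2 first.
- exact: (measurable_fun_fubini_tonelli_F H).
- by move=> x; exact: integral_ge0.
apply: eq_integral => x _.
rewrite ge0_integral_normal//=; last exact: measurableT_comp.
rewrite -ge0_integralZr//=; last 2 first.
- by apply: emeasurable_funM => //; exact: measurableT_comp.
- by move=> y _; exact: mule_ge0.
by apply: eq_integral => y _; rewrite -muleA EFinM; congr (_ * _); rewrite muleC.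
Qed.

Let normal_rotation0 (c s : R) H : measurable_fun setT H ->
    (forall p, 0 <= H p) -> s != 0%R -> (c ^+ 2 + s ^+ 2 = 1)%R ->
  \int[g1]_x \int[g1]_y H (c * x - s * y, s * x + c * y)%R =
  \int[g1]_x \int[g1]_y H (x, y).
Proof.
move=> mH H0 s0 cs.
pose K (p : T * T) := H p * (phi p.1 * phi p.2)%:E.
have mK : measurable_fun setT K.
  apply: emeasurable_funM => //; apply/measurable_EFinP.
  by apply: measurable_funM;
    exact: (measurableT_comp (measurable_normal_pdf _ _)).
have K0 p : 0 <= K p by rewrite mule_ge0// lee_fin mulr_ge0// normal_pdf_ge0.
have mHr : measurable_fun setT (H \o rot c s) :=
  measurableT_comp mH (measurable_rot c s).
apply: (etrans (g1E mHr (fun=> H0 _))).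
apply: etrans (esym (g1E mH H0)); apply: etrans (lebesgue_rotation mK K0 s0 cs).
apply: eq_integral => x _; apply: eq_integral => y _; rewrite /K /=.
congr (_ * _%:E); rewrite !normal_pdf01 mulrACA [RHS]mulrACA -!expRD.
congr (_ * expR _)%R.
(* The product of the two densities depends on x^2 + y^2 only, which the rotation preserves. *)
transitivity (- ((c ^+ 2 + s ^+ 2) * (x ^+ 2 + y ^+ 2) / 2))%R; last by field.
by rewrite cs; field.
Qed.

(** For s = 0 the shear coefficient is undefined; then c is 1 or -1, and the map is a composition of
    two quarter turns. *)
Lemma normal_rotation (c s : R) H : measurable_fun setT H ->
    (forall p, 0 <= H p) -> (c ^+ 2 + s ^+ 2 = 1)%R ->
  \int[g1]_x \int[g1]_y H (c * x - s * y, s * x + c * y)%R =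
  \int[g1]_x \int[g1]_y H (x, y).
Proof.
move=> mH H0 cs; have [s0|s0] := eqVneq s 0%R; last exact: normal_rotation0.
have n0 : (-1)%R != 0%R :> R by rewrite oppr_eq0 oner_neq0.
have c0 : c != 0%R.
  apply/eqP => c0; move: cs; rewrite c0 s0 expr0n/= addr0 => /eqP.
  by rewrite eq_sym oner_eq0.
have cs0 : ((0 : R) ^+ 2 + c ^+ 2 = 1)%R by rewrite -cs s0 addrC.
have e1 : ((0 : R) ^+ 2 + (-1) ^+ 2 = 1)%R by ring.
have mH1 : measurable_fun setT (H \o rot 0 c) :=
  measurableT_comp mH (measurable_rot _ _).
apply: etrans (normal_rotation0 mH H0 c0 cs0).
apply: etrans (normal_rotation0 mH1 (fun=> H0 _) n0 e1).
apply: eq_integral => x _; apply: eq_integral => y _; rewrite /rot /=.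
by congr (H (_, _)); rewrite s0; ring.
Qed.

Lemma normal_reflection (F : T -> \bar R) : measurable_fun setT F ->
  (forall x, 0 <= F x) -> \int[g1]_x F (- x)%R = \int[g1]_x F x.
Proof.
move=> mF F0; have n0 : (-1)%R != 0%R :> R by rewrite oppr_eq0 oner_neq0.
under eq_integral do rewrite -mulN1r -[(_ * _)%R]addr0.
rewrite normal_affine//; apply: eq_integral => x _.
rewrite normrN1 invr1 mul1r subr0 invrN1 mulrN1 sqrrN subrr expR0.
by rewrite mule1.
Qed.

Lemma gamma_cons k (F : 'cV[R]_k.+1 -> \bar R) :
  measurable_fun setT F -> (forall z, 0 <= F z) ->
  \int[gamma R k.+1]_z F z =
  \int[g1]_x \int[gamma R k]_y F (cons_cV (x, y)).
Proof.
move=> mF F0; rewrite (@gammaD R 1 k)// gamma1//.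
  have mF' : measurable_fun setT 
    (F \o (fun p : 'cV[R]_1 * 'cV[R]_k => col_mx p.1 p.2)) :=
    measurableT_comp mF (@measurable_col_mx R 1 k).
  exact: (measurable_fun_fubini_tonelli_F (m2 := gamma R k) _ mF' (fun=> F0 _)).
by move=> z; exact: integral_ge0.
Qed.

End rotation.

(** * Laws of linear images *)

Section gaussian_law.
Context (R : realType) (d : nat).
Local Notation g1 := (@normal_prob R 0 1).

Definition glaw k (A : 'M[R]_(d, k)) (F : 'cV[R]_d -> \bar R) : \bar R :=
  (\int[gamma R k]_z F (A *m z))%E.

Implicit Types F : 'cV[R]_d -> \bar R.

Lemma measurable_glaw_fun k (A : 'M[R]_(d, k)) F :
  measurable_fun setT F -> measurable_fun setT (fun z : 'cV[R]_k => F (A *m z)).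
Proof.
by move=> mF; apply: (measurableT_comp mF); exact: measurable_mulmx.
Qed.

Lemma measurable_shift_fun (b : 'cV[R]_d) F :
  measurable_fun setT F -> measurable_fun setT (fun y => F (b + y)).
Proof.
move=> mF; apply: (measurableT_comp mF).
have := measurable_affine (T := 'cV[R]_d) 1%:M b (measurable_id (D := setT)).
by under eq_fun do rewrite mul1mx addrC.
Qed.

Lemma mul_cV1 (a : 'cV[R]_d) (x : R) : a *m cV1 x = x *: a.
Proof. by apply/matrixP => i j; rewrite !mxE big_ord1 !mxE !ord1 mulrC. Qed.

Lemma glaw_row_mx m n (A : 'M[R]_(d, m)) (B : 'M[R]_(d, n)) F :
  measurable_fun setT F -> (forall x, 0 <= F x)%E ->
  glaw (row_mx A B) F = (\int[gamma R m]_x glaw B (fun y => F (A *m x + y)%R))%E.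
Proof.
move=> mF F0; have mF' := measurable_glaw_fun (row_mx A B) mF.
apply: (etrans (gammaD mF' (fun z => F0 (row_mx A B *m z)))).
apply: eq_integral => x _; apply: eq_integral => y _.
by rewrite mul_row_col.
Qed.

Lemma glaw_cons n (a : 'cV[R]_d) (B : 'M[R]_(d, n)) F :
  measurable_fun setT F -> (forall x, 0 <= F x)%E ->
  glaw (row_mx a B) F = (\int[g1]_x glaw B (fun y => F (x *: a + y)%R))%E.
Proof.
move=> mF F0; have mF' := measurable_glaw_fun (row_mx a B) mF.
apply: (etrans (gamma_cons mF' (fun z => F0 (row_mx a B *m z)))).
apply: eq_integral => x _; apply: eq_integral => y _.
by rewrite mul_row_col mul_cV1.
Qed.

(** Compares centred normal laws given by matrices with different numbers of columns. Nonnegative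
    test functions suffice, as signed ones are split in [samelaw_gexp]. *)
Definition samelaw k l (A : 'M[R]_(d, k)) (B : 'M[R]_(d, l)) : Prop :=
  forall F, measurable_fun setT F -> (forall x, 0 <= F x)%E -> glaw A F = glaw B F.

Lemma samelaw_row k l m (A : 'M[R]_(d, m)) (B : 'M[R]_(d, k)) (C : 'M[R]_(d, l)) :
  samelaw B C -> samelaw (row_mx A B) (row_mx A C).
Proof.
move=> BC F mF F0; rewrite (glaw_row_mx A B mF F0) (glaw_row_mx A C mF F0).
apply: eq_integral => x _.
by apply: BC => //; exact: measurable_shift_fun.
Qed.

Lemma samelaw_opp n (a : 'cV[R]_d) (B : 'M[R]_(d, n)) :
  samelaw (row_mx (- a) B) (row_mx a B).
Proof.
move=> F mF F0; rewrite (glaw_cons _ _ mF F0) (glaw_cons (- a) B mF F0).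
pose G x := glaw B (fun y => F (x *: a + y)).
have mG : measurable_fun [set: measurableTypeR R] G.
  have mF' := measurable_glaw_fun (row_mx a B) mF.
  have := measurable_fun_fubini_tonelli_F (m2 := gamma R n) _
    (measurableT_comp mF' (@measurable_cons_cV R n)) (fun=> F0 _).
  rewrite /fubini_F /= /G /glaw; congr measurable_fun.
  apply/funext => x; apply: eq_integral => y _.
  by rewrite mul_row_col mul_cV1.
have G0 x : (0 <= G x)%E by exact: integral_ge0.
apply: etrans (normal_reflection mG G0).
apply: eq_integral => x _; rewrite /G /glaw; apply: eq_integral => y _.
by rewrite scalerN -scaleNr.
Qed.

Lemma samelaw_rot n (a b : 'cV[R]_d) (B : 'M[R]_(d, n)) (c s : R) :
  c ^+ 2 + s ^+ 2 = 1 ->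
  samelaw (row_mx (c *: a + s *: b) (row_mx (c *: b - s *: a) B))
          (row_mx a (row_mx b B)).
Proof.
move=> cs F mF F0.
have E (u v : 'cV[R]_d) : glaw (row_mx u (row_mx v B)) F =
    (\int[g1]_x \int[g1]_y glaw B (fun z => F (x *: u + y *: v + z)%R))%E.
  rewrite (glaw_cons u _ mF F0); apply: eq_integral => x _.
  rewrite (glaw_cons v B (measurable_shift_fun _ mF) (fun=> F0 _)).
  by apply: eq_integral => y _; rewrite /glaw; under eq_integral do rewrite addrA.
rewrite !E.
pose H (p : measurableTypeR R * measurableTypeR R) :=
  glaw B (fun z => F (p.1 *: a + p.2 *: b + z)).
have mH : measurable_fun setT H.
  have mF' := measurable_glaw_fun (row_mx (row_mx a b) B) mF.
  have m2 : measurable_fun setT (fun p : measurableTypeR R * measurableTypeR R =>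
      col_mx (cV1 p.1) (cV1 p.2)).
    have m1 : measurable_fun setT (fun p : measurableTypeR R * measurableTypeR R =>
      (cV1 p.1, cV1 p.2)).
      apply/measurable_fun_pairP; split => /=.
        exact: (measurableT_comp (@measurable_col1 R) (@measurable_fst _ _ _ _)).
      exact: (measurableT_comp (@measurable_col1 R) (@measurable_snd _ _ _ _)).
    exact: (measurableT_comp (@measurable_col_mx R 1 1) m1).
  have m3 : measurable_fun setT
      (fun p : (measurableTypeR R * measurableTypeR R) * 'cV[R]_n =>
        col_mx (col_mx (cV1 p.1.1) (cV1 p.1.2)) p.2).
    have m1 : measurable_fun setT
        (fun p : (measurableTypeR R * measurableTypeR R) * 'cV[R]_n =>
        (col_mx (cV1 p.1.1) (cV1 p.1.2), p.2)).
      apply/measurable_fun_pairP; split => /=; last exact: measurable_snd.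
      exact: (measurableT_comp m2 (@measurable_fst _ _ _ _)).
    exact: (measurableT_comp (@measurable_col_mx R (1 + 1) n) m1).
  have := measurable_fun_fubini_tonelli_F (m2 := gamma R n) _
    (measurableT_comp mF' m3) (fun=> F0 _).
  rewrite /fubini_F /= /H /glaw; congr measurable_fun.
  apply/funext => x; apply: eq_integral => y _.
  by rewrite !mul_row_col !mul_cV1.
have H0 p : (0 <= H p)%E by exact: integral_ge0.
apply: etrans (normal_rotation mH H0 cs).
apply: eq_integral => x _; apply: eq_integral => y _.
rewrite /H /glaw; apply: eq_integral => z _; congr (F (_ + _)) => /=.
by apply/matrixP => i j; rewrite !mxE; ring.
Qed.

Lemma gram_row_mx m n (A : 'M[R]_(d, m)) (B : 'M[R]_(d, n)) :
  row_mx A B *m (row_mx A B)^T = A *m A^T + B *m B^T.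
Proof. by rewrite tr_row_mx mul_row_col. Qed.

(* Rotations of the columns of A preserve both the law of A z and A A^T, and
   move the whole row j into the first column. *)
Lemma pivot_row k (A : 'M[R]_(d, k.+1)) (j : 'I_d) :
  exists (a : 'cV[R]_d) (B : 'M[R]_(d, k)),
    [/\ 0 <= a j ord0, forall l, B j l = 0,
        A *m A^T = a *m a^T + B *m B^T & samelaw A (row_mx a B)].
Proof.
elim: k A => [|k IH] A.
  have EA (a : 'cV[R]_d) : row_mx a (0 : 'M[R]_(d, 0)) = a.
    apply/matrixP => i l; case: (@split_ordP 1 0 l) => p ->; last by case: p.
    by rewrite row_mxEl; congr (a i _); exact: val_inj.
  have B0 (B : 'M[R]_(d, 0)) : B *m B^T = 0.
    by apply/matrixP => i l; rewrite !mxE big_ord0.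
  have [Aj|Aj] := leP 0 (A j ord0).
    by exists A, 0; split => //; [move=> [] |rewrite B0 addr0|rewrite EA].
  exists (- A), 0; split; last by move=> F mF F0; rewrite samelaw_opp// EA.
  - by rewrite mxE oppr_ge0 ltW.
  - by move=> [].
  - by rewrite B0 addr0 linearN/= mulmxN mulNmx opprK.
rewrite -[A](@hsubmxK _ d 1 k.+1).
move: (@lsubmx _ d 1 k.+1 A) (@rsubmx _ d 1 k.+1 A) => a A2.
have [b [B [bj Bj EB SB]]] := IH A2.
have S1 : samelaw (row_mx a A2) (row_mx a (row_mx b B)) by exact: samelaw_row.
have EG : row_mx a A2 *m (row_mx a A2)^T = a *m a^T + (b *m b^T + B *m B^T).
  by rewrite gram_row_mx EB.
have [r rge0 r2] : exists2 r, 0 <= r & r ^+ 2 = a j ord0 ^+ 2 + b j ord0 ^+ 2.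
  exists (Num.sqrt (a j ord0 ^+ 2 + b j ord0 ^+ 2)); first exact: sqrtr_ge0.
  by rewrite sqr_sqrtr// addr_ge0// sqr_ge0.
have [r0|r0] := eqVneq r 0.
  move: r2; rewrite r0 expr0n/= => /esym/eqP.
  rewrite paddr_eq0 ?sqr_ge0// !sqrf_eq0 => /andP[/eqP a0 /eqP b0].
  exists a, (row_mx b B); split => //; first by rewrite a0.
    move=> l; case: (@split_ordP 1 k l) => i ->.
      by rewrite (@row_mxEl _ d 1 k b B j i) (ord1 i).
    by rewrite (@row_mxEr _ d 1 k b B j i).
  by rewrite EG (gram_row_mx b B).
(* Givens rotation sending the two entries of row [j] to (r, 0). *)
pose c := a j ord0 / r; pose s := b j ord0 / r.
have cs : c ^+ 2 + s ^+ 2 = 1.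
  by rewrite /c /s !expr_div_n -mulrDl -r2 divff// sqrf_eq0.
exists (c *: a + s *: b), (row_mx (c *: b - s *: a) B); split.
- rewrite !mxE (_ : _ + _ = r)// /c /s.
  rewrite -[RHS](mulfK r0) -expr2 r2; field; exact: r0.
- move=> l; case: (@split_ordP 1 k l) => i ->.
    rewrite (@row_mxEl _ d 1 k _ B j i) (ord1 i) !mxE /c /s; field; exact: r0.
  by rewrite (@row_mxEr _ d 1 k _ B j i).
- rewrite EG (gram_row_mx (c *: b - s *: a) B) addrA addrA; congr (_ + _).
  apply/matrixP => p q; rewrite !mxE !big_ord1 !mxE.
  rewrite -[LHS]mul1r -cs; ring.
- by move=> F mF F0; rewrite samelaw_rot//; exact: S1.
Qed.

Lemma gram_diag k (A : 'M[R]_(d, k)) i : (A *m A^T) i i = \sum_l A i l ^+ 2.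
Proof. by rewrite mxE; apply: eq_bigr => l _; rewrite mxE expr2. Qed.

Lemma gram_diag_ge0 k (A : 'M[R]_(d, k)) i : 0 <= (A *m A^T) i i.
Proof. by rewrite gram_diag sumr_ge0// => l _; rewrite sqr_ge0. Qed.

Lemma gram_diag_eq0 k (A : 'M[R]_(d, k)) i :
  (A *m A^T) i i = 0 -> forall l, A i l = 0.
Proof.
rewrite gram_diag => /eqP; rewrite psumr_eq0 => [/allP h l|l _]; last exact: sqr_ge0.
by have := h l (mem_index_enum _); rewrite /= sqrf_eq0 => /eqP.
Qed.

Lemma glaw0 k F : glaw (0 : 'M[R]_(d, k)) F = F 0.
Proof.
rewrite /glaw; under eq_integral do rewrite mul0mx.
rewrite integral_cst// -[RHS]mule1; congr (_ * _)%E.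
exact: (probability_setT (gamma R k)).
Qed.

(** Read off the Gram diagonal, hence a function of the covariance alone. Its cardinal is the
    induction measure of [gram_samelaw] and [gaussian_dcx]. *)
Definition nzrows k (A : 'M[R]_(d, k)) : {set 'I_d} :=
  finset (fun i => (A *m A^T) i i != 0).

Lemma nzrows_proper k l (A : 'M[R]_(d, k)) (B : 'M[R]_(d, l))
    (a : 'cV[R]_d) j :
  (A *m A^T) j j != 0 -> A *m A^T = a *m a^T + B *m B^T ->
  (forall l, B j l = 0) ->
  (#|nzrows B| < #|nzrows A|)%N.
Proof.
move=> Aj E Bj; apply: proper_card; apply/fintype.properP; split.
  apply/fintype.subsetP => i; rewrite !inE; apply: contra => /eqP; rewrite E mxE.
  by move/eqP; rewrite paddr_eq0 ?gram_diag_ge0// => /andP[].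
exists j; rewrite !inE// negbK gram_diag.
by rewrite big1// => i _; rewrite Bj expr0n.
Qed.

Lemma gram_row0 k (B : 'M[R]_(d, k)) j : (forall l, B j l = 0) ->
  forall i, (B *m B^T) j i = 0.
Proof. by move=> Bj i; rewrite mxE big1// => l _; rewrite Bj mul0r. Qed.

(* The common Gram matrix determines the first column after pivot_row; the
   remaining columns have fewer nonzero rows. *)
Lemma gram_samelaw k l (A : 'M[R]_(d, k)) (B : 'M[R]_(d, l)) :
  A *m A^T = B *m B^T -> samelaw A B.
Proof.
have [n] := ubnP #|nzrows A|.
elim: n => // n IH in k l A B *; rewrite ltnS => cA AB.
have [/finset.set0Pn[j]|] := boolP (nzrows A != finset.set0); last first.
  rewrite negbK => /eqP A0.
  have An i : (A *m A^T) i i = 0.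
    by apply/eqP/negPn/negP => h; have := finset.in_set0 i; rewrite -A0 inE h.
  have -> : A = 0.
    by apply/matrixP => i q; rewrite mxE (gram_diag_eq0 (An i)).
  have -> : B = 0.
    by apply/matrixP => i q; rewrite mxE gram_diag_eq0// -AB.
  by move=> F mF F0; rewrite !glaw0.
rewrite inE => Aj.
case: k => [|k] in A cA AB Aj *; first by rewrite mxE big_ord0 eqxx in Aj.
case: l => [|l] in B AB *.
  by rewrite AB mxE big_ord0 eqxx in Aj.
have [a [A' [aj A'j EA SA]]] := pivot_row A j.
have [b [B' [bj B'j EB SB]]] := pivot_row B j.
have jE i : a j ord0 * a i ord0 = b j ord0 * b i ord0.
  have := congr1 (fun M : 'M[R]_d => M j i) AB.
  rewrite /= EA EB mxE [in RHS]mxE (gram_row0 A'j) (gram_row0 B'j) !addr0.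
  by rewrite mxE [in RHS]mxE !big_ord1 !mxE.
(* The nonnegative pivots of [pivot_row] fix the sign left open by equality of squares. *)
have abj : a j ord0 = b j ord0.
  by apply/eqP; rewrite -(eqrXn2 (n := 2))// !expr2 jE.
have aj0 : a j ord0 != 0.
  apply: contra Aj => /eqP aj0.
  by rewrite EA mxE (gram_row0 A'j) addr0 mxE big_ord1 mxE aj0 mul0r.
have ab : a = b.
  apply/matrixP => i q; rewrite (ord1 q); apply: (mulfI aj0).
  by rewrite jE abj.
have AB' : A' *m A'^T = B' *m B'^T.
  by apply: (addrI (a *m a^T)); rewrite -EA AB EB ab.
have S : samelaw A' B'.
  by apply: IH => //; apply: leq_trans cA; apply: nzrows_proper Aj EA A'j.
by move=> F mF F0; rewrite SA// SB// ab; apply: samelaw_row.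
Qed.

End gaussian_law.

(** * Gaussian expectations *)

Section gaussian_expectation.
Context (R : realType) (d : nat).
Implicit Types f g : 'cV[R]_d -> R.

Definition gexp k (A : 'M[R]_(d, k)) f : \bar R :=
  (\int[gamma R k]_z (f (A *m z))%:E)%E.

Definition gint k (A : 'M[R]_(d, k)) f : Prop :=
  (gamma R k).-integrable setT (fun z => (f (A *m z))%:E).

Lemma measurable_gfun k (A : 'M[R]_(d, k)) f : measurable_fun setT f ->
  measurable_fun setT (fun z : 'cV[R]_k => (f (A *m z))%:E).
Proof.
move=> mf; apply/measurable_EFinP; apply: (measurableT_comp mf).
exact: measurable_mulmx.
Qed.

Lemma gintP k (A : 'M[R]_(d, k)) f : measurable_fun setT f ->
  gint A f <-> (glaw A (fun x => `|f x|%:E) < +oo)%E.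
Proof.
move=> mf; split=> [/integrableP[_]//|h]; apply/integrableP; split => //.
exact: measurable_gfun.
Qed.

Lemma samelaw_gint k l (A : 'M[R]_(d, k)) (B : 'M[R]_(d, l)) f :
  measurable_fun setT f -> samelaw A B -> gint A f -> gint B f.
Proof.
move=> mf AB /(gintP _ mf) h; apply/(gintP _ mf); rewrite -AB//.
apply/measurable_EFinP; exact: measurableT_comp.
Qed.

Lemma samelaw_gexp k l (A : 'M[R]_(d, k)) (B : 'M[R]_(d, l)) f :
  measurable_fun setT f -> samelaw A B -> gexp A f = gexp B f.
Proof.
move=> mf AB; have mf' : measurable_fun setT (EFin \o f) by exact/measurable_EFinP.
have E m (C : 'M[R]_(d, m)) : gexp C f =
    (glaw C ((EFin \o f)^\+) - glaw C ((EFin \o f)^\-))%E.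
  rewrite /gexp /glaw integralE; congr (_ - _)%E; apply: eq_integral => z _.
    by rewrite !funeposE.
  by rewrite !funenegE.
rewrite !E; congr (_ - _)%E; apply: AB => //.
- exact: measurable_funepos.
- exact: measurable_funeneg.
Qed.

Lemma le_gexp k (A : 'M[R]_(d, k)) f g : gint A f -> gint A g ->
  (forall x, f x <= g x) -> (gexp A f <= gexp A g)%E.
Proof.
by move=> fi gi fg; apply: le_integral => // z _; rewrite lee_fin.
Qed.

(* All comparisons reduce to averaging a pointwise inequality between four
   values whose arguments have only two different laws. *)
Section four_points.
Context (k m n : nat) (A1 A2 B1 B2 : 'M[R]_(d, k)) (A : 'M[R]_(d, m))
  (B : 'M[R]_(d, n)) (f g : 'cV[R]_d -> R).
Hypotheses (mf : measurable_fun setT f) (mg : measurable_fun setT g)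
  (A1A : samelaw A1 A) (A2A : samelaw A2 A)
  (B1B : samelaw B1 B) (B2B : samelaw B2 B)
  (fg : forall z, f (A1 *m z) + f (A2 *m z) <= g (B1 *m z) + g (B2 *m z)).

Let samelawC p q (M : 'M[R]_(d, p)) (N : 'M[R]_(d, q)) :
  samelaw M N -> samelaw N M.
Proof. by move=> MN F mF F0; rewrite MN. Qed.

Lemma four_points_le : gint A f -> gint B g -> (gexp A f <= gexp B g)%E.
Proof.
move=> fi gi.
have f1 := samelaw_gint mf (samelawC A1A) fi.
have f2 := samelaw_gint mf (samelawC A2A) fi.
have g1 := samelaw_gint mg (samelawC B1B) gi.
have g2 := samelaw_gint mg (samelawC B2B) gi.
have h : (gexp A1 f + gexp A2 f <= gexp B1 g + gexp B2 g)%E.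
  rewrite /gexp -integralD// -integralD//; apply: le_integral => //.
  - exact: integrableD.
  - exact: integrableD.
  - by move=> z _; rewrite -!EFinD lee_fin.
move: h; rewrite (samelaw_gexp mf A1A) (samelaw_gexp mf A2A).
rewrite (samelaw_gexp mg B1B) (samelaw_gexp mg B2B).
have := integrable_fin_num measurableT fi; have := integrable_fin_num measurableT gi.
rewrite -/(gexp A f) -/(gexp B g).
case: (gexp A f) => [a||]//; case: (gexp B g) => [b||]// _ _.
by rewrite -!EFinD !lee_fin => ab; lra.
Qed.

(** The inequality bounds [f] at one point above by values of [g] and the negative part of [f] at
    the other point. Control of negative parts thus suffices to pass integrability from [g] to
    [f]. *)
Lemma four_points_integrable : gint A (fun x => Num.max (- f x) 0) -> gint B g ->
  gint A f.
Proof.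
have mfn : measurable_fun setT (fun x => Num.max (- f x) 0).
  by apply: measurable_maxr => //; exact: measurableT_comp.
move=> fi gi; apply: (samelaw_gint mf A1A).
have f1 := samelaw_gint mfn (samelawC A1A) fi.
have f2 := samelaw_gint mfn (samelawC A2A) fi.
have g1 := samelaw_gint mg (samelawC B1B) gi.
have g2 := samelaw_gint mg (samelawC B2B) gi.
have := integrableD measurableT (integrableD measurableT f1 f2)
  (integrableD measurableT (integrable_norm g1) (integrable_norm g2)).
apply: le_integrable => //; first exact: measurable_gfun.
move=> z _; rewrite /= lee_fin.
have := fg z; move: (f (A1 *m z)) (f (A2 *m z)) (g (B1 *m z)) (g (B2 *m z)).
move=> a1 a2 b1 b2 h.
have m1 := ler_norm b1; have m2 := ler_norm b2.
have m3 := normr_ge0 b1; have m4 := normr_ge0 b2.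
have M1 : - a1 <= Num.max (- a1) 0 by rewrite le_max lexx.
have M2 : - a2 <= Num.max (- a2) 0 by rewrite le_max lexx.
have M3 : 0 <= Num.max (- a1) 0 by rewrite le_max lexx orbT.
have M4 : 0 <= Num.max (- a2) 0 by rewrite le_max lexx orbT.
rewrite [leRHS]ger0_norm; last by rewrite !addr_ge0.
by rewrite ler_norml; apply/andP; split; lra.
Qed.

End four_points.

End gaussian_expectation.

(** * Quadratic forms *)

Section dot_product.
Context (R : realType).

Definition dot n (x y : 'cV[R]_n) : R := (x^T *m y) ord0 ord0.

Definition sqn n (x : 'cV[R]_n) : R := dot x x.

Lemma dotE n (x y : 'cV[R]_n) : dot x y = \sum_i x i ord0 * y i ord0.
Proof. by rewrite /dot mxE; apply: eq_bigr => i _; rewrite mxE. Qed.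

Lemma dotC n (x y : 'cV[R]_n) : dot x y = dot y x.
Proof. by rewrite !dotE; apply: eq_bigr => i _; rewrite mulrC. Qed.

Lemma dotDl n (x y z : 'cV[R]_n) : dot (x + y) z = dot x z + dot y z.
Proof. by rewrite /dot linearD/= mulmxDl mxE. Qed.

Lemma dotDr n (x y z : 'cV[R]_n) : dot x (y + z) = dot x y + dot x z.
Proof. by rewrite /dot mulmxDr mxE. Qed.

Lemma dotZl n (a : R) (x z : 'cV[R]_n) : dot (a *: x) z = a * dot x z.
Proof. by rewrite /dot linearZ/= -scalemxAl mxE. Qed.

Lemma dotZr n (a : R) (x z : 'cV[R]_n) : dot x (a *: z) = a * dot x z.
Proof. by rewrite dotC dotZl dotC. Qed.

Lemma dot0l n (z : 'cV[R]_n) : dot 0 z = 0.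
Proof. by rewrite /dot linear0 mul0mx mxE. Qed.

Lemma dot0r n (z : 'cV[R]_n) : dot z 0 = 0.
Proof. by rewrite /dot mulmx0 mxE. Qed.

Lemma dotNr n (x y : 'cV[R]_n) : dot x (- y) = - dot x y.
Proof. by rewrite -scaleN1r dotZr mulN1r. Qed.

Lemma dot_mull n m (A : 'M[R]_(n, m)) x y : dot (A *m x) y = dot x (A^T *m y).
Proof. by rewrite /dot trmx_mul mulmxA. Qed.

Lemma dot_mulr n m (A : 'M[R]_(n, m)) x y : dot x (A *m y) = dot (A^T *m x) y.
Proof. by rewrite dot_mull trmxK. Qed.

Lemma dot_deltal n (i : 'I_n) (y : 'cV[R]_n) :
  dot (delta_mx i ord0) y = y i ord0.
Proof.
rewrite dotE (bigD1 i)//= mxE !eqxx mul1r big1 ?addr0// => j ji.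
by rewrite mxE (negbTE ji) mul0r.
Qed.

Lemma sqn_ge0 n (x : 'cV[R]_n) : 0 <= sqn x.
Proof. by rewrite /sqn dotE sumr_ge0// => i _; rewrite -expr2 sqr_ge0. Qed.

Lemma sqn_eq0 n (x : 'cV[R]_n) : sqn x = 0 -> x = 0.
Proof.
rewrite /sqn dotE => /eqP; rewrite psumr_eq0 => [/allP h|i _]; last first.
  by rewrite -expr2 sqr_ge0.
apply/matrixP => i j; rewrite (ord1 j) mxE; apply/eqP.
by have := h i (mem_index_enum _); rewrite /= mulf_eq0 orbb.
Qed.

Lemma sqn_coord n (x : 'cV[R]_n) i : x i ord0 ^+ 2 <= sqn x.
Proof.
rewrite /sqn dotE (bigD1 i)//= -expr2 lerDl sumr_ge0// => j _.
by rewrite -expr2 sqr_ge0.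
Qed.

Lemma sqnZ n (a : R) (x : 'cV[R]_n) : sqn (a *: x) = a ^+ 2 * sqn x.
Proof. by rewrite /sqn dotZl dotZr mulrA expr2. Qed.

Lemma sqnD n (x y : 'cV[R]_n) : sqn (x + y) = sqn x + 2 * dot x y + sqn y.
Proof. by rewrite /sqn dotDl !dotDr [dot y x]dotC; ring. Qed.

Lemma dot_AMGM n (x y : 'cV[R]_n) (c : R) : 0 < c ->
  2 * dot x y <= c * sqn x + c^-1 * sqn y.
Proof.
move=> c0; have := sqn_ge0 (c *: x + (- 1) *: y).
rewrite sqnD !sqnZ dotZl dotZr => h.
rewrite -(ler_pM2l c0).
have -> : c * (c * sqn x + c^-1 * sqn y) = c ^+ 2 * sqn x + sqn y.
  by field; rewrite gt_eqF.
lra.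
Qed.

Lemma sqnD_le n (x y : 'cV[R]_n) (c : R) : 0 < c ->
  sqn (x + y) <= (1 + c) * sqn x + (1 + c^-1) * sqn y.
Proof.
by move=> c0; have := dot_AMGM x y c0; rewrite sqnD; lra.
Qed.

Lemma cauchy_schwarz n (x y : 'cV[R]_n) : dot x y ^+ 2 <= sqn x * sqn y.
Proof.
have [x0|x0] := eqVneq (sqn x) 0.
  by rewrite (sqn_eq0 x0) dot0l expr0n/= mulr_ge0// sqn_ge0.
have xp : 0 < sqn x by rewrite lt_neqAle eq_sym x0 sqn_ge0.
have := sqn_ge0 (sqn x *: y + (- dot x y) *: x).
rewrite sqnD !sqnZ dotZl dotZr [dot y x]dotC => h.
rewrite -(ler_pM2l xp); move: h; lra.
Qed.

Lemma dot_gram n k (A : 'M[R]_(n, k)) x y :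
  dot x (A *m A^T *m y) = dot (A^T *m x) (A^T *m y).
Proof. by rewrite -mulmxA dot_mulr. Qed.

Lemma sqn_col_mx m n (x : 'cV[R]_m) (y : 'cV[R]_n) :
  sqn (col_mx x y) = sqn x + sqn y.
Proof. by rewrite /sqn /dot tr_col_mx mul_row_col mxE. Qed.

Lemma psdE n (M : 'M[R]_n) : psd M <-> M^T = M /\ forall x, 0 <= dot x (M *m x).
Proof.
by rewrite /psd /dot; split=> -[h1 h2]; split=> // x; have := h2 x;
  rewrite mulmxA.
Qed.

Lemma psd_gram n k (A : 'M[R]_(n, k)) : psd (A *m A^T).
Proof.
by apply/psdE; split=> [|x]; [rewrite trmx_mul trmxK|rewrite dot_gram sqn_ge0].
Qed.

Lemma psdD n (M N : 'M[R]_n) : psd M -> psd N -> psd (M + N).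
Proof.
move=> /psdE[M1 M2] /psdE[N1 N2]; apply/psdE; split=> [|x].
  by rewrite linearD/= M1 N1.
by rewrite mulmxDl dotDr addr_ge0.
Qed.

Lemma psdZ n (a : R) (M : 'M[R]_n) : 0 <= a -> psd M -> psd (a *: M).
Proof.
move=> a0 /psdE[M1 M2]; apply/psdE; split=> [|x]; first by rewrite linearZ/= M1.
by rewrite -scalemxAl dotZr mulr_ge0.
Qed.

Lemma psd_diag n (r : 'rV[R]_n) : (forall i, 0 <= r ord0 i) -> psd (diag_mx r).
Proof.
move=> r0; apply/psdE; split=> [|x]; first by rewrite tr_diag_mx.
rewrite dotE sumr_ge0// => i _; rewrite mul_diag_mx mxE mulrCA mulr_ge0//.
by rewrite -expr2 sqr_ge0.
Qed.

(** Schur complement: the reduced form at [x] is the minimum of the form of [M] on the line through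
    [x] in the [j]-th direction. *)
Lemma psd_pivot n (M : 'M[R]_n) j : psd M -> 0 < M j j ->
  psd (M - (M j j)^-1 *: (col j M *m (col j M)^T)).
Proof.
move=> /psdE[M1 M2] Mj; apply/psdE; split=> [|x].
  by rewrite linearB/= linearZ/= trmx_mul trmxK M1.
set c := col j M; set b := dot c x.
have ce : c = M *m delta_mx j ord0 by rewrite /c colE.
have eM y : dot (delta_mx j ord0) (M *m y) = dot c y.
  by rewrite dot_mulr M1 -ce.
have h := M2 (x + (- (b / M j j)) *: delta_mx j ord0).
have Mje : dot c (delta_mx j ord0) = M j j by rewrite dotC dot_deltal mxE.
move: h; rewrite mulmxDr -scalemxAr dotDl !dotDr !dotZl !dotZr !eM Mje.
have -> : dot x (M *m delta_mx j ord0) = b by rewrite -ce dotC.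
rewrite mulmxBl dotDr dotNr -scalemxAl dotZr -mulmxA.
have -> : dot x (c *m (c^T *m x)) = b ^+ 2.
  by rewrite dot_mulr dotE big_ord1 -expr2.
suff -> : dot x (M *m x) + - (b / M j j) * b +
  (- (b / M j j) * b + - (b / M j j) * (- (b / M j j) * M j j)) =
  dot x (M *m x) - (M j j)^-1 * b ^+ 2 by [].
by field; rewrite gt_eqF.
Qed.

Lemma psd_diag_ge0 n (M : 'M[R]_n) i : psd M -> 0 <= M i i.
Proof.
move=> /psdE[_ /(_ (delta_mx i ord0))]; rewrite dot_deltal -colE mxE //.
Qed.

(** A zero diagonal entry makes the form affine in t along t e_i + e_j; a nonzero slope would make
    it negative somewhere. *)
Lemma psd_diag0 n (M : 'M[R]_n) i j : psd M -> M i i = 0 -> M i j = 0.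
Proof.
move=> pM Mi; have Mj := psd_diag_ge0 j pM; case/psdE: pM => M1 M2.
have Mji : M j i = M i j by rewrite -[in RHS]M1 mxE.
(* At this [t] the form equals - M j j - 2. *)
apply/eqP/negPn/negP => Mij0; pose t := - (M j j + 1) / M i j.
have := M2 (t *: delta_mx i ord0 + delta_mx j ord0).
rewrite mulmxDr -scalemxAr dotDl !dotDr !dotZl !dotZr !dot_deltal -!colE !mxE.
rewrite Mi Mji /t.
have -> : - (M j j + 1) / M i j * (- (M j j + 1) / M i j * 0) +
  - (M j j + 1) / M i j * M i j + (- (M j j + 1) / M i j * M i j + M j j) =
  - M j j - 2 by field.
by lra.
Qed.

(** Cholesky elimination. Each pivot clears one diagonal entry, and [psd_diag0] leaves the entries
    that are already zero untouched. *)
Lemma psd_factor n (M : 'M[R]_n) : psd M ->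
  exists k (B : 'M[R]_(n, k)), M = B *m B^T.
Proof.
have [p] := ubnP #|finset (fun i => M i i != 0)|.
elim: p => // p IH in M *; rewrite ltnS => cM pM.
have [/finset.set0Pn[j]|] := boolP (finset (fun i => M i i != 0) != finset.set0);
  last first.
  rewrite negbK => /eqP M0; exists 0%N, 0.
  rewrite mul0mx; apply/matrixP => i j; rewrite mxE psd_diag0//.
  by apply/eqP/negPn/negP => h; have := finset.in_set0 i; rewrite -M0 inE h.
rewrite inE => Mj0.
have Mj : 0 < M j j by rewrite lt_neqAle eq_sym Mj0 psd_diag_ge0.
have pN := psd_pivot pM Mj.
set N := M - _ in pN.
have Mij i : M j i = M i j by case/psdE: pM => M1 _; rewrite -[in RHS]M1 mxE.
have NE i l : N i l = M i l - (M j j)^-1 * (M i j * M l j).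
  by rewrite /N !mxE big_ord1 !mxE.
have cN : (#|finset (fun i => N i i != 0%R)| < p)%N.
  apply: leq_trans cM; apply: proper_card; apply/fintype.properP; split.
    apply/fintype.subsetP => i; rewrite !inE; apply: contra => /eqP Mi.
    by rewrite NE Mi (psd_diag0 j pM Mi) mul0r mulr0 subr0.
  exists j; rewrite !inE// negbK NE mulKf ?subrr//.
have [k [B NB]] := IH N cN pN.
exists (1 + k)%N, (row_mx ((Num.sqrt (M j j))^-1 *: col j M) B).
rewrite gram_row_mx -NB /N linearZ/= -scalemxAl -scalemxAr scalerA.
rewrite -invfM -expr2 sqr_sqrtr ?ltW//; by rewrite addrC subrK.
Qed.

End dot_product.

(** * Two duality theorems *)

Section duality.
Context (R : realType).

(** Row vectors match [rV_compact], the source of compact boxes. *)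
Lemma continuous_dot n (a : 'cV[R]_n) :
  continuous (fun v : 'rV[R]_n => dot v^T a).
Proof.
have -> : (fun v : 'rV[R]_n => dot v^T a) =
    (fun v => \sum_i v ord0 i * a i ord0).
  by apply/funext => v; rewrite dotE; apply: eq_bigr => i _; rewrite mxE.
apply: continuous_big => [|i _ x].
  exact: add_continuous.
by apply: (@continuousM R); [exact: coord_continuous|exact: cst_continuous].
Qed.

Lemma continuous_sqn_mul n k (A : 'M[R]_(n, k)) :
  continuous (fun v : 'rV[R]_n => sqn (A^T *m v^T)).
Proof.
have -> : (fun v : 'rV[R]_n => sqn (A^T *m v^T)) =
    (fun v => \sum_l dot v^T (col l A) * dot v^T (col l A)).
  apply/funext => v; rewrite /sqn dotE; apply: eq_bigr => l _.
  suff -> : (A^T *m v^T) l ord0 = dot v^T (col l A) by [].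
  by rewrite dotE mxE; apply: eq_bigr => i _; rewrite !mxE mulrC.
apply: continuous_big => [|i _ x].
  exact: add_continuous.
by apply: (@continuousM R _ (fun v => dot v^T (col i A)));
  exact: continuous_dot.
Qed.

Lemma compact_box n (B : 'I_n -> R) :
  compact [set v : 'rV[R]_n | forall i, v ord0 i \in `[0, B i]].
Proof.
by apply: (rV_compact (A := fun i => `[0, B i]%classic)) => i;
  exact: segment_compact.
Qed.

(** Up to sign, the objective is the Lagrange dual of minimising |y|^2 subject to a <= A y, plus a
    ridge term; the box guarantees a minimiser. *)
Lemma box_minimizer n k (A : 'M[R]_(n, k)) (dl : R) (a : 'cV[R]_n) (K : R) :
  0 <= K ->
  exists2 l : 'cV[R]_n, (forall i, 0 <= l i ord0 <= K) &
    forall m : 'cV[R]_n, (forall i, 0 <= m i ord0 <= K) ->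
      sqn (A^T *m l) + dl * sqn l - 2 * dot l a <=
      sqn (A^T *m m) + dl * sqn m - 2 * dot m a.
Proof.
move=> K0.
pose f (v : 'rV[R]_n) := sqn (A^T *m v^T) + dl * sqn v^T - 2 * dot v^T a.
have cf : continuous f.
  have csq : continuous (fun v : 'rV[R]_n => sqn v^T).
    have := @continuous_sqn_mul n n 1%:M.
    by under eq_fun do rewrite trmx1 mul1mx.
  pose f1 (v : 'rV[R]_n) := sqn (A^T *m v^T).
  pose f2 (v : 'rV[R]_n) := dl * sqn v^T.
  pose f3 (v : 'rV[R]_n) := 2 * dot v^T a.
  have c2 : continuous f2.
    move=> x; apply: (@continuousM R _ (cst dl) (fun v => sqn v^T)) (csq x).
    exact: cst_continuous.
  have c3 : continuous f3.
    move=> x; apply: (@continuousM R _ (cst 2) (fun v => dot v^T a)).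
      exact: cst_continuous.
    exact: continuous_dot.
  move=> x; apply: (@continuousB R R^o _ (f1 \+ f2) f3 x) (c3 x).
  exact: (@continuousD R R^o _ f1 f2 x (@continuous_sqn_mul n k A x) (c2 x)).
have box0 : [set v : 'rV[R]_n | forall i, v ord0 i \in `[0, K]] !=set0.
  by exists 0 => i; rewrite mxE in_itv/= lexx.
have [c + cmin] := compact_EVT_min box0 (@compact_box n (fun=> K))
  (continuous_subspaceT cf).
rewrite inE /= => cK; exists c^T => [i|m mK].
  by have := cK i; rewrite in_itv/= mxE.
have := cmin m^T; rewrite /f trmxK; apply; rewrite inE/= => i.
by rewrite in_itv/= mxE.
Qed.

(* The least-norm y with B w <= A y has the form A^T l with l >= 0 solving the
   dual quadratic program; a multiple of u absorbs the error made by
   regularising that program. *)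
Lemma dominating_point n k m (A : 'M[R]_(n, k)) (B : 'M[R]_(n, m))
    (u : 'cV[R]_k) (c eta : R) :
  (forall i, (forall l, A i l = 0) \/ 1 <= (A *m u) i ord0) ->
  (forall l : 'cV[R]_n, (forall i, 0 <= l i ord0) ->
    sqn (B^T *m l) <= c * sqn (A^T *m l)) ->
  0 < c -> 0 < eta ->
  forall w, exists2 y, (forall i, (B *m w) i ord0 <= (A *m y) i ord0) &
    sqn y <= c * (1 + eta) * sqn w.
Proof.
move=> Au BA c0 eta0 w.
pose U := sqn u.
have U0 : 0 <= U := sqn_ge0 u.
(* Chosen so that the final error e + (e^2 + e) U is at most [eta], using e <= 1. *)
pose e := Num.min 1 (eta / (1 + 2 * U)).
have U1 : 0 < 1 + 2 * U by lra.
have e0 : 0 < e by rewrite lt_min ltr01 divr_gt0.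
have e1 : e <= 1 by rewrite ge_min lexx.
have eU : e * (1 + 2 * U) <= eta by rewrite -ler_pdivlMr// ge_min lexx orbT.
pose dl := e ^+ 2.
have dl0 : 0 < dl by rewrite exprn_gt0.
pose a := B *m w.
pose K := 1 + 4 * sqn a / dl ^+ 2.
have sa0 := sqn_ge0 a.
have d2 : 0 < dl ^+ 2 by rewrite exprn_gt0.
have sd : 0 <= 4 * sqn a / dl ^+ 2 by rewrite divr_ge0 ?mulr_ge0// ltW.
have K0 : 0 <= K by rewrite /K; lra.
have [l lK lmin] := box_minimizer A dl a K0.
have l0 i : 0 <= l i ord0 by case/andP: (lK i).
have lltK i : l i ord0 < K.
  have h1 : dl * sqn l <= 2 * dot l a.
    have z0 (q : 'I_n) : 0 <= (0 : 'cV[R]_n) q ord0 <= K by rewrite mxE lexx.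
    have := lmin 0 z0; rewrite mulmx0 /sqn !dot0l mulr0 addr0.
    by have := sqn_ge0 (A^T *m l); rewrite /sqn; lra.
  have dl20 : 0 < dl / 2 by rewrite divr_gt0.
  have h2 := dot_AMGM l a dl20.
  have E : (dl / 2)^-1 = 2 / dl by rewrite invf_div.
  have h3 : sqn l <= 4 * sqn a / dl ^+ 2.
    rewrite ler_pdivlMr// expr2 mulrA -ler_pdivlMr//.
    rewrite E in h2; have : 2 * sqn a / dl * 2 = 4 * sqn a / dl by ring.
    have : 2 / dl * sqn a = 2 * sqn a / dl by ring.
    lra.
  have h4 := sqn_coord l i.
  have h5 : K <= K ^+ 2 by rewrite ler_eXnr// /K; lra.
  have : l i ord0 ^+ 2 < K ^+ 2 by rewrite /K in h5 *; lra.
  by rewrite ltr_pXn2r// nnegrE.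
pose y0 := A^T *m l.
(* First-order optimality: otherwise raising the [i]-th coordinate by [t] would lower the objective
   by at least t (2 g - t q) > 0. *)
have kkt i : a i ord0 <= (A *m y0) i ord0 + dl * l i ord0.
  rewrite leNgt; apply/negP => hi.
  pose g := a i ord0 - ((A *m y0) i ord0 + dl * l i ord0).
  have g0 : 0 < g by rewrite /g; lra.
  pose q := 1 + sqn (A^T *m delta_mx i ord0) + dl.
  have q0 : 0 < q.
    by have := sqn_ge0 (A^T *m delta_mx i (ord0 : 'I_1)); rewrite /q; lra.
  pose t := Num.min (K - l i ord0) (g / q).
  have t0 : 0 < t by rewrite lt_min divr_gt0// andbT subr_gt0.
  have tK : t <= K - l i ord0 by rewrite ge_min lexx.
  have tq : t * q <= g by rewrite -ler_pdivlMr// ge_min lexx orbT.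
  have := lmin (l + t *: delta_mx i ord0).
  have -> : A^T *m (l + t *: delta_mx i ord0) =
      y0 + t *: (A^T *m delta_mx i ord0) by rewrite mulmxDr -scalemxAr.
  rewrite !sqnD !sqnZ !dotZr dotDl dotZl dot_deltal.
  have -> : dot y0 (A^T *m delta_mx i ord0) = (A *m y0) i ord0.
    by rewrite dot_mulr trmxK dotC dot_deltal.
  have -> : dot l (delta_mx i ord0) = l i ord0 by rewrite dotC dot_deltal.
  have -> : sqn (delta_mx i ord0 : 'cV[R]_n) = 1.
    by rewrite /sqn dot_deltal mxE !eqxx.
  rewrite -/y0 => h.
  have : 0 <= t * (t * q - 2 * g).
    suff : 0 <= t ^+ 2 * (sqn (A^T *m delta_mx i ord0) + dl) - 2 * t * g.
      rewrite /q => H.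
      have : 0 <= t ^+ 2 by rewrite sqr_ge0.
      by move: H; set S := sqn _; nra.
    have bx j : 0 <= (l + t *: delta_mx i ord0) j ord0 <= K.
      rewrite !mxE eqxx andbT; case: eqP => [->|_].
        by rewrite mulr1; have := l0 i; lra.
      by rewrite mulr0 addr0; exact: lK.
    by have := h bx; rewrite /g; set S := sqn _; nra.
  rewrite pmulr_rge0//; lra.
(* Optimality against scaling [l] down, which stays in the box; this is one half of complementary
   slackness. *)
have scl : sqn y0 + dl * sqn l <= dot l a.
  set X := sqn y0 + dl * sqn l; rewrite leNgt; apply/negP => hX.
  have X0 : 0 <= X by rewrite addr_ge0 ?sqn_ge0// mulr_ge0 ?sqn_ge0// ltW.
  pose s := (X - dot l a) / (X + (X - dot l a)).
  have dn : 0 < X + (X - dot l a) by lra.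
  have s0 : 0 < s by rewrite divr_gt0// subr_gt0.
  have s1 : s <= 1 by rewrite ler_pdivrMr//; lra.
  have sX : s * X <= X - dot l a.
    rewrite /s mulrAC ler_pdivrMr// ler_pM2l ?subr_gt0//; lra.
  have := lmin ((1 - s) *: l).
  have -> : A^T *m ((1 - s) *: l) = (1 - s) *: y0 by rewrite -scalemxAr.
  rewrite !sqnZ !dotZl -/y0.
  have -> : (1 - s) ^+ 2 * sqn y0 + dl * ((1 - s) ^+ 2 * sqn l) =
    (1 - s) ^+ 2 * X by rewrite /X; ring.
  rewrite -/X => h.
  have {}h : X - 2 * dot l a <= (1 - s) ^+ 2 * X - 2 * ((1 - s) * dot l a).
    apply: h => i; rewrite mxE mulr_ge0 ?subr_ge0//=.
    case/andP: (lK i) => h1 h2; apply: le_trans h2.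
    by rewrite ler_piMl//; lra.
  have : 0 <= s * (s * X - 2 * (X - dot l a)) by move: h; nra.
  by rewrite pmulr_rge0//; lra.
have sw0 := sqn_ge0 w.
have W : sqn y0 + 2 * (dl * sqn l) <= c * sqn w.
  have h1 := dot_AMGM (B^T *m l) w (c := c^-1).
  rewrite invr_gt0 invrK in h1; have {}h1 := h1 c0.
  have h2 := BA l l0; rewrite -/y0 in h2.
  have h3 : c^-1 * sqn (B^T *m l) <= sqn y0.
    by rewrite mulrC ler_pdivrMr// mulrC.
  have : dot l a = dot (B^T *m l) w by rewrite /a dot_mulr.
  lra.
pose W2 := c * sqn w.
have W20 : 0 <= W2 by rewrite mulr_ge0// ltW.
pose W1 := Num.sqrt W2.
have W1E : W1 ^+ 2 = W2 by rewrite sqr_sqrtr.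
have W10 : 0 <= W1 by exact: sqrtr_ge0.
have sl0 := sqn_ge0 l; have sy0 := sqn_ge0 y0.
(* The ridge leaves a defect dl l_i in the constraint. As dl = e^2, it is of order [e] and a small
   multiple of [u] covers it. *)
have dl1 i : dl * l i ord0 <= e * W1.
  rewrite /dl expr2 -mulrA ler_pM2l//.
  rewrite -(@ler_pXn2r _ 2)// ?nnegrE ?mulr_ge0// ?(ltW e0)//.
  rewrite exprMn -/dl W1E; apply: (@le_trans _ _ (dl * sqn l)).
    by rewrite ler_pM2l// sqn_coord.
  have : 0 <= dl * sqn l by rewrite mulr_ge0// ltW.
  by rewrite /W2; lra.
exists (y0 + (e * W1) *: u) => [i|].
  rewrite -/a mulmxDr -scalemxAr.
  have -> : (A *m y0 + (e * W1) *: (A *m u)) i ord0 =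
    (A *m y0) i ord0 + e * W1 * (A *m u) i ord0 by rewrite !mxE.
  case: (Au i) => [Ai|hu].
    have z x : (A *m x) i ord0 = 0.
      by rewrite mxE big1// => q _; rewrite Ai mul0r.
    rewrite !z mulr0 addr0.
    (* A zero row of [A] forces a zero row of [B]: test the hypothesis on a unit vector. *)
    have Bi : forall q, B i q = 0.
      apply: gram_diag_eq0.
      have := BA (delta_mx i ord0) _.
      have -> : sqn (A^T *m delta_mx i ord0) = 0.
        rewrite /sqn -dot_gram dot_deltal.
        by rewrite -colE mxE gram_diag big1// => q _; rewrite Ai expr0n.
      rewrite mulr0 /sqn -dot_gram dot_deltal -colE mxE => h.
      apply/eqP; rewrite eq_le gram_diag_ge0 andbT; apply: h => q.
      by rewrite mxE ler0n.
    by rewrite /a mxE big1// => q _; rewrite Bi mul0r.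
  apply: le_trans (kkt i) _; rewrite lerD2l (le_trans (dl1 i))//.
  by rewrite ler_peMr// mulr_ge0// ltW.
have := sqnD_le y0 ((e * W1) *: u) e0.
rewrite sqnZ exprMn W1E -/U => h.
have {}h : sqn (y0 + (e * W1) *: u) <= (1 + e) * W2 + (e ^+ 2 + e) * (W2 * U).
  apply: le_trans h _.
  have -> : (1 + e^-1) * (e ^+ 2 * W2 * U) = (e ^+ 2 + e) * (W2 * U).
    by field; rewrite gt_eqF.
  rewrite lerD2r ler_wpM2l//; first lra.
  have : 0 <= dl * sqn l by rewrite mulr_ge0// ltW.
  by rewrite /W2; lra.
apply: le_trans h _.
have -> : c * (1 + eta) * sqn w = (1 + eta) * W2 by rewrite /W2; ring.
have -> : (1 + e) * W2 + (e ^+ 2 + e) * (W2 * U) =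
   (1 + (e + (e ^+ 2 + e) * U)) * W2 by ring.
rewrite ler_wpM2r// lerD2l (le_trans _ eU)//.
have eU0 : 0 <= e * (1 - e) * U.
  by apply: mulr_ge0 => //; apply: mulr_ge0; rewrite ?subr_ge0 ?(ltW e0).
by move: eU0; lra.
Qed.

(** Consider the point of the convex hull of the rows in [I] nearest to the origin. If it is the
    origin, its weights give [w]; otherwise its multiple by the inverse squared norm is [u], by the
    variational inequality. *)
Lemma gordan n k (A : 'M[R]_(n, k)) (I : pred 'I_n) :
  (exists u : 'cV[R]_k, forall i, I i -> 1 <= (A *m u) i ord0) \/
  exists w : 'cV[R]_n, [/\ forall i, 0 <= w i ord0,
    forall i, ~~ I i -> w i ord0 = 0, w != 0 & A^T *m w = 0].
Proof.
have [/existsP[i0 Ii0]|/existsPn nI] := boolP [exists i, I i]; last first.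
  by left; exists 0 => i Ii; have := nI i; rewrite Ii.
pose S := [set v : 'rV[R]_n | forall i, v ord0 i \in `[0, (I i)%:R]] `&`
  [set v : 'rV[R]_n | dot v^T (const_mx 1) = 1].
have cS : compact S.
  apply: compact_closedI; first exact: compact_box.
  have -> : [set v : 'rV[R]_n | dot v^T (const_mx 1) = 1] =
    (fun v : 'rV[R]_n => dot v^T (const_mx 1)) @^-1` [set 1] by [].
  apply: closed_comp; last exact: closed_eq.
  by move=> v _; exact: continuous_dot.
have S0 : S !=set0.
  exists (delta_mx ord0 i0); split=> [i|] /=.
    rewrite in_itv/= mxE eqxx /=; case: eqP => [->|_]; first by rewrite Ii0 ler01 lexx.
    by rewrite lexx ler0n.
  by rewrite trmx_delta dot_deltal mxE.
have [l + lmin] := compact_EVT_min S0 cS (continuous_subspaceT (@continuous_sqn_mul n k A)).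
rewrite inE => -[lI l1].
have l0 i : 0 <= l^T i ord0 by have := lI i; rewrite in_itv/= mxE => /andP[].
have lnI i : ~~ I i -> l^T i ord0 = 0.
  move=> nIi; have := lI i; rewrite in_itv/= (negbTE nIi) mxE => h.
  by apply/eqP; rewrite eq_le andbC.
have ln0 : l^T != 0.
  apply/eqP => l00; move: l1; rewrite /= l00 dot0l => /eqP.
  by rewrite eq_sym oner_eq0.
set y := A^T *m l^T in lmin.
have [sy|sy] := eqVneq (sqn y) 0.
  by right; exists l^T; split => //; exact: sqn_eq0.
have sy0 : 0 < sqn y by rewrite lt_neqAle eq_sym sy sqn_ge0.
left; exists ((sqn y)^-1 *: y) => i Ii.
rewrite -scalemxAr mxE mulrC ler_pdivlMr// mul1r leNgt; apply/negP => hi.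
(* If row [i] had too small a product with [y], moving weight toward it would shorten [y]. *)
pose g := sqn y - (A *m y) i ord0.
have g0 : 0 < g by rewrite subr_gt0.
pose z := A^T *m delta_mx i ord0 - y.
pose q := 1 + sqn z.
have q0 : 0 < q by have := sqn_ge0 z; rewrite /q; lra.
pose t := Num.min 1 (g / q).
have t0 : 0 < t by rewrite lt_min ltr01 divr_gt0.
have t1 : t <= 1 by rewrite ge_min lexx.
have tq : t * q <= g by rewrite -ler_pdivlMr// ge_min lexx orbT.
have := lmin ((1 - t) *: l + t *: delta_mx ord0 i).
have -> : A^T *m ((1 - t) *: l + t *: delta_mx ord0 i)^T = y + t *: z.
  rewrite linearD/= !linearZ/= trmx_delta mulmxDr -!scalemxAr -/y /z.
  by apply/matrixP => a b; rewrite !mxE; ring.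
rewrite sqnD sqnZ dotZr.
have -> : dot y z = - g.
  by rewrite /z /g dotDr dotNr dot_mulr trmxK dotC dot_deltal /sqn; ring.
move=> h; have {}h : 0 <= t * (t * sqn z - 2 * g).
  suff : sqn y <= sqn y + 2 * (t * - g) + t ^+ 2 * sqn z by nra.
  apply: h; rewrite inE; split=> [j|] /=.
    rewrite in_itv/= !mxE eqxx /=.
    have := lI j; rewrite in_itv/= => /andP[h1 h2].
    have [ji|ji] := eqVneq j i.
      rewrite ji in h1 h2 *.
      have -> : (I i)%:R = 1 :> R by rewrite Ii.
      have {}h2 : l ord0 i <= 1 by rewrite Ii in h2.
      have p1 : 0 <= (1 - t) * l ord0 i by rewrite mulr_ge0 ?subr_ge0.
      have p2 : 0 <= (1 - t) * (1 - l ord0 i) by rewrite mulr_ge0 ?subr_ge0.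
      by rewrite mulr1; apply/andP; split; lra.
    rewrite mulr0 addr0; apply/andP; split; first by rewrite mulr_ge0 ?subr_ge0.
    by apply: le_trans h2; rewrite ler_piMl//; lra.
  rewrite linearD/= !linearZ/= trmx_delta dotDl !dotZl dot_deltal mxE.
  by move: l1 => /= ->; ring.
move: h; rewrite pmulr_rge0// => h.
have := sqn_ge0 z; rewrite /q in tq; lra.
Qed.

End duality.

(** * Gaussian densities and growth *)

Section gaussian_density.
Context (R : realType).
Local Notation g1 := (@normal_prob R 0 1).

Lemma cons_cV0 k (x : R) (y : 'cV[R]_k) l j :
  cons_cV (x, y) (@lshift 1 k l) j = x.
Proof. by rewrite /cons_cV (@col_mxEu _ 1 k) mxE. Qed.

Lemma cons_cVS k (x : R) (y : 'cV[R]_k) l :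
  cons_cV (x, y) (@rshift 1 k l) ord0 = y l ord0.
Proof. by rewrite /cons_cV (@col_mxEd _ 1 k). Qed.

Lemma cons_cV_affine k (th b0 x : R) (b y : 'cV[R]_k) :
  cons_cV (th * x + b0, th *: y + b) = th *: cons_cV (x, y) + cons_cV (b0, b).
Proof.
apply/matrixP => i j; rewrite (ord1 j).
have -> : (th *: cons_cV (x, y) + cons_cV (b0, b)) i ord0 =
  th * cons_cV (x, y) i ord0 + cons_cV (b0, b) i ord0 by rewrite !mxE.
by case: (@split_ordP 1 k i) => l ->; rewrite ?cons_cV0 ?cons_cVS ?mxE.
Qed.

(* The density with respect to gamma of the law of th *: z + b. *)
Definition affine_weight k (th : R) (b z : 'cV[R]_k) : R :=
  `|th|^-1 ^+ k * expR (sqn z / 2 - sqn (th^-1 *: (z - b)) / 2).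

Lemma affine_weight_ge0 k th (b z : 'cV[R]_k) : 0 <= affine_weight th b z.
Proof. by rewrite mulr_ge0 ?expR_ge0// exprn_ge0// invr_ge0. Qed.

Lemma measurable_sqn_affine k (th : R) (b : 'cV[R]_k) :
  measurable_fun setT (fun z : 'cV[R]_k => sqn (th *: (z - b))).
Proof.
rewrite (_ : (fun _ => _) = fun z : 'cV[R]_k =>
    \sum_i (th * (z i ord0 - b i ord0)) ^+ 2); last first.
  apply/funext => z; rewrite /sqn dotE; apply: eq_bigr => i _.
  by rewrite !mxE expr2.
apply: measurable_sum => i; apply: measurable_funX.
apply: measurable_funM => //; apply: measurable_funB => //.
exact: measurable_coord.
Qed.

Lemma measurable_affine_weight k th (b : 'cV[R]_k) :
  measurable_fun setT (affine_weight th b).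
Proof.
apply: measurable_funM => //; apply: measurableT_comp => //.
apply: measurable_funB; apply: measurable_funM => //.
  have := measurable_sqn_affine 1 (0 : 'cV[R]_k).
  by under eq_fun do rewrite scale1r subr0.
exact: measurable_sqn_affine.
Qed.

Lemma sqn_cons k (x : R) (y : 'cV[R]_k) : sqn (cons_cV (x, y)) = x ^+ 2 + sqn y.
Proof.
transitivity (sqn (cV1 x) + sqn y); first exact: (sqn_col_mx (cV1 x) y).
by rewrite {1}/sqn dotE big_ord1 /= mxE expr2.
Qed.

Lemma affine_weight_cons k th (b0 x : R) (b y : 'cV[R]_k) :
  affine_weight th (cons_cV (b0, b)) (cons_cV (x, y)) =
  (`|th|^-1 * expR (x ^+ 2 / 2 - ((x - b0) / th) ^+ 2 / 2)) *
  affine_weight th b y.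
Proof.
rewrite /affine_weight mulrACA -exprS -expRD; congr (_ * expR _).
have -> : cons_cV (x, y) - cons_cV (b0, b) = cons_cV (x - b0, y - b).
  apply/matrixP => i j; rewrite (ord1 j).
  have -> : (cons_cV (x, y) - cons_cV (b0, b)) i ord0 =
    cons_cV (x, y) i ord0 - cons_cV (b0, b) i ord0 by rewrite !mxE.
  by case: (@split_ordP 1 k i) => l ->; rewrite ?cons_cV0 ?cons_cVS ?mxE.
by rewrite !sqnZ !sqn_cons; ring.
Qed.

Lemma measurable_scale_shift k (th : R) (b : 'cV[R]_k) :
  measurable_fun setT (fun z : 'cV[R]_k => th *: z + b).
Proof.
have := measurable_affine (T := 'cV[R]_k) (th%:M) b (measurable_id (D := setT)).
by under eq_fun do rewrite mul_scalar_mx.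
Qed.

Lemma gamma_affine k (th : R) (b : 'cV[R]_k) (F : 'cV[R]_k -> \bar R) :
  th != 0 -> measurable_fun setT F -> (forall z, 0 <= F z)%E ->
  (\int[gamma R k]_z F (th *: z + b)%R =
   \int[gamma R k]_z (F z * (affine_weight th b z)%:E))%E.
Proof.
move=> th0; elim: k => [|k IH] in b F * => mF F0.
  apply: eq_integral => z _.
  have E (x : 'cV[R]_0) : x = 0 by apply/matrixP => -[].
  rewrite /affine_weight expr0 mul1r (E (th *: z + b)) (E z) (E (_ *: _)).
  by rewrite /sqn dot0l mul0r subr0 expR0 mule1.
have [b0 [b' ->]] : exists b0 b', b = cons_cV (b0, b').
  exists (b ord0 ord0), (\col_i b (lift ord0 i) ord0).
  apply/matrixP => i j; rewrite (ord1 j).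
  case: (@split_ordP 1 k i) => l ->.
    by rewrite cons_cV0 (ord1 l); congr (b _ _); exact: val_inj.
  by rewrite cons_cVS mxE; congr (b _ _); exact: val_inj.
have mFW : measurable_fun setT
    (fun z : 'cV[R]_k.+1 => F z * (affine_weight th (cons_cV (b0, b')) z)%:E)%E.
  apply: emeasurable_funM => //; apply/measurable_EFinP.
  exact: measurable_affine_weight.
have mFs : measurable_fun setT
    (fun z : 'cV[R]_k.+1 => F (th *: z + cons_cV (b0, b'))).
  exact: (measurableT_comp mF (measurable_scale_shift _ _)).
have W0 l (c z : 'cV[R]_l) : (0 <= (affine_weight th c z)%:E)%E.
  by rewrite lee_fin affine_weight_ge0.
rewrite (gamma_cons mFs (fun=> F0 _)).
rewrite (gamma_cons mFW (fun z => mule_ge0 (F0 z) (W0 _ _ z))).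
have mFc x : measurable_fun setT (fun y : 'cV[R]_k => F (cons_cV (x, y))).
  apply: (measurableT_comp (measurableT_comp mF (@measurable_cons_cV R k))).
  exact: measurable_pair1.
pose G (x : measurableTypeR R) := (\int[gamma R k]_y (F (cons_cV (x, y)) *
   (affine_weight th b' y)%:E))%E.
have G0 x : (0 <= G x)%E by apply: integral_ge0 => y _; exact: mule_ge0.
have mG : measurable_fun setT G.
  pose H (p : measurableTypeR R * 'cV[R]_k) :=
    (F (cons_cV p) * (affine_weight th b' p.2)%:E)%E.
  have mH : measurable_fun setT H.
    apply: emeasurable_funM.
      exact: (measurableT_comp mF (@measurable_cons_cV R k)).
    apply/measurable_EFinP.
    exact: (measurableT_comp (measurable_affine_weight th b') (@measurable_snd _ _ _ _)).
  exact: (measurable_fun_fubini_tonelli_F (m2 := gamma R k) _ mH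
    (fun p => mule_ge0 (F0 _) (W0 _ _ _))).
transitivity (\int[g1]_x G (th * x + b0)%R)%E.
  apply: eq_integral => x _; rewrite /G -(IH b' _ (mFc _) (fun=> F0 _)).
  by apply: eq_integral => y _; rewrite cons_cV_affine.
apply: (etrans (normal_affine b0 th0 mG G0)); apply: eq_integral => x _.
rewrite /G -ge0_integralZr//.
- apply: eq_integral => y _; rewrite affine_weight_cons -muleA; congr (_ * _)%E.
  by rewrite -EFinM mulrC.
- apply: emeasurable_funM => //; apply/measurable_EFinP.
  exact: measurable_affine_weight.
- by move=> y _; exact: mule_ge0.
Qed.

Lemma integral_gamma_cst k (c : \bar R) : (\int[gamma R k]_z c = c)%E.
Proof.
rewrite integral_cst// -[RHS]mule1; congr (_ * _)%E.
exact: (probability_setT (gamma R k)).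
Qed.

(** With b = 0 and th = (1 - c)^(-1/2), [affine_weight] is a positive multiple of this function, and
    being a probability density it has total mass 1. *)
Lemma integrable_exp_sqn k (c : R) : 0 <= c < 1 ->
  (gamma R k).-integrable setT (fun z => (expR (c * (sqn z / 2)))%:E).
Proof.
move=> /andP[c0 c1]; have d0 : 0 < 1 - c by lra.
pose th := (Num.sqrt (1 - c))^-1.
have th0 : 0 < th by rewrite invr_gt0 sqrtr_gt0.
have mE : measurable_fun setT (fun z : 'cV[R]_k => expR (c * (sqn z / 2))).
  apply: measurableT_comp => //; do 2 apply: measurable_funM => //.
  have := measurable_sqn_affine 1 (0 : 'cV[R]_k).
  by under eq_fun do rewrite scale1r subr0.
apply/integrableP; split; first exact/measurable_EFinP.
under eq_integral do rewrite abse_EFin ger0_norm ?expR_ge0//.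
have := @gamma_affine k th 0 (cst 1%E) (lt0r_neq0 th0) (measurable_cst _)
  (fun=> ltac:(exact: lee01)).
rewrite /= integral_gamma_cst.
under eq_integral do rewrite mul1e.
have E z : affine_weight th (0 : 'cV[R]_k) z =
    `|th|^-1 ^+ k * expR (c * (sqn z / 2)).
  rewrite /affine_weight subr0 sqnZ; congr (_ * expR _).
  by rewrite /th invrK sqr_sqrtr ?ltW//; ring.
under eq_integral do rewrite E EFinM.
rewrite ge0_integralZl//; [|exact/measurable_EFinP|..].
have t0 : 0 < `|th|^-1 ^+ k by rewrite exprn_gt0// invr_gt0 gtr0_norm.
case: (integral _ _ _) => [r||]//; first by rewrite ltry.
by rewrite gt0_muley// lte_fin.
Qed.

Definition box k (q : 'cV[R]_k) (r : R) : set 'cV[R]_k :=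
  [set u | forall i, u i ord0 \in `[q i ord0 - r, q i ord0 + r]].

Lemma measurable_box k (q : 'cV[R]_k) r : measurable (box q r).
Proof.
apply: (measurable_rect (B := fun i => `[q i ord0 - r, q i ord0 + r]%classic)).
by move=> i; exact: measurable_itv.
Qed.

Lemma normal_itv_gt0 (a b : R) : a < b -> (0 < g1 `[a, b]%classic)%E.
Proof.
(* A lower bound of the density on the interval, from x^2 <= a^2 + b^2. *)
move=> ab; pose m := normal_peak 1 * expR (- ((a ^+ 2 + b ^+ 2) / 2)) : R.
have m0 : 0 < m by rewrite mulr_gt0 ?expR_gt0// normal_peak_gt0 ?oner_neq0.
apply: (@lt_le_trans _ _ (m%:E * (b - a)%:E)%E).
  by rewrite -EFinM lte_fin mulr_gt0// subr_gt0.
have -> : (b - a)%:E = lebesgue_measure `[a, b]%classic.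
  by rewrite lebesgue_measure_itv/= lte_fin ab EFinB.
rewrite -integral_cst//; apply: ge0_le_integral => //.
- by move=> x _; rewrite lee_fin ltW.
- by apply/measurable_EFinP; apply: measurable_funTS; exact: measurable_normal_pdf.
move=> x; rewrite /= in_itv/= => /andP[ax xb].
rewrite lee_fin normal_pdf01 /m ler_pM2l ?normal_peak_gt0 ?oner_neq0//.
rewrite ler_expR lerN2 ler_pM2r ?invr_gt0//.
have [x0|x0] := leP 0 x; first by have := sqr_ge0 a; nra.
by have := sqr_ge0 b; nra.
Qed.

Lemma gamma_box_gt0 k (q : 'cV[R]_k) r : 0 < r -> (0 < gamma R k (box q r))%E.
Proof.
move=> r0.
rewrite (gamma_standard (B := fun i => `[q i ord0 - r, q i ord0 + r]%classic)).
  elim/big_ind : _ => //.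
    by move=> x y x0 y0; exact: mule_gt0.
  by move=> i _; apply: normal_itv_gt0; lra.
by move=> i; exact: measurable_itv.
Qed.

Lemma sqn_box k (q : 'cV[R]_k) r : exists M, forall u, box q r u -> sqn u <= M.
Proof.
exists (\sum_i (`|q i ord0| + `|r|) ^+ 2) => u hu; rewrite /sqn dotE.
apply: ler_sum => i _; rewrite -expr2 -real_normK ?num_real//.
rewrite lerXn2r ?nnegrE ?addr_ge0//.
have := hu i; rewrite in_itv/= => /andP[h1 h2].
have := ler_norm (q i ord0); have := ler_norm r; have := ler_norm (- q i ord0).
by rewrite normrN => *; rewrite ler_norml; apply/andP; split; lra.
Qed.

(** Cameron-Martin shift: moving [y] from the argument into the measure costs the density exp (y . u
    + |y|^2 / 2) at z = y + u. As [u] is bounded, eta |y|^2 / 2 and a constant absorb the cross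
    term. *)
Lemma box_translate_bound k (p : 'cV[R]_k -> R) (q : 'cV[R]_k) (r eta : R) :
  (gamma R k).-integrable setT (EFin \o p) -> 0 < eta ->
  exists2 K, 0 <= K & forall y,
  (\int[gamma R k]_(u in box q r) `|p (y + u)%R|%:E <=
    (K * expR ((1 + eta) * (sqn y / 2)))%:E)%E.
Proof.
move=> ip eta0.
have mp : measurable_fun setT p.
  by apply/measurable_EFinP; exact: measurable_int ip.
have [M MP] := sqn_box q r.
pose I := (\int[gamma R k]_z `|p z|%:E)%E.
have mabs : measurable_fun setT (fun z : 'cV[R]_k => `|p z|%:E).
  by apply/measurable_EFinP; exact: measurableT_comp.
have Ioo : (I < +oo)%E by case/integrableP: ip.
have I0 : (0 <= I)%E by exact: integral_ge0.
have IE : (fine I)%:E = I by rewrite fineK// ge0_fin_numE.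
exists (expR (eta^-1 * (M / 2)) * fine I).
  by rewrite mulr_ge0 ?expR_ge0// fine_ge0.
move=> y.
pose F (z : 'cV[R]_k) := ((\1_(box q r) (z - y))%:E * `|p z|%:E)%E.
have F0 z : (0 <= F z)%E by rewrite mule_ge0// lee_fin.
have mF : measurable_fun setT F.
  apply: emeasurable_funM; apply/measurable_EFinP; last first.
    exact: measurableT_comp.
  have := measurable_scale_shift 1 (- y).
  under eq_fun do rewrite scale1r.
  apply: measurableT_comp; apply: measurable_indic; exact: measurable_box.
have n0 : (1 : R) != 0 by exact: oner_neq0.
have E := gamma_affine y n0 mF F0.
have -> : (\int[gamma R k]_(u in box q r) `|p (y + u)%R|%:E =
    \int[gamma R k]_z F (1 *: z + y)%R)%E.
  rewrite integral_mkcond; apply: eq_integral => z _.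
  rewrite patchE /F scale1r addrK indicE [y + z]addrC.
  by case: ifPn => _; rewrite ?mul1e ?mul0e.
rewrite E.
set c := expR (eta^-1 * (M / 2)) * expR ((1 + eta) * (sqn y / 2)).
have c0 : 0 <= c by rewrite mulr_ge0// expR_ge0.
rewrite mulrAC -/c EFinM IE /I -ge0_integralZl//.
apply: ge0_le_integral => //.
- by move=> z _; apply: mule_ge0 => //; rewrite lee_fin affine_weight_ge0.
- apply: emeasurable_funM => //; apply/measurable_EFinP.
  exact: measurable_affine_weight.
- exact: emeasurable_funM.
move=> z _; rewrite /F /= -!EFinM lee_fin indicE mulrAC ler_wpM2r//.
have [hz|_] := boolP (z - y \in box q r); last by rewrite mul0r.
rewrite mul1r /affine_weight normr1 invr1 expr1n mul1r scale1r /c -expRD ler_expR.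
have /MP zM : box q r (z - y) by rewrite inE in hz.
have -> : sqn z = sqn y + 2 * dot y (z - y) + sqn (z - y).
  by rewrite -sqnD addrC subrK.
have := dot_AMGM y (z - y) eta0.
have : eta^-1 * sqn (z - y) <= eta^-1 * M by rewrite ler_pM2l ?invr_gt0.
by lra.
Qed.

(* Both |p (y + .)| and |p (y' + .)| have controlled means over the box, hence
   are controlled simultaneously at some point of it. *)
Lemma box_pick k (p : 'cV[R]_k -> R) (q : 'cV[R]_k) (r eta : R) :
  (gamma R k).-integrable setT (EFin \o p) -> 0 < eta -> 0 < r ->
  exists2 C, 0 <= C & forall y y', exists u, [/\ box q r u,
    `|p (y + u)| <= C * (expR ((1 + eta) * (sqn y / 2)) +
                         expR ((1 + eta) * (sqn y' / 2))) &
    `|p (y' + u)| <= C * (expR ((1 + eta) * (sqn y / 2)) +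
                         expR ((1 + eta) * (sqn y' / 2)))].
Proof.
move=> ip eta0 r0.
have mp : measurable_fun setT p.
  by apply/measurable_EFinP; exact: measurable_int ip.
have mps y : measurable_fun setT (fun u : 'cV[R]_k => `|p (y + u)|%:E).
  apply/measurable_EFinP; apply: measurableT_comp => //.
  have := measurable_scale_shift 1 y.
  under eq_fun do rewrite scale1r addrC.
  exact: measurableT_comp.
have [K K0 KP] := box_translate_bound q r ip eta0.
have g0 := gamma_box_gt0 q r0.
have gE : (fine (gamma R k (box q r)))%:E = gamma R k (box q r).
  by rewrite fineK// fin_num_measure//; exact: measurable_box.
set G := fine _ in gE; have G0 : 0 < G by rewrite -lte_fin gE.
exists ((K + 1) / G); first by rewrite divr_ge0 ?ltW//; lra.
move=> y y'; set e := expR _; set e' := expR _.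
have e0 : 0 < e by exact: expR_gt0. have e'0 : 0 < e' by exact: expR_gt0.
(* If no point worked, the sum of the two values would be at least (K + 1) (e + e') / G on the whole
   box, and its integral at least (K + 1) (e + e'), against the bound K (e + e'). *)
apply: contrapT => /forallNP hn.
have h u : box q r u -> (K + 1) / G * (e + e') <= `|p (y + u)| + `|p (y' + u)|.
  move=> hu; rewrite leNgt; apply/negP => lt; apply: (hn u); split => //.
    by rewrite (le_trans _ (ltW lt))// lerDl.
  by rewrite (le_trans _ (ltW lt))// lerDr.
have : (((K + 1) / G * (e + e'))%:E * gamma R k (box q r) <=
    (K * e)%:E + (K * e')%:E)%E.
  rewrite -integral_cst//; last exact: measurable_box.
  apply: le_trans (leeD (KP y) (KP y')).
  rewrite -ge0_integralD//; last 3 first.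
  - exact: measurable_box.
  - exact: measurable_funTS.
  - exact: measurable_funTS.
  apply: ge0_le_integral => //.
  - exact: measurable_box.
  - move=> u _; rewrite lee_fin; apply: mulr_ge0; last by lra.
    by apply: divr_ge0; [lra|exact: ltW].
  - by apply: emeasurable_funD; exact: measurable_funTS.
rewrite -gE -EFinM -EFinD lee_fin mulrAC divfK ?gt_eqF//; nra.
Qed.

End gaussian_density.

(** * Expectations under dilations *)

Section scaling_limit.
Context (R : realType).

Let weight k (a : R) (z : 'cV[R]_k) : R :=
  `|a| ^+ k * expR ((1 - a ^+ 2) * (sqn z / 2)).

Let weightE k (a : R) (z : 'cV[R]_k) :
  affine_weight a^-1 0 z = weight a z.
Proof.
rewrite /affine_weight /weight subr0 sqnZ invrK normfV invrK.
by congr (_ * expR _); ring.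
Qed.

Let measurable_weight k (a : R) :
  measurable_fun setT (fun z : 'cV[R]_k => weight a z).
Proof.
by under eq_fun do rewrite -weightE; exact: measurable_affine_weight.
Qed.

Let weight_le k (a : R) (z : 'cV[R]_k) : 1 <= a <= 2 -> weight a z <= 2 ^+ k.
Proof.
move=> /andP[a1 a2]; rewrite -[leRHS]mulr1 /weight.
have a0 : 0 <= a by rewrite (le_trans _ a1).
apply: ler_pM; rewrite ?exprn_ge0 ?expR_ge0//.
  by rewrite ger0_norm// lerXn2r ?nnegrE.
rewrite -[leRHS]expR0 ler_expR mulr_le0_ge0//.
  by rewrite subr_le0 -[leLHS](expr1n _ 2) lerXn2r ?nnegrE.
by rewrite divr_ge0// sqn_ge0.
Qed.

Let weight_cvg k (z : 'cV[R]_k) :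
  weight (1 + harmonic n) z @[n --> \oo] --> (1 : R).
Proof.
have c1 : (1 + harmonic n : R) @[n --> \oo] --> (1 : R).
  rewrite -[X in _ --> X]addr0; apply: (@cvgD _ R^o); first exact: cvg_cst.
  exact: cvg_harmonic.
have w1 : weight 1 z = 1.
  by rewrite /weight normr1 !expr1n subrr mul0r expR0 mulr1.
suff cw : {for (1 : R), continuous (fun a => weight a z)}.
  by have := cvg_comp _ _ c1 cw; rewrite w1.
rewrite /weight.
apply: (@continuousM R _ (fun a : R => `|a| ^+ k)
  (fun a : R => expR ((1 - a ^+ 2) * (sqn z / 2))) (1 : R)).
  apply: (@continuous_comp _ _ _ (fun a : R => `|a|) (fun a : R => a ^+ k)).
    exact: norm_continuous.
  exact: exprn_continuous.
apply: (@continuous_comp _ _ _ (fun a : R => (1 - a ^+ 2) * (sqn z / 2)) expR);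
  last exact: continuous_expR.
apply: (@continuousM R _ (fun a : R => 1 - a ^+ 2) (cst (sqn z / 2)) (1 : R));
  last exact: cst_continuous.
apply: (@continuousB R R^o _ (cst 1) (fun a : R => a ^+ 2)).
  exact: cst_continuous.
exact: exprn_continuous.
Qed.

Let integrable_weight k (a : R) (p : 'cV[R]_k -> R) : 1 <= a <= 2 ->
  (gamma R k).-integrable setT (EFin \o p) ->
  (gamma R k).-integrable setT (fun z => (p z * weight a z)%:E).
Proof.
move=> a12 ip.
have mp : measurable_fun setT p.
  by apply/measurable_EFinP; exact: measurable_int ip.
have := integrableZl measurableT (2 ^+ k) ip.
apply: le_integrable => //.
  apply/measurable_EFinP; apply: measurable_funM => //.
  exact: measurable_weight.
move=> z _; rewrite /= lee_fin normrM [leRHS]normrM mulrC.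
apply: ler_wpM2r => //.
rewrite ger0_norm ?(le_trans (weight_le _ a12)) ?ler_norm//.
by rewrite mulr_ge0 ?expR_ge0// exprn_ge0.
Qed.

Let scale_mulmx k (a : R) : measurable_fun setT (fun z : 'cV[R]_k => a *: z).
Proof.
have := measurable_scale_shift a (0 : 'cV[R]_k).
by under eq_fun do rewrite addr0.
Qed.

Let gamma_scale k (a : R) (F : 'cV[R]_k -> \bar R) : a != 0 ->
  measurable_fun setT F -> (forall z, 0 <= F z)%E ->
  (\int[gamma R k]_z F (a^-1 *: z) =
   \int[gamma R k]_z (F z * (weight a z)%:E))%E.
Proof.
move=> a0 mF F0; have a0' : a^-1 != 0 by rewrite invr_eq0.
have := gamma_affine 0 a0' mF F0.
under eq_integral do rewrite addr0.
by under [in X in _ = X -> _]eq_integral do rewrite weightE.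
Qed.

Lemma integrable_scale k (a : R) (p : 'cV[R]_k -> R) : 1 <= a <= 2 ->
  (gamma R k).-integrable setT (EFin \o p) ->
  (gamma R k).-integrable setT (fun z => (p (a^-1 *: z))%:E).
Proof.
move=> a12 ip.
have a0 : a != 0 by case/andP: a12 => h _; rewrite gt_eqF// (lt_le_trans _ h).
have mp : measurable_fun setT p.
  by apply/measurable_EFinP; exact: measurable_int ip.
apply/integrableP; split.
  by apply/measurable_EFinP; exact: (measurableT_comp mp (scale_mulmx _)).
have mabs : measurable_fun setT (fun z : 'cV[R]_k => `|p z|%:E).
  by apply/measurable_EFinP; exact: measurableT_comp.
have E := gamma_scale a0 mabs (fun=> ltac:(by rewrite lee_fin)).
rewrite (_ : integral _ _ _ = \int[gamma R k]_z (`|p (a^-1 *: z)|)%:E)%E//.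
rewrite E; have /integrableP[_] := integrable_weight a12 ip.
congr (_ < _)%E; apply: eq_integral => z _.
rewrite /= -EFinM normrM [X in _ * X]ger0_norm//.
by rewrite mulr_ge0 ?expR_ge0// exprn_ge0.
Qed.

Let integral_scale k (a : R) (p : 'cV[R]_k -> R) : a != 0 ->
  measurable_fun setT p ->
  (\int[gamma R k]_z (p (a^-1 *: z))%:E =
   \int[gamma R k]_z (p z * weight a z)%:E)%E.
Proof.
move=> a0 mp; have mp' : measurable_fun setT (EFin \o p) by exact/measurable_EFinP.
have w0 z : 0 <= weight a z :> R by rewrite mulr_ge0 ?expR_ge0// exprn_ge0.
rewrite integralE [RHS]integralE; congr (_ - _)%E.
  have := gamma_scale a0 (measurable_funepos mp') (fun=> funepos_ge0 _ _).
  rewrite (eq_integral (fun z => ((fun z => (p (a^-1 *: z))%:E)^\+) z)%E).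
    move=> ->; apply: eq_integral => z _.
    by rewrite !funeposE /= -!EFin_max -EFinM maxr_pMl// mul0r.
  by move=> z _; rewrite !funeposE.
have := gamma_scale a0 (measurable_funeneg mp') (fun=> funeneg_ge0 _ _).
rewrite (eq_integral (fun z => ((fun z => (p (a^-1 *: z))%:E)^\-) z)%E).
  move=> ->; apply: eq_integral => z _.
  by rewrite !funenegE /= -!EFin_max -EFinM maxr_pMl// mul0r mulNr.
by move=> z _; rewrite !funenegE.
Qed.

(** The dilation is moved from the integrand, which is merely integrable, to the Gaussian density.
    For 1 <= a <= 2 the resulting weights are at most 2^k, and they tend to 1 with [a], so dominated
    convergence applies. *)
Lemma scaling_limit k l (p : 'cV[R]_k -> R) (q : 'cV[R]_l -> R) :
  (gamma R k).-integrable setT (EFin \o p) ->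
  (gamma R l).-integrable setT (EFin \o q) ->
  (forall a : R, 1 < a <= 2 ->
    (\int[gamma R k]_z (p (a^-1 *: z))%:E <=
     \int[gamma R l]_z (q (a^-1 *: z))%:E)%E) ->
  (\int[gamma R k]_z (p z)%:E <= \int[gamma R l]_z (q z)%:E)%E.
Proof.
move=> ip iq pq.
(* [harmonic n] is 1 / (n + 1), so already [a 0] is 2, within the admissible range. *)
pose a n : R := 1 + harmonic n.
have ha n : 1 < a n <= 2.
  rewrite /a /= ltrDl invr_gt0 ltr0n /= [leRHS](_ : 2 = 1 + 1)//.
  by rewrite lerD2l invf_le1 ?ltr0n// ler1n.
have a12 n : 1 <= a n <= 2 by case/andP: (ha n) => h ->; rewrite ltW.
have a0 n : a n != 0.
  by case/andP: (a12 n) => h _; rewrite gt_eqF// (lt_le_trans _ h).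
have lim m (r : 'cV[R]_m -> R) : (gamma R m).-integrable setT (EFin \o r) ->
  (\int[gamma R m]_z (r ((a n)^-1 *: z))%:E)%E @[n --> \oo] -->
  (\int[gamma R m]_z (r z)%:E)%E.
  move=> ir.
  have mr : measurable_fun setT r.
    by apply/measurable_EFinP; exact: measurable_int ir.
  under eq_fun do rewrite integral_scale//.
  apply: (@dominated_cvg _ _ _ (gamma R m) _ measurableT _ _ (fun z => (2 ^+ m * `|r z|)%:E)) => //.
  - move=> n; apply/measurable_EFinP; apply: measurable_funM => //.
    exact: measurable_weight.
  - move=> z _; apply/cvg_EFin; first exact: nearW.
    rewrite -[X in _ --> X]mulr1.
    by apply: (@cvgM R); [exact: cvg_cst|exact: weight_cvg].
  - by have := integrableZl measurableT (2 ^+ m) (integrable_norm ir).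
  - move=> n z _; rewrite /= lee_fin normrM mulrC ler_wpM2r//.
    rewrite ger0_norm ?weight_le//.
    by rewrite mulr_ge0 ?expR_ge0// exprn_ge0.
apply: (lee_cvg_to (lim _ _ ip) (lim _ _ iq)).
by apply: nearW => n; apply: pq; exact: ha.
Qed.

End scaling_limit.

(** * Directionally convex functions *)

Section directional_convexity.
Context (R : realType) (d : nat).
Implicit Types (f : 'cV[R]_d -> R) (x u w z v : 'cV[R]_d).

Definition nnegv u : Prop := forall i, 0 <= u i ord0.

Definition incdiff f : Prop := forall x u w, nnegv u -> nnegv w ->
  f (x + u) + f (x + w) <= f x + f (x + u + w).

(** Kept beside [incdiff], which directly yields only the midpoint case. *)
Definition ray_convex f : Prop := forall x u (p : R), nnegv u -> 0 <= p <= 1 ->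
  f (x + p *: u) <= (1 - p) * f x + p * f (x + u).

Lemma nnegvD u w : nnegv u -> nnegv w -> nnegv (u + w).
Proof. by move=> u0 w0 i; rewrite mxE addr_ge0. Qed.

Lemma nnegvZ (a : R) u : 0 <= a -> nnegv u -> nnegv (a *: u).
Proof. by move=> a0 u0 i; rewrite mxE mulr_ge0. Qed.

Lemma nnegv_delta (a : R) (i : 'I_d) : 0 <= a -> nnegv (a *: delta_mx i ord0).
Proof. by move=> a0 j; rewrite !mxE mulr_ge0. Qed.

Lemma nnegv0 : nnegv 0.
Proof. by move=> i; rewrite mxE. Qed.

Lemma nnegv_sum u : nnegv u ->
  u = \sum_i (u i ord0 *: delta_mx i ord0).
Proof.
move=> u0; apply/matrixP => i j; rewrite (ord1 j) summxE (bigD1 i)//=.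
rewrite !mxE !eqxx mulr1 big1 ?addr0// => k ki.
by rewrite !mxE eq_sym (negbTE ki) mulr0.
Qed.

Lemma nnegv_ind (P : 'cV[R]_d -> Prop) : P 0 ->
  (forall u w, nnegv u -> nnegv w -> P u -> P w -> P (u + w)) ->
  (forall i (a : R), 0 <= a -> P (a *: delta_mx i ord0)) ->
  forall u, nnegv u -> P u.
Proof.
move=> P0 PD P1 u u0; rewrite (nnegv_sum u0).
have : nnegv (\sum_i u i ord0 *: delta_mx i ord0) /\
       P (\sum_i u i ord0 *: delta_mx i ord0); last by case.
elim/big_ind : _ => [|a b [a0 Pa] [b0 Pb]|i _].
- by split; [exact: nnegv0|].
- by split; [exact: nnegvD|exact: PD].
- by split; [exact: nnegv_delta|exact: P1].
Qed.

Lemma convex_functionP (g : R^o -> R) : @convex_function R R^o setT g ->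
  forall a b p : R, 0 <= p <= 1 ->
  g (p * a + (1 - p) * b) <= p * g a + (1 - p) * g b.
Proof.
move=> cg a b p /andP[p0 p1].
have := cg (Itv01 p0 p1) a b; rewrite !inE => /(_ I I).
by rewrite /conv /=.
Qed.

Lemma set_coordE x i (t : R) :
  set_coord x i t = x + (t - x i ord0) *: delta_mx i ord0.
Proof.
apply/matrixP => j k; rewrite (ord1 k) !mxE eqxx andbT.
by case: eqP => [->|_]; rewrite ?mulr1 ?mulr0 ?addr0// addrC subrK.
Qed.

Section dcx.
Variable f : 'cV[R]_d -> R.
Hypothesis fdcx : dir_convex f.

Let coord_convex x i (a b p : R) : 0 <= p <= 1 ->
  f (x + (p * a + (1 - p) * b) *: delta_mx i ord0) <=
  p * f (x + a *: delta_mx i ord0) + (1 - p) * f (x + b *: delta_mx i ord0).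
Proof.
move=> p01; have := convex_functionP (fdcx.2 x i) (x i ord0 + a) (x i ord0 + b) p01.
rewrite !set_coordE.
rewrite (_ : p * (x i ord0 + a) + (1 - p) * (x i ord0 + b) - x i ord0 =
  p * a + (1 - p) * b); last by ring.
by rewrite [x i ord0 + a]addrC [x i ord0 + b]addrC !addrK.
Qed.

(** For i = j this is coordinate convexity, both middle points lying between [x] and the far point.
    Otherwise it is supermodularity: the middle points have minimum [x] and the far point as
    maximum. *)
Let incdiff_delta x i j (s t : R) : 0 <= s -> 0 <= t ->
  f (x + s *: delta_mx i ord0) + f (x + t *: delta_mx j ord0) <=
  f x + f (x + s *: delta_mx i ord0 + t *: delta_mx j ord0).
Proof.
move=> s0 t0; have [<-|ij] := eqVneq i j.
  have [st0|st0] := eqVneq (s + t) 0.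
    have -> : s = 0 by lra.
    have -> : t = 0 by lra.
    by rewrite !scale0r !addr0.
  have st : 0 < s + t by rewrite lt_neqAle eq_sym st0 addr_ge0.
  have h (q : R) : 0 <= q <= s + t -> f (x + q *: delta_mx i ord0) <=
      q / (s + t) * f (x + (s + t) *: delta_mx i ord0) + (1 - q / (s + t)) * f x.
    move=> /andP[q0 q1].
    have := @coord_convex x i (s + t) 0 (q / (s + t)).
    rewrite scale0r addr0 mulr0 addr0 divfK//; apply.
    by rewrite divr_ge0 ?addr_ge0//= ler_pdivrMr// mul1r.
  have h1 := h s; have h2 := h t.
  rewrite -addrA -scalerDl.
  have E : t / (s + t) = 1 - s / (s + t) by field.
  rewrite E in h2.
  have := h1 _; have := h2 _.
  move=> {}h2 {}h1.
  have {}h1 := h1 ltac:(lra); have {}h2 := h2 ltac:(lra).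
  lra.
have := fdcx.1 (x + s *: delta_mx i ord0) (x + t *: delta_mx j ord0).
have -> : map2_mx Num.min (x + s *: delta_mx i ord0) (x + t *: delta_mx j ord0) = x.
  apply/matrixP => k l; rewrite (ord1 l) !mxE eqxx !andbT.
  have [->|ki] := eqVneq k i.
    by rewrite (negbTE ij) mulr1 mulr0 addr0 min_r// lerDl.
  rewrite mulr0 addr0; case: eqVneq => _; last by rewrite mulr0 addr0 minxx.
  by rewrite mulr1 min_l// lerDl.
suff -> : map2_mx Num.max (x + s *: delta_mx i ord0) (x + t *: delta_mx j ord0) =
   x + s *: delta_mx i ord0 + t *: delta_mx j ord0 by [].
apply/matrixP => k l; rewrite (ord1 l) !mxE eqxx !andbT.
have [->|ki] := eqVneq k i.
  by rewrite (negbTE ij) mulr1 mulr0 !addr0 max_l// lerDl.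
rewrite mulr0 addr0; case: eqVneq => _; last by rewrite mulr0 addr0 maxxx.
by rewrite mulr1 max_r// lerDl.
Qed.

Lemma dcx_incdiff : incdiff f.
Proof.
move=> x u w u0 w0; move: u u0 x.
apply: nnegv_ind => [x|u u' u0 u'0 Pu Pu' x|i s s0].
- by rewrite !addr0 addrC.
- have := Pu x; have := Pu' (x + u).
  by rewrite !addrA; lra.
move: w w0; apply: nnegv_ind => [x|w w' w0 w'0 Pw Pw' x|j t t0 x].
- by rewrite !addr0 addrC.
- have := Pw x; have := Pw' (x + w).
  rewrite !addrA [x + w + s *: delta_mx i ord0]addrAC; lra.
exact: incdiff_delta.
Qed.

(** Ray convexity adds up over directions: the mixed term produced by moving along [u] and [w]
    together has the right sign by [dcx_incdiff]. *)
Lemma dcx_ray_convex : ray_convex f.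
Proof.
move=> x u p u0 p01; move: u u0 x.
apply: nnegv_ind => [x|u w u0 w0 Pu Pw x|i s s0 x].
- by rewrite scaler0 addr0; lra.
- have h1 := Pu x; have h2 := Pw (x + p *: u).
  have q0 : 0 <= 1 - p by lra.
  have h3 := dcx_incdiff (x + p *: u) (nnegvZ q0 u0) w0.
  have E : x + p *: u + (1 - p) *: u = x + u.
    by rewrite -addrA -scalerDl [p + _]addrC subrK scale1r.
  rewrite E in h3.
  rewrite scalerDr !addrA; have p0 : 0 <= p by lra.
  have := ler_wpM2l p0 h3; lra.
have := @coord_convex x i s 0 p p01.
by rewrite scale0r mulr0 !addr0 scalerA [leRHS]addrC.
Qed.

End dcx.

Section consequences.
Variable f : 'cV[R]_d -> R.
Hypotheses (fid : incdiff f) (frc : ray_convex f).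

(** The four points are the corners of a parallelogram with nonnegative sides |t - s| p and |t - s|
    q. *)
Lemma swap_le x p q (s t : R) : nnegv p -> nnegv q ->
  f (x + s *: p + t *: q) + f (x + t *: p + s *: q) <=
  f (x + s *: (p + q)) + f (x + t *: (p + q)).
Proof.
wlog st : s t / s <= t => [H p0 q0|p0 q0].
  have [st|ts] := leP s t; first exact: H.
  by have := H t s (ltW ts) p0 q0; lra.
have ts0 : 0 <= t - s by rewrite subr_ge0.
have := fid (x + s *: (p + q)) (nnegvZ ts0 q0) (nnegvZ ts0 p0).
have -> : x + s *: (p + q) + (t - s) *: q = x + s *: p + t *: q.
  by apply/matrixP => i j; rewrite !mxE; ring.
have -> : x + s *: p + t *: q + (t - s) *: p = x + t *: (p + q).
  by apply/matrixP => i j; rewrite !mxE; ring.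
have -> // : x + s *: (p + q) + (t - s) *: p = x + t *: p + s *: q.
by apply/matrixP => i j; rewrite !mxE; ring.
Qed.

Lemma spread_le x p (s : R) : nnegv p ->
  f x + f x <= f (x + s *: p) + f (x - s *: p).
Proof.
wlog s0 : s / 0 <= s => [H p0|p0].
  have [s0|s0] := leP 0 s; first exact: H.
  have := H (- s) _ p0; rewrite scaleNr opprK oppr_ge0 => h.
  by have := h (ltW s0); lra.
have := fid (x - s *: p) (nnegvZ s0 p0) (nnegvZ s0 p0).
by rewrite subrK; lra.
Qed.

(** Walk from [a] to [z] one coordinate at a time. Convexity bounds each increment by the forward
    unit slope at its end, and increasing differences carry that slope up to [z]. *)
Lemma gradient_le a u z : nnegv u -> a + u = z ->
  f z - f a <= \sum_i u i ord0 * (f (z + delta_mx i ord0) - f z).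
Proof.
move=> u0 auz.
pose P (r : seq 'I_d) := forall b, nnegv (z - (b + \sum_(i <- r) (u i ord0 *: delta_mx i ord0))) ->
  f (b + \sum_(i <- r) (u i ord0 *: delta_mx i ord0)) - f b <=
  \sum_(i <- r) u i ord0 * (f (z + delta_mx i ord0) - f z).
have : P (index_enum 'I_d); last first.
  move/(_ a); rewrite -(nnegv_sum u0) auz subrr; apply; exact: nnegv0.
elim: (index_enum _) => [b _|i r IH b]; first by rewrite !big_nil addr0 subrr.
rewrite !big_cons addrA => hb.
have := IH _ hb.
set c := b + u i ord0 *: delta_mx i ord0 in hb *.
set S := \sum_(j <- r) _ in hb *; set T := \sum_(j <- r) _ * _ => h1.
have S0 : nnegv S.
  rewrite /S; elim/big_ind : _ => [|? ? ? ?|j _]; [exact: nnegv0|exact: nnegvD|].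
  exact: nnegv_delta.
have cz : nnegv (z - c).
  have -> : z - c = (z - (c + S)) + S by rewrite (opprD c S) addrA subrK.
  exact: nnegvD.
have ui := u0 i.
have h2 : f c - f b <= u i ord0 * (f (c + delta_mx i ord0) - f c).
  (* The point [c] lies at the fraction u_i / (u_i + 1) of the segment from [b] to c + e_i. *)
  have s1 : 0 < u i ord0 + 1 by lra.
  have e0 : nnegv ((u i ord0 + 1) *: delta_mx i (ord0 : 'I_1)).
    by apply: nnegv_delta; exact: ltW.
  have := @frc b _ (u i ord0 / (u i ord0 + 1)) e0.
  rewrite scalerA divfK ?gt_eqF// -/c.
  have -> : b + (u i ord0 + 1) *: delta_mx i ord0 = c + delta_mx i ord0.
    by rewrite scalerDl scale1r addrA.
  have p01 : 0 <= u i ord0 / (u i ord0 + 1) <= 1.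
    by rewrite divr_ge0 ?(ltW s1)//= ler_pdivrMr//; lra.
  move=> /(_ p01); rewrite -(ler_pM2r s1).
  have -> : ((1 - u i ord0 / (u i ord0 + 1)) * f b +
    u i ord0 / (u i ord0 + 1) * f (c + delta_mx i ord0)) * (u i ord0 + 1) =
    f b + u i ord0 * f (c + delta_mx i ord0) by field; rewrite gt_eqF.
  lra.
have h3 : f (c + delta_mx i ord0) - f c <= f (z + delta_mx i ord0) - f z.
  have e0 : nnegv (delta_mx i (ord0 : 'I_1)).
    by rewrite -[delta_mx _ _]scale1r; exact: nnegv_delta.
  have := fid c e0 cz; rewrite [c + (z - c)]addrC subrK.
  have -> : c + delta_mx i ord0 + (z - c) = z + delta_mx i ord0.
    by rewrite addrAC [c + (z - c)]addrC subrK.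
  lra.
have := ler_wpM2l ui h3; lra.
Qed.

(** The point z + e may leave the region where growth is controlled. Since z / n <= v and e <= v,
    each grid step along the segment raises the increment in direction [e] by at most a second
    difference with step [v], which involves only points s z + c v. *)
Lemma telescope_le z e v (n : nat) : (0 < n)%N -> nnegv e -> nnegv (v - e) ->
  nnegv (v - n%:R^-1 *: z) ->
  f (z + e) - f z <= f e - f 0 + \sum_(j < n)
    (f ((j%:R / n%:R) *: z + 2 *: v) - 2 * f ((j%:R / n%:R) *: z + v) +
     f ((j%:R / n%:R) *: z)).
Proof.
move=> n0 e0 ev zv.
have nR : n%:R != 0 :> R by rewrite pnatr_eq0 -lt0n.
pose zz (j : nat) : 'cV[R]_d := (j%:R / n%:R) *: z.
have v0 : nnegv v by rewrite -[v](subrK e); exact: nnegvD.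
suff H m : f (zz m + e) - f (zz m) <= f e - f 0 +
    \sum_(j < m) (f (zz j + 2 *: v) - 2 * f (zz j + v) + f (zz j)).
  by have := H n; rewrite {1 2}/zz divff// scale1r.
elim: m => [|m IH]; first by rewrite big_ord0 /zz mul0r scale0r add0r addr0.
rewrite big_ord_recr/= addrA.
have h1 : f (zz m.+1 + e) - f (zz m.+1) <= f (zz m + v + e) - f (zz m + v).
  have := fid (zz m.+1) e0 zv.
  have -> : zz m.+1 + (v - n%:R^-1 *: z) = zz m + v.
    by rewrite /zz -[m.+1]addn1 natrD mulrDl mul1r scalerDl; rewrite addrCA addrK addrC.
  have -> : zz m.+1 + e + (v - n%:R^-1 *: z) = zz m + v + e.
    rewrite addrAC; congr (_ + _).
    by rewrite /zz -[m.+1]addn1 natrD mulrDl mul1r scalerDl; rewrite addrCA addrK addrC.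
  lra.
have h2 := fid (zz m + e) v0 ev.
have E1 : zz m + e + (v - e) = zz m + v by rewrite -addrA [e + _]addrC subrK.
have E2 : zz m + e + v + (v - e) = zz m + 2 *: v.
  by apply/matrixP => i j; rewrite !mxE; ring.
rewrite E1 E2 in h2.
have E3 : zz m + e + v = zz m + v + e by rewrite addrAC.
rewrite E3 in h2.
lra.
Qed.

(** A convex function on [-1, 1] has difference quotients at 0 between the slopes of its two chords.
    This is the continuity in direction [v] behind the limit eps to 0. *)
Lemma ray_lipschitz x v (t : R) : nnegv v -> `|t| <= 1 ->
  `|f (x + t *: v) - f x| <= `|t| * (`|f (x + v) - f x| + `|f x - f (x - v)|).
Proof.
move=> v0; rewrite ler_norml => /andP[t1 t2].
have nn0 := normr_ge0 (f (x + v) - f x); have nn1 := normr_ge0 (f x - f (x - v)).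
have n1 := ler_norm (f (x + v) - f x); have n2 := ler_norm (f x - f (x - v)).
have n3 : - (f (x + v) - f x) <= `|f (x + v) - f x| by rewrite -normrN ler_norm.
have n4 : - (f x - f (x - v)) <= `|f x - f (x - v)| by rewrite -normrN ler_norm.
set N1 := `|f (x + v) - f x| in n1 n3 nn0 *.
set N2 := `|f x - f (x - v)| in n2 n4 nn1 *.
have up (s : R) : 0 <= s <= 1 -> f (x + s *: v) - f x <= s * (f (x + v) - f x).
  by move=> s01; have := frc x v0 s01; lra.
have dn (s : R) : 0 <= s <= 1 -> f (x - s *: v) - f x <= s * (f (x - v) - f x).
  move=> s01; have s01' : 0 <= 1 - s <= 1 by lra.
  have := frc (x - v) v0 s01'; rewrite subrK.
  have -> : x - v + (1 - s) *: v = x - s *: v.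
    by apply/matrixP => i j; rewrite !mxE; ring.
  lra.
have mid (s : R) : 0 <= s -> f x + f x <= f (x + s *: v) + f (x - s *: v).
  by move=> s0; exact: spread_le.
have [t0|t0] := leP 0 t.
  have t01 : 0 <= t <= 1 by lra.
  have h1 := up t t01; have h2 := dn t t01; have h3 := mid t t0.
  rewrite (ger0_norm t0) ler_norml; apply/andP; split; nra.
have t01 : 0 <= - t <= 1 by lra.
have h1 := up _ t01; have h2 := dn _ t01; have h3 := mid (- t) ltac:(lra).
rewrite scaleNr opprK in h1 h2 h3.
rewrite (ltr0_norm t0) ler_norml; apply/andP; split; nra.
Qed.

End consequences.

End directional_convexity.

(** * Growth of directionally convex functions *)

Section growth.
Context (R : realType).

Lemma le1D_expR (eta t : R) : 0 < eta -> 0 <= t ->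
  1 + t <= (1 + eta^-1) * expR (eta * t).
Proof.
move=> eta0 t0; have := expR_ge1Dx (eta * t) => h.
have e0 : 0 < eta^-1 by rewrite invr_gt0.
have h2 : (1 + eta^-1) * (1 + eta * t) <= (1 + eta^-1) * expR (eta * t).
  by rewrite ler_pM2l//; lra.
apply: le_trans h2.
have -> : (1 + eta^-1) * (1 + eta * t) = 1 + t + eta^-1 + eta * t.
  by field; rewrite gt_eqF.
have : 0 <= eta * t by rewrite mulr_ge0// ltW.
lra.
Qed.

(** Bookkeeping for [negative_part_bound]: [n] telescoping steps, T = 1 + |y|^2 for the point y
    there, [a] the sum of the |a_i|, [X] the exponential; here [x] stands for - g z and [y] for g z
    - g a. *)
Lemma growth_product (q L T a K D X n x y : R) :
  0 <= q -> 0 <= L -> 1 <= T -> 0 <= a -> 0 <= K -> 0 <= D -> 1 <= X ->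
  n <= (L + 1) * T -> x <= D * X -> 0 <= n ->
  y <= (q * (L * T) + a) * (K + 4 * (n * (D * X))) ->
  x + y <= (D + (q * L + 1) * (K + 4 * ((L + 1) * D))) * (T ^+ 2 * (1 + a) * X).
Proof.
move=> q0 L0 T1 a0 K0 D0 X1 nT xD n0 h.
have T0 : 0 <= T by lra.
have X0 : 0 <= X by lra.
have qL : 0 <= q * L by exact: mulr_ge0.
have DX0 : 0 <= D * X by exact: mulr_ge0.
have F1 : q * (L * T) + a <= (q * L + 1) * (T * (1 + a)).
  have := mulr_ge0 qL (mulr_ge0 T0 a0); have : 0 <= (T - 1) * (1 + a).
    by apply: mulr_ge0; lra.
  lra.
have F2 : K + 4 * (n * (D * X)) <= (K + 4 * ((L + 1) * D)) * (T * X).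
  have h1 := ler_wpM2r DX0 nT.
  have h2 : K <= K * (T * X).
    by rewrite ler_peMr// -[leLHS]mulr1; apply: ler_pM.
  lra.
have F3 : y <= (q * L + 1) * (T * (1 + a)) * ((K + 4 * ((L + 1) * D)) * (T * X)).
  apply: (le_trans h); apply: ler_pM => //.
    by rewrite addr_ge0// mulr_ge0// mulr_ge0.
  by rewrite addr_ge0// !mulr_ge0.
have F4 : D * X <= D * (T ^+ 2 * (1 + a) * X).
  rewrite ler_wpM2l// ler_peMl// -[leLHS]mulr1; apply: ler_pM => //; last by lra.
  exact: exprn_ege1.
have -> : (D + (q * L + 1) * (K + 4 * ((L + 1) * D))) * (T ^+ 2 * (1 + a) * X) =
  D * (T ^+ 2 * (1 + a) * X) +
  (q * L + 1) * (T * (1 + a)) * ((K + 4 * ((L + 1) * D)) * (T * X)) by ring.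
by lra.
Qed.

Lemma sqr_le_expR (e eta t : R) : 0 < e -> e <= 1 -> 4 * e <= eta -> 0 <= t ->
  (1 + t) ^+ 2 * expR ((1 + e) ^+ 2 * (t / 2)) <=
  (1 + (e / 4)^-1) ^+ 2 * expR ((1 + eta) * (t / 2)).
Proof.
move=> e0 e1 e4 t0; set c := 1 + (e / 4)^-1; set X := expR ((1 + e) ^+ 2 * _).
have e40 : 0 < e / 4 by lra.
have c0 : 0 <= c by rewrite addr_ge0// invr_ge0 ltW.
have h1 : (1 + t) ^+ 2 <= (c * expR (e / 4 * t)) ^+ 2.
  by rewrite lerXn2r ?nnegrE//; [rewrite addr_ge0|
    rewrite mulr_ge0// expR_ge0|exact: le1D_expR].
apply: le_trans (ler_wpM2r (expR_ge0 _) h1) _; rewrite exprMn -[leLHS]mulrA.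
apply: ler_wpM2l; first exact: sqr_ge0.
rewrite expr2 -!expRD ler_expR.
have h : (1 + e) ^+ 2 + e <= 1 + eta by nra.
have := ler_wpM2r (divr_ge0 t0 (ler0n R 2)) h; lra.
Qed.

Lemma norm_le1D_sqn n (y : 'cV[R]_n) l : `|y l ord0| <= 1 + sqn y.
Proof.
have := sqn_coord y l; rewrite -real_normK ?num_real//.
have := normr_ge0 (y l ord0); set t := `|_|; move=> t0 h; nra.
Qed.

Lemma mulmx_coord_bound n k (A : 'M[R]_(n, k)) : exists2 L, 0 <= L &
  forall y i, `|(A *m y) i ord0| <= L * (1 + sqn y).
Proof.
exists (\sum_i \sum_l `|A i l|).
  by rewrite sumr_ge0// => i _; rewrite sumr_ge0.
move=> y i; rewrite mxE (le_trans (ler_norm_sum _ _ _))//.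
apply: (@le_trans _ _ ((\sum_l `|A i l|) * (1 + sqn y))).
  rewrite mulr_suml; apply: ler_sum => l _.
  by rewrite normrM ler_wpM2l// norm_le1D_sqn.
apply: ler_wpM2r; first by have := sqn_ge0 y; lra.
by rewrite [leRHS](bigD1 i)//= lerDl sumr_ge0// => j _; rewrite sumr_ge0.
Qed.

(** [box_pick] is used at [y] to choose [s], then at the pair [y], [y + s] to choose one [w] good
    for both. Since the box is bounded, growth at [y + s] becomes growth at [y] with a slightly
    larger exponent. *)
Lemma three_pick k (p : 'cV[R]_k -> R) (q1 q2 : 'cV[R]_k) (r eta : R) :
  (gamma R k).-integrable setT (EFin \o p) -> 0 < eta -> 0 < r ->
  exists2 C, 0 <= C & forall y, exists s w, [/\ box q1 r s, box q2 r w &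
    [/\ `|p (y + s)| <= C * expR ((1 + eta) * (sqn y / 2)),
        `|p (y + w)| <= C * expR ((1 + eta) * (sqn y / 2)) &
        `|p (y + s + w)| <= C * expR ((1 + eta) * (sqn y / 2))]].
Proof.
move=> ip eta0 r0.
pose e := Num.min 1 (eta / 3).
have e0 : 0 < e by rewrite lt_min ltr01 divr_gt0.
have e1 : e <= 1 by rewrite ge_min lexx.
have e3 : 3 * e <= eta by rewrite mulrC -ler_pdivlMr// ge_min lexx orbT.
have [C1 C10 P1] := box_pick q1 ip e0 r0.
have [C2 C20 P2] := box_pick q2 ip e0 r0.
have [M0 MP] := sqn_box q1 r.
pose M := Num.max M0 0.
pose D := expR ((1 + e) * ((1 + e^-1) * M / 2)).
have D0 : 0 < D by exact: expR_gt0.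
have Eeta (y : 'cV[R]_k) : expR ((1 + e) * (sqn y / 2)) <= expR ((1 + eta) * (sqn y / 2)) :> R.
  rewrite ler_expR ler_wpM2r ?divr_ge0 ?sqn_ge0//; lra.
have Es y s : box q1 r s ->
    expR ((1 + e) * (sqn (y + s) / 2)) <= D * expR ((1 + eta) * (sqn y / 2)).
  move=> /MP hs; rewrite /D -expRD ler_expR.
  have hsM : sqn s <= M by rewrite le_max hs.
  have h1 := sqnD_le y s e0.
  have sy := sqn_ge0 y.
  have i0 : 0 < e^-1 by rewrite invr_gt0.
  have h2 : (1 + e^-1) * sqn s <= (1 + e^-1) * M by rewrite ler_pM2l//; lra.
  have h3 : (1 + e) * sqn (y + s) <= (1 + e) * ((1 + e) * sqn y + (1 + e^-1) * M).
    by rewrite ler_pM2l//; lra.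
  have h4 : (1 + e) * ((1 + e) * sqn y) <= (1 + eta) * sqn y.
    rewrite mulrA ler_wpM2r//; nra.
  lra.
exists (2 * C1 + C2 * (1 + D)).
  by rewrite addr_ge0 ?mulr_ge0// ?addr_ge0// ltW.
move=> y; have [s [s1 s2 _]] := P1 y y.
have [w [w1 w2 w3]] := P2 y (y + s).
exists s, w; split => //.
have h1 := Eeta y; have h2 := Es y s s1.
set E := expR ((1 + eta) * _) in h1 h2 *.
have E0 : 0 < E by exact: expR_gt0.
have a1 : C1 * (expR ((1 + e) * (sqn y / 2)) + expR ((1 + e) * (sqn y / 2)))
    <= C1 * (2 * E) by rewrite ler_wpM2l//; lra.
have a2 : C2 * (expR ((1 + e) * (sqn y / 2)) + expR ((1 + e) * (sqn (y + s) / 2)))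
    <= C2 * ((1 + D) * E) by rewrite ler_wpM2l//; lra.
have p1 : 0 <= C1 * (2 * E) by rewrite !mulr_ge0// ltW.
have p2 : 0 <= C2 * ((1 + D) * E) by rewrite !mulr_ge0 ?addr_ge0// ltW.
have -> : (2 * C1 + C2 * (1 + D)) * E = C1 * (2 * E) + C2 * ((1 + D) * E) by ring.
by split; lra.
Qed.

Context (d k : nat) (A : 'M[R]_(d, k)) (u0 : 'cV[R]_k) (g : 'cV[R]_d -> R).
Hypotheses (Au0 : forall i, (forall l, A i l = 0) \/ 1 <= (A *m u0) i ord0)
  (mg : measurable_fun setT g) (gid : incdiff g) (grc : ray_convex g)
  (gi : gint A g).

Let v := A *m u0.

Let inactive i (x : 'cV[R]_k) : (forall l, A i l = 0) -> (A *m x) i ord0 = 0.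
Proof. by move=> Ai; rewrite mxE big1// => l _; rewrite Ai mul0r. Qed.

Lemma nnegv_direction : nnegv v.
Proof. by move=> i; case: (Au0 i) => [/inactive ->//|]; rewrite /v; lra. Qed.

(** [A *m u0] is at least 1 on the nonzero rows, which leaves room for small perturbations of
    [u0]. *)
Let box_nneg : exists2 r, 0 < r & forall u, box u0 r u -> nnegv (A *m u).
Proof.
pose L := \sum_i \sum_l `|A i l|.
have L0 : 0 <= L by rewrite sumr_ge0// => i _; rewrite sumr_ge0.
have r0 : 0 < (1 + L)^-1 by rewrite invr_gt0; lra.
exists (1 + L)^-1 => // u hu i; case: (Au0 i) => [/inactive ->//|h].
have : `|(A *m (u - u0)) i ord0| <= 1.
  rewrite mxE (le_trans (ler_norm_sum _ _ _))//.
  apply: (@le_trans _ _ ((\sum_l `|A i l|) * (1 + L)^-1)).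
    rewrite mulr_suml; apply: ler_sum => l _.
    rewrite normrM ler_wpM2l// !mxE.
    have := hu l; rewrite in_itv/= => /andP[h1 h2].
    by rewrite ler_norml; apply/andP; split; lra.
  rewrite ler_pdivrMr ?mul1r; last lra.
  apply: (@le_trans _ _ L); last lra.
  by rewrite /L [leRHS](bigD1 i)//= lerDl sumr_ge0// => j _; rewrite sumr_ge0.
have -> : (A *m (u - u0)) i ord0 = (A *m u) i ord0 - (A *m u0) i ord0.
  by rewrite mulmxBr !mxE.
by rewrite ler_norml => /andP[h1 _]; lra.
Qed.

(* An integrable function has Gaussian growth only at well chosen points; the
   two inequalities of increasing differences that express g at A y through
   such points in y - box and y + box make the bound pointwise. *)
Lemma pointwise_bound eta : 0 < eta -> exists2 C, 0 <= C &
  forall y, `|g (A *m y)| <= C * expR ((1 + eta) * (sqn y / 2)).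
Proof.
move=> eta0; have [r r0 hr] := box_nneg.
have hrN u : box (- u0) r u -> nnegv (A *m (- u)).
  move=> hu; apply: hr => i; have := hu i; rewrite !mxE !in_itv/= => /andP[h1 h2].
  by apply/andP; split; lra.
have [C1 C10 P1] := three_pick (- u0) u0 gi eta0 r0.
have [C2 C20 P2] := three_pick u0 u0 gi eta0 r0.
exists (3 * C1 + 3 * C2); first by rewrite addr_ge0// mulr_ge0.
move=> y; set E := expR _.
have E0 : 0 < E by exact: expR_gt0.
(* Here A y is a middle corner of the parallelogram whose lowest corner is A (y + s), with - s near
   [u0]. *)
have up : g (A *m y) <= 3 * C1 * E.
  have [s [w [/hrN hs /hr hw []]]] := P1 y; rewrite -/E => b1 b2 b3.
  have := gid (A *m (y + s)) hs hw; rewrite -!mulmxDr addrK.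
  move: b1 b2 b3; rewrite !ler_norml => /andP[_ b1] /andP[_ b2] /andP[b3 _].
  lra.
(* Here A y is the lowest corner. *)
have dn : - (3 * C2 * E) <= g (A *m y).
  have [s [w [/hr hs /hr hw []]]] := P2 y; rewrite -/E => b1 b2 b3.
  have := gid (A *m y) hs hw; rewrite -!mulmxDr.
  move: b1 b2 b3; rewrite !ler_norml => /andP[b1 _] /andP[b2 _] /andP[_ b3].
  lra.
have p1 : 0 <= 3 * C1 * E by rewrite !mulr_ge0// ltW.
have p2 : 0 <= 3 * C2 * E by rewrite !mulr_ge0// ltW.
have -> : (3 * C1 + 3 * C2) * E = 3 * C1 * E + 3 * C2 * E by ring.
by rewrite ler_norml; apply/andP; split; lra.
Qed.

(* Convexity bounds g a from below by g and its upper increments at A y >= a;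
   these increments telescope along the segment from 0 to A y. *)
Lemma negative_part_bound eta : 0 < eta -> exists2 C, 0 <= C &
  forall (y : 'cV[R]_k) (a : 'cV[R]_d), (forall i, a i ord0 <= (A *m y) i ord0) ->
    (forall i, (forall l, A i l = 0) -> a i ord0 = 0) ->
    - g a <= C * (1 + \sum_i `|a i ord0|) * expR ((1 + eta) * (sqn y / 2)).
Proof.
move=> eta0.
pose e := Num.min 1 (eta / 4).
have e0 : 0 < e by rewrite lt_min ltr01 divr_gt0.
have e1 : e <= 1 by rewrite ge_min lexx.
have e4 : 4 * e <= eta by rewrite mulrC -ler_pdivlMr// ge_min lexx orbT.
have [C0 C00 P] := pointwise_bound e0.
have [L L0 LP] := mulmx_coord_bound A.
pose U := sqn u0; have U0 : 0 <= U := sqn_ge0 u0.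
have i0 : 0 < e^-1 by rewrite invr_gt0.
pose D := C0 * expR ((1 + e) * ((1 + e^-1) * (2 * U))).
have D0 : 0 <= D by rewrite mulr_ge0// expR_ge0.
pose K0 := \sum_i `|g (delta_mx i ord0) - g 0|.
have K00 : 0 <= K0 by rewrite sumr_ge0.
pose B0 := D + (d%:R * L + 1) * (K0 + 4 * ((L + 1) * D)).
have dL : 0 <= d%:R * L by rewrite mulr_ge0.
have B00 : 0 <= B0.
  apply: addr_ge0 => //; apply: mulr_ge0; first lra.
  by apply: addr_ge0 => //; rewrite !mulr_ge0//; lra.
exists (B0 * (1 + (e / 4)^-1) ^+ 2).
  by rewrite mulr_ge0// sqr_ge0.
move=> y a ay a0.
pose t := sqn y; have t0 : 0 <= t := sqn_ge0 y.
pose X := expR ((1 + e) ^+ 2 * (t / 2)).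
have X1 : 1 <= X by rewrite /X -expR0 ler_expR !mulr_ge0// addr_ge0// ltW.
pose z := A *m y.
(* Enough steps for z / n <= v: the coordinates of [z] are below [n], and those of [v] are at least
   1 on nonzero rows. *)
pose n := (Num.truncn (L * (1 + t))).+1.
have Lt0 : 0 <= L * (1 + t) by rewrite mulr_ge0//; lra.
have n1 : L * (1 + t) < n%:R by rewrite truncnS_gt.
have n2 : n%:R <= (L + 1) * (1 + t).
  rewrite /n -natr1 mulrDl mul1r; apply: lerD; last lra.
  by rewrite truncn_le.
have n0 : 0 < n%:R :> R by rewrite ltr0n.
have gz (s c : R) : 0 <= s <= 1 -> 0 <= c <= 2 ->
    `|g (s *: z + c *: v)| <= D * X.
  move=> /andP[s0 s1] /andP[c0 c1].
  have -> : s *: z + c *: v = A *m (s *: y + c *: u0).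
    by rewrite mulmxDr -!scalemxAr.
  apply: le_trans (P _) _; rewrite /D -mulrA ler_wpM2l// /X -expRD ler_expR.
  have h1 := sqnD_le (s *: y) (c *: u0) e0.
  rewrite !sqnZ -/t -/U in h1.
  have h2 : s ^+ 2 * t <= t by rewrite ler_piMl// expr_le1.
  have h3 : c ^+ 2 * U <= 4 * U by rewrite ler_wpM2r//; nra.
  have h4 : (1 + e) * (s ^+ 2 * t) <= (1 + e) * t by rewrite ler_pM2l//; lra.
  have h5 : (1 + e^-1) * (c ^+ 2 * U) <= (1 + e^-1) * (4 * U).
    by rewrite ler_pM2l//; lra.
  have h6 : (1 + e) * sqn (s *: y + c *: u0) <=
      (1 + e) * ((1 + e) * t + (1 + e^-1) * (4 * U)).
    by rewrite ler_pM2l//; lra.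
  lra.
(* Zero rows are exempt: [z] and [a] both vanish there, so the slope gets weight 0 in
   [gradient_le]. *)
have ki i : (forall l, A i l = 0) \/
    g (z + delta_mx i ord0) - g z <= K0 + 4 * (n%:R * (D * X)).
  case: (Au0 i) => [Ai|hi]; [by left|right].
  have e_n : nnegv (delta_mx i ord0 : 'cV[R]_d).
    by rewrite -[delta_mx _ _]scale1r; exact: nnegv_delta.
  have ev : nnegv (v - delta_mx i ord0).
    move=> j; have -> : (v - delta_mx i ord0) j ord0 = v j ord0 - (j == i)%:R.
      by rewrite !mxE eqxx andbT.
    case: eqVneq => [->|_]; first by rewrite subr_ge0.
    by rewrite subr0; exact: nnegv_direction.
  have zv : nnegv (v - n%:R^-1 *: z).
    move=> j; have -> : (v - n%:R^-1 *: z) j ord0 = v j ord0 - n%:R^-1 * z j ord0.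
      by rewrite !mxE.
    case: (Au0 j) => [Aj|hj].
      by rewrite /v /z !inactive// mulr0 subrr.
    rewrite subr_ge0 (le_trans _ hj)// mulrC ler_pdivrMr// mul1r.
    by rewrite (le_trans (ler_norm _))// (le_trans (LP y j))// ltW.
  have h := telescope_le gid (isT : (0 < n)%N) e_n ev zv.
  apply: le_trans h _; apply: lerD.
    rewrite (le_trans (ler_norm _))// /K0 [leRHS](bigD1 i)//= lerDl.
    by rewrite sumr_ge0.
  apply: (@le_trans _ _ (\sum_(j < n) 4 * (D * X))); last first.
    by rewrite sumr_const card_ord -[in leLHS]mulr_natr; lra.
  apply: ler_sum => j _.
  have j01 : 0 <= (j%:R / n%:R : R) <= 1.
    by rewrite divr_ge0//= ler_pdivrMr// mul1r ler_nat ltnW.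
  have c0 : 0 <= (0 : R) <= 2 by rewrite lexx ler0n.
  have c1 : 0 <= (1 : R) <= 2 by rewrite ler01 ler1n.
  have c2 : 0 <= (2 : R) <= 2 by rewrite lexx ler0n.
  have b0 := gz (j%:R / n%:R) 0 j01 c0.
  have b1 := gz (j%:R / n%:R) 1 j01 c1.
  have b2 := gz (j%:R / n%:R) 2 j01 c2.
  rewrite scale0r addr0 in b0; rewrite scale1r in b1.
  move: b0 b1 b2; rewrite !ler_norml => /andP[_ b0] /andP[b1 _] /andP[_ b2].
  lra.
have u_ge0 : nnegv (z - a).
  by move=> i; have := ay i; rewrite -/z !mxE subr_ge0.
have := gradient_le gid grc u_ge0 (subrKC a z).
set S := \sum_i _ => hS.
pose Sa := \sum_i `|a i ord0|; have Sa0 : 0 <= Sa by rewrite sumr_ge0.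
have DX0 : 0 <= D * X by rewrite mulr_ge0// expR_ge0.
have KX0 : 0 <= K0 + 4 * (n%:R * (D * X)).
  by apply: addr_ge0 => //; rewrite mulr_ge0// mulr_ge0// ltW.
have S1 : S <= (d%:R * (L * (1 + t)) + Sa) * (K0 + 4 * (n%:R * (D * X))).
  have -> : d%:R * (L * (1 + t)) + Sa = \sum_i (L * (1 + t) + `|a i ord0|).
    by rewrite big_split/= sumr_const card_ord mulr_natl.
  rewrite mulr_suml; apply: ler_sum => i _.
  have zi : (z - a) i ord0 <= L * (1 + t) + `|a i ord0|.
    have -> : (z - a) i ord0 = z i ord0 - a i ord0 by rewrite !mxE.
    apply: lerD; first by rewrite (le_trans (ler_norm _))// LP.
    by rewrite -normrN ler_norm.
  case: (ki i) => [Ai|hk].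
    have -> : (z - a) i ord0 = 0.
      have -> : (z - a) i ord0 = z i ord0 - a i ord0 by rewrite !mxE.
      by rewrite /z inactive// a0// subr0.
    by rewrite mul0r mulr_ge0// addr_ge0.
  apply: (@le_trans _ _ ((z - a) i ord0 * (K0 + 4 * (n%:R * (D * X))))).
    by rewrite ler_wpM2l// u_ge0.
  by rewrite ler_wpM2r.
have gz1 : - g z <= D * X.
  have h10 : 0 <= (1 : R) <= 1 by rewrite ler01 lexx.
  have h02 : 0 <= (0 : R) <= 2 by rewrite lexx ler0n.
  have := gz 1 0 h10 h02; rewrite scale1r scale0r addr0; apply: le_trans.
  by rewrite -normrN ler_norm.
have T1 : 1 <= 1 + t by rewrite lerDl.
have -> : - g a = - g z + (g z - g a) by rewrite addKr.
have := growth_product (ler0n R d) L0 T1 Sa0 K00 D0 X1 n2 gz1 (ltW n0)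
  (le_trans hS S1).
rewrite -/B0 => F5; apply: (le_trans F5).
have -> : B0 * ((1 + t) ^+ 2 * (1 + Sa) * X) = B0 * (1 + Sa) * ((1 + t) ^+ 2 * X).
  by ring.
have -> : B0 * (1 + (e / 4)^-1) ^+ 2 * (1 + Sa) * expR ((1 + eta) * (t / 2)) =
  B0 * (1 + Sa) * ((1 + (e / 4)^-1) ^+ 2 * expR ((1 + eta) * (t / 2))) by ring.
by apply: ler_wpM2l; [rewrite mulr_ge0// addr_ge0|exact: sqr_le_expR].
Qed.

End growth.

(** * Integrability gained by contraction *)

Section shrinking.
Context (R : realType) (d k : nat) (A : 'M[R]_(d, k)) (u0 : 'cV[R]_k)
  (g : 'cV[R]_d -> R) (th : R).
Hypotheses (Au0 : forall i, (forall l, A i l = 0) \/ 1 <= (A *m u0) i ord0)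
  (mg : measurable_fun setT g) (gid : incdiff g) (grc : ray_convex g)
  (gi : gint A g) (th01 : 0 < th < 1).

Let v := A *m u0.

Lemma measurable_funZ (f : 'cV[R]_d -> R) (t : R) : measurable_fun setT f ->
  measurable_fun setT (fun x : 'cV[R]_d => f (t *: x)).
Proof.
move=> mf; apply: (measurableT_comp mf).
have -> : *:%R t = mulmx t%:M :> ('cV[R]_d -> 'cV[R]_d).
  by apply/funext => x; rewrite mul_scalar_mx.
exact: measurable_mulmx.
Qed.

(** [dominating_point] places th B w below A y with |y| only slightly larger than th |w|, and
    [negative_part_bound] applies at this [y]. As th < 1, the resulting Gaussian exponent is
    integrable. *)
Lemma negative_part_integrable : exists2 kap : R, 0 < kap &
  forall m (B : 'M[R]_(d, m)), (forall l : 'cV[R]_d, (forall i, 0 <= l i ord0) ->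
    sqn (B^T *m l) <= (1 + kap) * sqn (A^T *m l)) ->
  gint B (fun x : 'cV[R]_d => Num.max (- g (th *: x)) 0).
Proof.
case/andP: th01 => th0 th1.
(* The gap 1 - th^2 = 16 kap pays for (1 + kap)^3 <= 1 + 4 kap and for the 2 kap spent on the
   polynomial factor. *)
pose kap : R := (1 - th ^+ 2) / 16.
have th2 : 0 < th ^+ 2 by rewrite exprn_gt0.
have th21 : th ^+ 2 < 1 by rewrite expr_lt1// ltW.
have kap0 : 0 < kap by rewrite divr_gt0//; lra.
have kap1 : 1 + kap > 0 by lra.
exists kap => // m B BA.
have [C C0 hC] := negative_part_bound Au0 gid grc gi kap0.
have [L L0 hL] := mulmx_coord_bound B.
pose c := th ^+ 2 + 6 * kap.
have c01 : 0 <= c < 1 by rewrite /c /kap; apply/andP; split; lra.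
pose M := C * ((1 + d%:R * L) * (1 + kap^-1)).
have dL : 0 <= d%:R * L by rewrite mulr_ge0.
have ki : 0 < kap^-1 by rewrite invr_gt0.
have M0 : 0 <= M by rewrite !mulr_ge0//; lra.
have mm : measurable_fun setT (fun x : 'cV[R]_d => Num.max (- g (th *: x)) 0).
  apply: measurable_maxr => //.
  by apply: measurableT_comp => //; exact: measurable_funZ.
have := integrableZl measurableT M (integrable_exp_sqn m c01).
apply: le_integrable => //; first exact: (measurable_gfun B mm).
move=> w _; rewrite -EFinM /= lee_fin.
have E0 := expR_gt0 (c * (sqn w / 2)).
rewrite !ger0_norm ?le_max ?lexx ?orbT//; last by rewrite mulr_ge0// ltW.
have ME0 : 0 <= M * expR (c * (sqn w / 2)) by rewrite mulr_ge0// ltW.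
rewrite ge_max ME0 andbT scalemxAr.
have [y By ny] := dominating_point Au0 BA kap1 kap0 (th *: w).
have inact i : (forall l, A i l = 0) -> (B *m (th *: w)) i ord0 = 0.
  move=> Ai; rewrite mxE big1// => l _.
  suff -> : B i l = 0 by rewrite mul0r.
  have := BA (delta_mx i ord0).
  have -> : A^T *m delta_mx i ord0 = 0 :> 'cV[R]_k.
    by rewrite -colE; apply/matrixP => a b; rewrite !mxE Ai.
  rewrite {2}/sqn dot0l mulr0 => h.
  have /h {}h : forall a, 0 <= (delta_mx i ord0 : 'cV[R]_d) a ord0.
    by move=> a; rewrite mxE.
  have B0 : B^T *m delta_mx i ord0 = 0 :> 'cV[R]_m.
    by apply: sqn_eq0; apply/eqP; rewrite eq_le h sqn_ge0.
  by move/matrixP : B0 => /(_ l ord0); rewrite -colE !mxE.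
apply: le_trans (hC y _ By inact) _.
pose t := sqn w; have t0 : 0 <= t := sqn_ge0 w.
rewrite sqnZ -/t in ny.
have S1 : 1 + \sum_i `|(B *m (th *: w)) i ord0| <=
    (1 + d%:R * L) * ((1 + kap^-1) * expR (kap * t)).
  apply: (@le_trans _ _ ((1 + d%:R * L) * (1 + t))); last first.
    by apply: ler_wpM2l; [lra|exact: le1D_expR].
  have : \sum_i `|(B *m (th *: w)) i ord0| <= d%:R * (L * (1 + t)).
    apply: (@le_trans _ _ (\sum_(i < d) L * (1 + t))); last first.
      by rewrite sumr_const card_ord mulr_natl.
    apply: ler_sum => i _; apply: le_trans (hL _ i) _.
    rewrite sqnZ -/t ler_wpM2l// lerD2l; nra.
  by rewrite mulrDl mul1r mulrA; lra.
have S2 : (1 + kap) * (sqn y / 2) <= (th ^+ 2 + 4 * kap) * (t / 2).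
  have h3 : (1 + kap) * ((1 + kap) * (1 + kap) * th ^+ 2) <= th ^+ 2 + 4 * kap.
    have k16 : kap <= 1 / 16 by rewrite /kap; lra.
    have : (1 + kap) * (1 + kap) * (1 + kap) <= 1 + 4 * kap by nra.
    move=> h; have := ler_wpM2r (ltW th2) h; have := ler_wpM2l (ltW kap0) (ltW th21).
    lra.
  have := ler_wpM2r t0 h3; have := ny.
  have : 0 <= 1 + kap by lra.
  move=> k0 h1 h2; have := ler_wpM2l k0 h1; lra.
rewrite -mulrA /M -[leRHS]mulrA; apply: ler_wpM2l => //.
apply: (@le_trans _ _ ((1 + d%:R * L) * ((1 + kap^-1) * expR (kap * t)) *
    expR ((th ^+ 2 + 4 * kap) * (t / 2)))).
  apply: ler_pM => //; first by rewrite addr_ge0// sumr_ge0.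
  by rewrite ler_expR.
rewrite [X in X * _]mulrA -[leLHS]mulrA -expRD; apply: ler_wpM2l.
  by rewrite mulr_ge0//; lra.
by rewrite ler_expR /c -/t; lra.
Qed.

(** The added column eps v = A (eps u0) stays in the range of [A], so [pointwise_bound] yields one
    integrable majorant for all small eps; pointwise convergence comes from [ray_lipschitz]. *)
Lemma shrunk_limit (eps1 : R) : 0 < eps1 -> exists2 eps0 : R, 0 < eps0 <= eps1 &
  (forall eps, 0 <= eps <= eps0 ->
     gint (row_mx A (eps *: v)) (fun x => g (th *: x))) /\
  (forall e : \bar R, (forall eps, 0 < eps <= eps0 ->
     (e <= gexp (row_mx A (eps *: v)) (fun x => g (th *: x)))%E) ->
     (e <= gexp A (fun x => g (th *: x)))%E).
Proof.
move=> eps10; case/andP: th01 => th0 th1.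
pose kap : R := (1 - th ^+ 2) / 16.
have th2 : 0 < th ^+ 2 by rewrite exprn_gt0.
have th21 : th ^+ 2 < 1 by rewrite expr_lt1// ltW.
have kap0 : 0 < kap by rewrite divr_gt0//; lra.
have k16 : kap <= 1 / 16 by rewrite /kap; lra.
have [C C0 hC] := pointwise_bound Au0 gid gi kap0.
pose c := (1 + kap) * ((1 + kap) * th ^+ 2).
have c01 : 0 <= c < 1.
  have E : th ^+ 2 = 1 - 16 * kap by rewrite /kap; lra.
  rewrite /c E; apply/andP; split; nra.
pose U := sqn u0 + 1; have U0 : 0 < U by have := sqn_ge0 u0; rewrite /U; lra.
pose eps0 := Num.min eps1 (Num.min 1 (kap / U)).
have e00 : 0 < eps0 by rewrite !lt_min eps10 ltr01 divr_gt0.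
pose dom (z : 'cV[R]_(k + 1)) := C * expR (c * (sqn z / 2)).
have idom : (gamma R (k + 1)).-integrable setT (fun z => (dom z)%:E).
  exact: (integrableZl measurableT C (integrable_exp_sqn (k + 1) c01)).
pose gs := fun x : 'cV[R]_d => g (th *: x).
have mgs : measurable_fun setT gs by exact: measurable_funZ.
have bound eps z : 0 <= eps <= eps0 ->
    `|gs (row_mx A (eps *: v) *m z)| <= dom z.
  move=> /andP[ep0 ep1].
  rewrite -[z]vsubmxK; move: (usubmx z) (dsubmx z) => y q.
  rewrite /gs /dom mul_row_col sqn_col_mx.
  have -> : th *: (A *m y + eps *: v *m q) =
      A *m (th *: (y + (eps * q ord0 ord0) *: u0)).
    rewrite -!scalemxAr mulmxDr -scalemxAr /v; congr (_ *: (_ + _)).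
    by rewrite (mx11_scalar q) mul_mx_scalar scalerA mxE eqxx mulrC.
  apply: le_trans (hC _) _; apply: ler_wpM2l => //; rewrite ler_expR sqnZ.
  have h1 := sqnD_le y ((eps * q ord0 ord0) *: u0) kap0.
  rewrite sqnZ in h1.
  have q2 : sqn q = q ord0 ord0 ^+ 2 by rewrite /sqn dotE big_ord1 expr2.
  have h2 : eps ^+ 2 * sqn u0 <= kap.
    apply: (@le_trans _ _ (eps * U)).
      have e1 : eps <= 1 by rewrite (le_trans ep1)// !ge_min lexx !orbT.
      rewrite expr2 -mulrA ler_wpM2l// /U.
      have := sqn_ge0 u0; nra.
    by rewrite -ler_pdivlMr// (le_trans ep1)// !ge_min lexx !orbT.
  have h3 : (1 + kap^-1) * ((eps * q ord0 ord0) ^+ 2 * sqn u0) <= (1 + kap) * sqn q.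
    rewrite q2 exprMn.
    have -> : (1 + kap^-1) * (eps ^+ 2 * q ord0 ord0 ^+ 2 * sqn u0) =
      (1 + kap^-1) * (eps ^+ 2 * sqn u0) * q ord0 ord0 ^+ 2 by ring.
    apply: ler_wpM2r; first exact: sqr_ge0.
    have -> : 1 + kap = (1 + kap^-1) * kap by field; rewrite gt_eqF.
    by apply: ler_wpM2l => //; have : 0 < kap^-1 by [rewrite invr_gt0]; lra.
  rewrite /c.
  have h4 : sqn (y + (eps * q ord0 ord0) *: u0) <= (1 + kap) * (sqn y + sqn q) by lra.
  have h5 : 0 <= (1 + kap) * th ^+ 2 by rewrite mulr_ge0; lra.
  have := ler_wpM2l h5 h4; lra.
have gint_eps eps : 0 <= eps <= eps0 -> gint (row_mx A (eps *: v)) gs.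
  move=> he; apply: le_integrable idom => //; first exact: measurable_gfun.
  move=> z _; rewrite /= lee_fin; apply: le_trans (bound _ z he) _.
  exact: ler_norm.
exists eps0; first by rewrite e00 ge_min lexx.
split=> // e he.
pose en (n : nat) := eps0 * harmonic n.
have h0 n : 0 < (harmonic n : R) by exact: harmonic_gt0.
have h1 n : (harmonic n : R) <= 1 by rewrite /harmonic/= invf_le1 ?ler1n.
have en0 n : 0 < en n <= eps0.
  by rewrite /en; apply/andP; split; [exact: mulr_gt0|apply: ler_piMr => //; exact: ltW].
(* A zero column puts the limit on the same Gaussian space as the approximations. *)
have -> : gexp A gs = gexp (row_mx A (0 *: v)) gs.
  apply: samelaw_gexp => //; apply: gram_samelaw.
  by rewrite gram_row_mx scale0r mul0mx addr0.
have cv : gexp (row_mx A (en n *: v)) gs @[n --> \oo] --> gexp (row_mx A (0 *: v)) gs.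
  apply: (dominated_cvg (g := fun z => (dom z)%:E) measurableT) => //.
  - by move=> n; exact: measurable_gfun.
  - move=> z _; apply/fine_cvgP; split; first by near=> n.
    rewrite -[z]vsubmxK; move: (usubmx z) (dsubmx z) => y q /=.
    under eq_fun do rewrite mul_row_col.
    rewrite mul_row_col scale0r mul0mx addr0.
    pose x := th *: (A *m y); pose p := th *: v; pose s := q ord0 ord0.
    have Ep (a : R) : th *: (A *m y + a *: v *m q) = x + (a * s) *: p.
      rewrite scalerDr -/x; congr (_ + _).
      rewrite (mx11_scalar q) mul_mx_scalar /p !scalerA; congr (_ *: _).
      by rewrite /s; ring.
    rewrite /gs -/x; under eq_fun do rewrite Ep.
    have p0 : nnegv p.
      by apply: nnegvZ; [exact: ltW|exact: nnegv_direction].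
    pose K := `|g (x + p) - g x| + `|g x - g (x - p)|.
    have K0 : 0 <= K by rewrite addr_ge0.
    have cen : (fun n => en n * s) @ \oo --> (0 : R).
      rewrite -[X in _ --> X](mul0r s); apply: cvgMl.
      by rewrite -[X in _ --> X](mulr0 eps0); apply: cvgMr; exact: cvg_harmonic.
    apply/cvgrPdist_le => e1 e10.
    have K1 : 0 < K + 1 by lra.
    have d0 : 0 < Num.min 1 (e1 / (K + 1)) by rewrite lt_min ltr01 divr_gt0.
    near=> n; have : `|en n * s| <= Num.min 1 (e1 / (K + 1)).
      by near: n; exact: (cvgr0_norm_le _ cen _ d0).
    rewrite le_min => /andP[a1 a2].
    rewrite distrC; apply: le_trans (ray_lipschitz gid grc x p0 a1) _.
    rewrite -/K; move: a2; rewrite ler_pdivlMr//.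
    have := normr_ge0 (en n * s); move: `|_| => a; nra.
  - by move=> n z _; rewrite lee_fin bound//; have /andP[/ltW -> ->] := en0 n.
apply: (cvge_to_ge cv); near=> n; exact: he.
Unshelve. all: by end_near. Qed.

End shrinking.

(** * Moves between covariance matrices *)

Section gram_moves.
Context (R : realType) (d : nat).
Implicit Types (M N : 'M[R]_d) (p q l v : 'cV[R]_d).

Definition outer p : 'M[R]_d := p *m p^T.

(* Each move increases the expectation of functions with increasing
   differences: a spread by adding an independent nonnegative multiple of a
   normal variable, a swap by replacing two independent coefficients with a
   common one. *)
Inductive gram_move : 'M[R]_d -> 'M[R]_d -> Prop :=
| move_refl M : psd M -> gram_move M M
| move_trans M N S : gram_move M N -> gram_move N S -> gram_move M S
| move_spread M p : psd M -> nnegv p -> gram_move M (M + outer p)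
| move_swap M p q : psd M -> nnegv p -> nnegv q ->
    gram_move (M + outer p + outer q) (M + outer (p + q)).

Lemma psd_outer p : psd (outer p).
Proof. exact: psd_gram. Qed.

Lemma psd0 : psd (0 : 'M[R]_d).
Proof. by apply/psdE; split=> [|x]; rewrite ?trmx0// mul0mx dot0r. Qed.

Lemma psd_outer_sum I (r : seq I) (p : I -> 'cV[R]_d) :
  psd (\sum_(i <- r) outer (p i)).
Proof.
elim/big_ind : _ => [|*|i _]; [exact: psd0|exact: psdD|exact: psd_outer].
Qed.

Lemma dot_outer p l : dot l (outer p *m l) = dot p l ^+ 2.
Proof. by rewrite /outer dot_gram dotE big_ord1 -expr2. Qed.

Lemma dot_nneg p l : nnegv p -> nnegv l -> 0 <= dot p l.
Proof. by move=> p0 l0; rewrite dotE sumr_ge0// => i _; rewrite mulr_ge0. Qed.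

Lemma gram_move_psd M N : gram_move M N -> psd M /\ psd N.
Proof.
elim=> {M N} [M pM|M N S _ [? ?] _ [? ?]|M p pM _|M p q pM _ _]; split=> //;
  by repeat apply: psdD => //; exact: psd_outer.
Qed.

(** A swap adds 2 (p . l) (q . l), which is nonnegative for l >= 0 but not for general [l]; hence
    the cone in [neg_integrable]. *)
Lemma gram_move_quad M N l : gram_move M N -> nnegv l ->
  dot l (M *m l) <= dot l (N *m l).
Proof.
move=> MN l0; elim: MN => {M N} [//|M N S _ h1 _ h2|M p _ p0|M p q _ p0 q0].
- exact: le_trans h1 h2.
- by rewrite mulmxDl dotDr lerDl dot_outer sqr_ge0.
- rewrite !mulmxDl !dotDr !dot_outer -addrA lerD2l dotDl.
  have := mulr_ge0 (dot_nneg p0 l0) (dot_nneg q0 l0); rewrite sqrrD; lra.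
Qed.

Lemma moves_spread I (r : seq I) (p : I -> 'cV[R]_d) M : psd M ->
  (forall i, nnegv (p i)) -> gram_move M (M + \sum_(i <- r) outer (p i)).
Proof.
move=> pM p0; elim: r => [|i r IH]; first by rewrite big_nil addr0; exact: move_refl.
rewrite big_cons [outer _ + _]addrC addrA; apply: move_trans IH _.
by apply: move_spread => //; apply: psdD => //; exact: psd_outer_sum.
Qed.

Lemma moves_swap I (r : seq I) (p q : I -> 'cV[R]_d) M : psd M ->
  (forall i, nnegv (p i)) -> (forall i, nnegv (q i)) ->
  gram_move (M + \sum_(i <- r) (outer (p i) + outer (q i)))
            (M + \sum_(i <- r) outer (p i + q i)).
Proof.
move=> pM p0 q0; elim: r M pM => [|i r IH] M pM.
  by rewrite !big_nil addr0; exact: move_refl.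
rewrite !big_cons; set S := \sum_(j <- r) _.
apply: (@move_trans _ (M + outer (p i + q i) + S)).
  have -> : M + (outer (p i) + outer (q i) + S) = M + S + outer (p i) + outer (q i).
    by rewrite [_ + S]addrC !addrA.
  rewrite [M + _ + S]addrAC; apply: move_swap => //; apply: psdD => //.
  by rewrite /S big_split; apply: psdD; exact: psd_outer_sum.
rewrite addrA; apply: IH; apply: psdD => //; exact: psd_outer.
Qed.

(** Repeated swaps replace independent components by multiples of one common variable. *)
Lemma moves_merge I (r : seq I) (p : I -> 'cV[R]_d) M q : psd M -> nnegv q ->
  (forall i, nnegv (p i)) ->
  gram_move (M + outer q + \sum_(i <- r) outer (p i))
            (M + outer (q + \sum_(i <- r) p i)).
Proof.
move=> pM q0 p0; elim: r q q0 => [|i r IH] q q0.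
  by rewrite !big_nil !addr0; apply: move_refl; apply: psdD => //; exact: psd_outer.
rewrite !big_cons !addrA; set S := \sum_(j <- r) _.
apply: (@move_trans _ (M + outer (q + p i) + S)); last first.
  by apply: IH; exact: nnegvD.
have -> : M + outer q + outer (p i) + S = M + S + outer q + outer (p i).
  by rewrite addrAC; congr (_ + _); rewrite addrAC.
rewrite [M + _ + S]addrAC; apply: move_swap => //; apply: psdD => //.
exact: psd_outer_sum.
Qed.

Lemma outerZ_delta (c : R) i :
  outer (c *: delta_mx i ord0) = c ^+ 2 *: delta_mx i i.
Proof.
by rewrite /outer linearZ/= -scalemxAl -scalemxAr scalerA -expr2 trmx_delta
  mul_delta_mx.
Qed.

Lemma outerZ_delta2 (c : R) i j :
  outer (c *: delta_mx i ord0 + c *: delta_mx j ord0) =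
  c ^+ 2 *: delta_mx i i + c ^+ 2 *: delta_mx j j +
  (c ^+ 2 *: delta_mx i j + c ^+ 2 *: delta_mx j i).
Proof.
rewrite -scalerDr /outer linearZ/= -scalemxAl -scalemxAr scalerA -expr2.
rewrite linearD/= !trmx_delta mulmxDl !mulmxDr !mul_delta_mx.
by apply/matrixP => a b; rewrite !mxE; ring.
Qed.

(* The entries of S' - S are added in n equal steps. A swap creating the
   off-diagonal entries (i, j) and (j, i) uses up diagonal mass, which is
   provided by the matrix eps^2 diag(v^2); it suffices as soon as the row sums
   of (S' - S) / n are at most eps^2. *)
Lemma gram_chain (S S' : 'M[R]_d) v (eps : R) : psd S -> psd S' ->
  (forall i j, S i j <= S' i j) -> nnegv v ->
  (forall i, S' i i = 0 \/ 1 <= v i ord0) -> 0 < eps ->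
  gram_move S (S' + outer (eps *: v)).
Proof.
move=> pS pS' SS' v0 v1 eps0.
pose E := S' - S.
have E0 i j : 0 <= E i j by rewrite /E !mxE subr_ge0.
have Einactive i j : S' i i = 0 -> E i j = 0.
  move=> Si; rewrite /E !mxE (psd_diag0 j pS' Si) (psd_diag0 j pS) ?subrr//.
  by apply/eqP; rewrite eq_le psd_diag_ge0// andbT -Si.
have Esym : E^T = E.
  by case/psdE: pS => S1 _; case/psdE: pS' => S2 _; rewrite /E linearB/= S1 S2.
pose e i : 'cV[R]_d := (eps * v i ord0) *: delta_mx i ord0.
have e0 i : nnegv (e i) by apply: nnegv_delta; rewrite mulr_ge0// ltW.
pose D := \sum_i outer (e i).
have De : D = diag_mx (\row_i (eps * v i ord0) ^+ 2).
  rewrite diag_mx_sum_delta; apply: eq_bigr => i _.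
  by rewrite outerZ_delta mxE.
(* Three stages: spreads from [S] to [S + D], swaps from [S + D] to [S' + D], and merging the
   columns of [D] into [eps *: v]. *)
apply: (@move_trans _ (S + D)); first exact: moves_spread.
apply: (@move_trans _ (S' + D)); last first.
  have -> : S' + D = S' + outer 0 + D by rewrite /outer mul0mx addr0.
  have -> : eps *: v = 0 + \sum_i e i.
    rewrite add0r (nnegv_sum (nnegvZ (ltW eps0) v0)); apply: eq_bigr => i _.
    by rewrite mxE.
  by apply: moves_merge => //; exact: nnegv0.
pose K := \sum_i \sum_j E i j.
have K0 : 0 <= K by rewrite sumr_ge0// => i _; rewrite sumr_ge0.
have KE i : \sum_j E i j <= K.
  by rewrite /K [leRHS](bigD1 i)//= lerDl sumr_ge0// => a _; rewrite sumr_ge0.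
pose n := (Num.truncn (K / eps ^+ 2)).+1.
have ep2 : 0 < eps ^+ 2 by rewrite exprn_gt0.
have nR : 0 < n%:R :> R by rewrite ltr0n.
have Kn : K / n%:R <= eps ^+ 2.
  by rewrite ler_pdivrMr// mulrC -ler_pdivrMr// ltW// truncnS_gt.
(* Half of E / n, because the sum over ordered pairs creates each entry twice, from (i, j) and from
   (j, i). *)
pose W := (2 * n%:R)^-1 *: E.
have WE i j : W i j = (2 * n%:R)^-1 * E i j by rewrite /W mxE.
have W0 i j : 0 <= W i j by rewrite WE mulr_ge0// invr_ge0 mulr_ge0// ltW.
have Wsym : W^T = W by rewrite /W linearZ/= Esym.
pose rho : 'rV[R]_d := \row_i \sum_j W i j.
have S1 : \sum_i \sum_j W i j *: delta_mx i i = diag_mx rho.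
  rewrite diag_mx_sum_delta; apply: eq_bigr => i _.
  by rewrite mxE scaler_suml.
have S2 : \sum_i \sum_j W i j *: delta_mx j j = diag_mx rho.
  rewrite exchange_big/= -S1; apply: eq_bigr => i _; apply: eq_bigr => j _.
  by rewrite -[in LHS]Wsym mxE.
have S3 : \sum_i \sum_j W i j *: delta_mx i j = W by rewrite -matrix_sum_delta.
have S4 : \sum_i \sum_j W i j *: delta_mx j i = W.
  rewrite exchange_big/= -[RHS]S3; apply: eq_bigr => i _; apply: eq_bigr => j _.
  by rewrite -[in LHS]Wsym mxE.
pose p (x : 'I_d * 'I_d) : 'cV[R]_d := Num.sqrt (W x.1 x.2) *: delta_mx x.1 ord0.
pose q (x : 'I_d * 'I_d) : 'cV[R]_d := Num.sqrt (W x.1 x.2) *: delta_mx x.2 ord0.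
have sum1 : \sum_x (outer (p x) + outer (q x)) = diag_mx rho + diag_mx rho.
  rewrite big_split/= -[X in _ = X + _]S1 -[X in _ = _ + X]S2 !pair_big/=.
  by congr (_ + _); apply: eq_bigr => x _; rewrite outerZ_delta sqr_sqrtr.
have sum2 : \sum_x outer (p x + q x) = diag_mx rho + diag_mx rho + n%:R^-1 *: E.
  have -> : n%:R^-1 *: E = W + W.
    rewrite /W -scalerDl; congr (_ *: _); field; exact: lt0r_neq0.
  rewrite -[X in _ = X + _ + _]S1 -[X in _ = _ + X + _]S2.
  rewrite -[X in _ = _ + (X + _)]S3 -[X in _ = _ + (_ + X)]S4 !pair_big/= -!big_split/=.
  by apply: eq_bigr => x _; rewrite outerZ_delta2 sqr_sqrtr.
have step j : (j <= n)%N -> gram_move (S + D) (S + (j%:R / n%:R) *: E + D).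
  elim: j => [_|j IH jn].
    rewrite mul0r scale0r addr0; apply: move_refl; apply: psdD => //.
    exact: psd_outer_sum.
  apply: move_trans (IH (ltnW jn)) _.
  (* What remains after setting aside the diagonal mass used by this step. It is psd: [D] covers
     that mass, and the rest is a convex combination of [S] and [S']. *)
  pose M := S + (j%:R / n%:R) *: E + (D - (diag_mx rho + diag_mx rho)).
  have -> : S + (j%:R / n%:R) *: E + D = M + \sum_x (outer (p x) + outer (q x)).
    by rewrite sum1 /M -[RHS]addrA subrK.
  have -> : S + (j.+1%:R / n%:R) *: E + D = M + \sum_x outer (p x + q x).
    rewrite sum2 /M -natr1 mulrDl mul1r; move: (diag_mx rho) => r.
    by apply/matrixP => a b; rewrite !mxE; ring.
  apply: moves_swap.
  - rewrite /M; apply: psdD.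
      have -> : S + (j%:R / n%:R) *: E = (1 - j%:R / n%:R) *: S + (j%:R / n%:R) *: S'.
        by rewrite /E scalerBl scale1r scalerBr addrA addrAC.
      have j01 : j%:R / n%:R <= 1 :> R.
        by rewrite ler_pdivrMr// mul1r ler_nat ltnW.
      by apply: psdD; apply: psdZ => //; rewrite subr_ge0.
    rewrite De -!linearD/= -linearB/=; apply: psd_diag => i; rewrite !mxE.
    rewrite subr_ge0.
    have -> : \sum_j0 W i j0 + \sum_j0 W i j0 = (\sum_j E i j) / n%:R.
      rewrite -big_split/= mulr_suml; apply: eq_bigr => b _; rewrite WE.
      by field; exact: lt0r_neq0.
    case: (v1 i) => [/Einactive Ei|v1i].
      by rewrite big1 ?mul0r ?sqr_ge0// => b _; exact: Ei.
    apply: (@le_trans _ _ (eps ^+ 2)).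
      by apply: le_trans Kn; rewrite ler_pM2r// invr_gt0.
    by rewrite exprMn ler_peMr ?(ltW ep2)// exprn_ege1.
  - by move=> x; apply: nnegv_delta; exact: sqrtr_ge0.
  - by move=> x; apply: nnegv_delta; exact: sqrtr_ge0.
have := step n (leqnn n); rewrite divff ?gt_eqF// scale1r.
by rewrite [S + E]addrC subrK.
Qed.

End gram_moves.

(** * Comparison of directionally convex expectations *)

Section core.
Context (R : realType) (d : nat).
Implicit Types (f g : 'cV[R]_d -> R) (M N : 'M[R]_d).

(* Integrability of g is known only at the end of a chain of moves. It passes
   backwards along the chain because negative parts are integrable throughout. *)
Definition neg_integrable g N := forall m (B : 'M[R]_(d, m)),
  (forall l, nnegv l -> dot l (B *m B^T *m l) <= dot l (N *m l)) ->
  gint B (fun x => Num.max (- g x) 0).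

Section moves.
Variable g : 'cV[R]_d -> R.
Hypotheses (mg : measurable_fun setT g) (gid : incdiff g).

Let step k n m (A1 A2 B1 B2 : 'M[R]_(d, k)) (A : 'M[R]_(d, m)) (B : 'M[R]_(d, n)) :
  A1 *m A1^T = A *m A^T -> A2 *m A2^T = A *m A^T ->
  B1 *m B1^T = B *m B^T -> B2 *m B2^T = B *m B^T ->
  (forall z, g (A1 *m z) + g (A2 *m z) <= g (B1 *m z) + g (B2 *m z)) ->
  gint A (fun x => Num.max (- g x) 0) -> gint B g ->
  gint A g /\ (gexp A g <= gexp B g)%E.
Proof.
move=> /gram_samelaw A1A /gram_samelaw A2A /gram_samelaw B1B /gram_samelaw B2B.
move=> h gA gB.
have iA : gint A g.
  exact: (four_points_integrable mg mg A1A A2A B1B B2B h gA gB).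
by split=> //; exact: (four_points_le mg mg A1A A2A B1B B2B h iA gB).
Qed.

(** A spread compares x with x + s p and x - s p; a swap compares two exchanged choices of
    coefficients. Intermediate covariances are factored by [psd_factor], and any factor serves since
    only the law matters. *)
Lemma gram_move_le M N : gram_move M N -> neg_integrable g N ->
  forall n (B : 'M[R]_(d, n)), B *m B^T = N -> gint B g ->
  forall m (A : 'M[R]_(d, m)), A *m A^T = M ->
    gint A g /\ (gexp A g <= gexp B g)%E.
Proof.
have negA M0 N0 m (A : 'M[R]_(d, m)) : gram_move M0 N0 -> neg_integrable g N0 ->
    A *m A^T = M0 -> gint A (fun x => Num.max (- g x) 0).
  by move=> MN hN AE; apply: hN => l l0; rewrite AE; exact: gram_move_quad MN l0.
elim=> {M N} [M pM|M N S MN IH1 NS IH2|M p pM p0|M p q pM p0 q0] hN n B BE gB m A AE.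
- have AB : samelaw A B by apply: gram_samelaw; rewrite AE BE.
  have BA : samelaw B A by apply: gram_samelaw; rewrite AE BE.
  by split; [exact: samelaw_gint BA gB|rewrite (samelaw_gexp mg AB)].
- have [_ pN] := gram_move_psd MN; have [l [C CE]] := psd_factor pN.
  have [gC CB] := IH2 hN n B BE gB l C (esym CE).
  have hN' : neg_integrable g N.
    move=> r D hD; apply: hN => x x0; apply: le_trans (hD x x0) _.
    exact: gram_move_quad NS x0.
  have [gA AC] := IH1 hN' l C (esym CE) gC m A AE.
  by split=> //; exact: le_trans AC CB.
- have nA := negA _ _ _ _ (move_spread pM p0) hN AE.
  (* The zero column puts all four matrices on the same Gaussian space. *)
  apply: (@step _ _ _ (row_mx A (0 : 'cV[R]_d)) (row_mx A (0 : 'cV[R]_d))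
    (row_mx A p) (row_mx A (- p))) => //.
  + by rewrite gram_row_mx mul0mx addr0.
  + by rewrite gram_row_mx mul0mx addr0.
  + by rewrite gram_row_mx BE AE.
  + by rewrite gram_row_mx BE AE linearN/= mulNmx mulmxN opprK.
  move=> z; rewrite -[z]vsubmxK !mul_row_col mul0mx addr0.
  rewrite (mx11_scalar (dsubmx z)) !mul_mx_scalar scalerN.
  exact: spread_le.
- have [l [C CE]] := psd_factor pM.
  have nA := negA _ _ _ _ (move_swap pM p0 q0) hN AE.
  apply: (@step _ _ _ (row_mx (row_mx C p) q) (row_mx (row_mx C q) p)
    (row_mx (row_mx C (p + q)) (0 : 'cV[R]_d))
    (row_mx (row_mx C (0 : 'cV[R]_d)) (p + q))) => //.
  + by rewrite !gram_row_mx AE -CE.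
  + by rewrite !gram_row_mx AE -CE addrAC.
  + by rewrite !gram_row_mx mul0mx addr0 BE -CE.
  + by rewrite !gram_row_mx mul0mx addr0 BE -CE.
  move=> z; rewrite -[z]vsubmxK -[usubmx z]vsubmxK !mul_row_col !mul0mx !addr0.
  move: (usubmx (usubmx z)) (dsubmx (usubmx z)) (dsubmx z) => y s t.
  rewrite (mx11_scalar s) (mx11_scalar t) !mul_mx_scalar.
  by rewrite [_ + _ *: q + _ *: p]addrAC; exact: swap_le.
Qed.

End moves.

(* The intermediate covariances exceed A' A'^T by eps^2 v v^T, so g is first
   contracted by a factor 1 / a to gain integrability; then eps tends to 0 and
   a tends to 1. *)
Lemma gaussian_dcx_core k n (A : 'M[R]_(d, k)) (A' : 'M[R]_(d, n))
    (u0 : 'cV[R]_n) f g :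
  measurable_fun setT f -> measurable_fun setT g -> (forall x, f x <= g x) ->
  incdiff g -> ray_convex g ->
  (forall i j, (A *m A^T) i j <= (A' *m A'^T) i j) ->
  (forall i, (forall l, A' i l = 0) \/ 1 <= (A' *m u0) i ord0) ->
  gint A f -> gint A' g -> (gexp A f <= gexp A' g)%E.
Proof.
move=> mf mg fg gid grc AA' hu0 fA gA'.
pose v := A' *m u0.
have v0 : nnegv v := nnegv_direction hu0.
apply: (scaling_limit (p := fun z => f (A *m z)) (q := fun z => g (A' *m z))) => //.
move=> a /andP[a1 a2].
have a0 : 0 < a by lra.
pose th := a^-1.
have th0 : 0 < th by rewrite invr_gt0.
have th01 : 0 < th < 1 by rewrite th0 invf_lt1.
pose fs (x : 'cV[R]_d) := f (th *: x).
pose gs (x : 'cV[R]_d) := g (th *: x).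
have mfs : measurable_fun setT fs by exact: measurable_funZ.
have mgs : measurable_fun setT gs by exact: measurable_funZ.
have -> : (\int[gamma R k]_z (f (A *m (a^-1 *: z)))%:E = gexp A fs)%E.
  by apply: eq_integral => z _; rewrite -scalemxAr.
have -> : (\int[gamma R n]_z (g (A' *m (a^-1 *: z)))%:E = gexp A' gs)%E.
  by apply: eq_integral => z _; rewrite -scalemxAr.
have fsA : gint A fs.
  have a12 : 1 <= a <= 2 by rewrite (ltW a1).
  apply: eq_integrable (integrable_scale a12 fA) => // z _.
  by rewrite /= -scalemxAr.
have [kap kap0 hkap] := negative_part_integrable hu0 mg gid grc gA' th01.
pose U := sqn u0 + 1; have U0 : 0 < U by have := sqn_ge0 u0; rewrite /U; lra.
(* For eps <= eps1, Cauchy-Schwarz gives eps^2 (v . l)^2 <= kap |A'^T l|^2, exactly the excess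
   allowed by [negative_part_integrable]. *)
pose eps1 := Num.min 1 (kap / U).
have e10 : 0 < eps1 by rewrite lt_min ltr01 divr_gt0.
have [eps0 /andP[e00 e01] [h1 h2]] := shrunk_limit hu0 mg gid grc gA' th01 e10.
apply: h2 => eps /andP[ep0 ep1].
have gtop := h1 eps; rewrite (ltW ep0) ep1 in gtop.
have {}gtop := gtop isT.
have gsid : incdiff gs.
  move=> x u w u0' w0; rewrite /gs !scalerDr; apply: gid; exact: nnegvZ (ltW th0) _.
have chain : gram_move (A *m A^T) (A' *m A'^T + outer (eps *: v)).
  apply: gram_chain => //; [exact: psd_gram|exact: psd_gram|] => i.
  case: (hu0 i) => [A0|]; [left|by right].
  by rewrite mxE big1// => l _; rewrite A0 mul0r.
have topE : row_mx A' (eps *: v) *m (row_mx A' (eps *: v))^T =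
  A' *m A'^T + outer (eps *: v) by rewrite gram_row_mx.
have neg : neg_integrable gs (A' *m A'^T + outer (eps *: v)).
  move=> m B hB; apply: hkap => l l0.
  have := hB l l0; rewrite dot_gram mulmxDl dotDr dot_gram dot_outer -/(sqn _).
  rewrite -/(sqn (A'^T *m l)) dotZl /v dot_mull exprMn => h.
  apply: le_trans h _; rewrite mulrDl mul1r lerD2l.
  have cs := cauchy_schwarz u0 (A'^T *m l).
  have h3 : eps ^+ 2 * sqn u0 <= kap.
    apply: (@le_trans _ _ (eps * U)).
      have e1 : eps <= 1.
        by rewrite (le_trans ep1)// (le_trans e01)// ge_min lexx.
      rewrite expr2 -mulrA ler_wpM2l ?(ltW ep0)// /U.
      have := sqn_ge0 u0; nra.
    by rewrite -ler_pdivlMr// (le_trans ep1)// (le_trans e01)// ge_min lexx orbT.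
  apply: (@le_trans _ _ (eps ^+ 2 * (sqn u0 * sqn (A'^T *m l)))).
    by apply: ler_wpM2l => //; exact: sqr_ge0.
  by rewrite mulrA ler_wpM2r// sqn_ge0.
have [gA le1] := gram_move_le mgs gsid chain neg topE gtop erefl.
(* The chain is run for [gs]; the inequality [fs <= gs] is used under the law of [A] only. *)
apply: le_trans le1; apply: le_gexp => // x; exact: fg.
Qed.

End core.

(** * Conditioning on a common Gaussian component *)

Lemma measurable_glaw_shift (R : realType) (d m k : nat) (a : 'M[R]_(d, m))
    (C : 'M[R]_(d, k)) (F : 'cV[R]_d -> \bar R) :
  measurable_fun setT F -> (forall x, 0 <= F x)%E ->
  measurable_fun setT (fun x : 'cV[R]_m => glaw C (fun y => F (a *m x + y)%R)).
Proof.
move=> mF F0; have mF' := measurable_glaw_fun (row_mx a C) mF.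
have := measurable_fun_fubini_tonelli_F (m2 := gamma R k) _
  (measurableT_comp mF' (@measurable_col_mx R m k)) (fun=> F0 _).
rewrite /fubini_F /= /glaw; congr measurable_fun.
by apply/funext => x; apply: eq_integral => y _; rewrite mul_row_col.
Qed.

Section conditional_comparison.
Context (R : realType) (d m k n : nat) (a : 'M[R]_(d, m)) (B : 'M[R]_(d, k))
  (B' : 'M[R]_(d, n)) (f g : 'cV[R]_d -> R).
Hypotheses (mf : measurable_fun setT f) (mg : measurable_fun setT g).

Let shift (h : 'cV[R]_d -> R) (x : 'cV[R]_m) : 'cV[R]_d -> R :=
  fun y => h (a *m x + y).

Let mshift h x : measurable_fun setT h -> measurable_fun setT (shift h x).
Proof.
move=> mh; apply/measurable_EFinP.
by apply: (measurable_shift_fun (a *m x) (F := EFin \o h)); exact/measurable_EFinP.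
Qed.

Let gexpE l (C : 'M[R]_(d, l)) h : gexp C h =
  (glaw C (fun x => (Num.max (h x) 0)%:E) -
   glaw C (fun x => (Num.max (- h x) 0)%:E))%E.
Proof.
rewrite /gexp /glaw integralE; congr (_ - _)%E; apply: eq_integral => z _.
  by rewrite funeposE -EFin_max.
by rewrite funenegE -EFin_max.
Qed.

Let ae_gint l (C : 'M[R]_(d, l)) (h : 'cV[R]_d -> R) : measurable_fun setT h ->
  gint (row_mx a C) h -> \forall x \ae gamma R m, gint C (shift h x).
Proof.
move=> mh hi.
have mn : measurable_fun setT (fun x => `|h x|%:E).
  by apply/measurable_EFinP; exact: measurableT_comp.
have n0 x : (0 <= `|h x|%:E)%E by rewrite lee_fin.
have ih : (gamma R m).-integrable setT
    (fun x => glaw C (fun y => `|h (a *m x + y)%R|%:E)).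
  apply/integrableP; split; first exact: (measurable_glaw_shift a C mn n0).
  under eq_integral do rewrite gee0_abs ?integral_ge0//.
  by rewrite -(glaw_row_mx a C mn n0); apply/gintP.
have := integrable_ae measurableT ih; apply: filterS => x /(_ I) h1.
by apply/gintP; [exact: mshift|rewrite ltey_eq h1].
Qed.

(** The signed expectations are rearranged into four nonnegative terms, to which Tonelli applies.
    Almost every section is integrable, so the comparison is asked for such sections only. *)
Lemma conditional_le : gint (row_mx a B) f -> gint (row_mx a B') g ->
  (forall x, gint B (shift f x) -> gint B' (shift g x) ->
    (gexp B (shift f x) <= gexp B' (shift g x))%E) ->
  (gexp (row_mx a B) f <= gexp (row_mx a B') g)%E.
Proof.
move=> fi gi fg.
have aef := ae_gint mf fi; have aeg := ae_gint mg gi.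
pose pos h : 'cV[R]_d -> \bar R := fun x => (Num.max (h x) 0)%:E.
have mpos (h : 'cV[R]_d -> R) : measurable_fun setT h -> measurable_fun setT (pos h).
  by move=> mh; apply/measurable_EFinP; exact: measurable_maxr.
have pos0 h x : (0 <= pos h x)%E by rewrite lee_fin le_max lexx orbT.
pose opp (h : 'cV[R]_d -> R) : 'cV[R]_d -> R := fun x => - h x.
have mN (h : 'cV[R]_d -> R) : measurable_fun setT h -> measurable_fun setT (opp h).
  by move=> mh; exact: measurableT_comp.
have fin l (C : 'M[R]_(d, l)) (h : 'cV[R]_d -> R) : measurable_fun setT h -> gint C h ->
    glaw C (pos h) \is a fin_num.
  move=> mh hi; apply: integrable_fin_num => //; apply: le_integrable hi => //.
    exact: (measurable_glaw_fun C (mpos _ mh)).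
  move=> z _; rewrite lee_fin ger0_norm ?le_max ?lexx ?orbT// ge_max.
  by rewrite ler_norm normr_ge0.
have finN l (C : 'M[R]_(d, l)) (h : 'cV[R]_d -> R) : measurable_fun setT h -> gint C h ->
    glaw C (pos (opp h)) \is a fin_num.
  move=> mh hi; apply: fin; first exact: mN.
  exact: integrableN hi.
rewrite !gexpE -/(pos f) -/(pos g) -/(pos (opp f)) -/(pos (opp g)).
have h : (glaw (row_mx a B) (pos f) + glaw (row_mx a B') (pos (opp g)) <=
   glaw (row_mx a B') (pos g) + glaw (row_mx a B) (pos (opp f)))%E.
  rewrite (glaw_row_mx a B (mpos _ mf) (pos0 f)).
  rewrite (glaw_row_mx a B' (mpos _ (mN _ mg)) (pos0 (opp g))).
  rewrite (glaw_row_mx a B' (mpos _ mg) (pos0 g)).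
  rewrite (glaw_row_mx a B (mpos _ (mN _ mf)) (pos0 (opp f))).
  have mG l (C : 'M[R]_(d, l)) h : measurable_fun setT h ->
      measurable_fun setT (fun x : 'cV[R]_m => glaw C (fun y => pos h (a *m x + y)%R)).
    by move=> mh; exact: (measurable_glaw_shift a C (mpos _ mh) (pos0 h)).
  have G0 l (C : 'M[R]_(d, l)) h x : (0 <= glaw C (fun y => pos h (a *m x + y)%R))%E.
    by apply: integral_ge0 => z _; exact: pos0.
  rewrite -(ge0_integralD _ measurableT (fun x _ => G0 _ B f x) (mG _ B f mf)
    (fun x _ => G0 _ B' (opp g) x) (mG _ B' _ (mN _ mg))).
  rewrite -(ge0_integralD _ measurableT (fun x _ => G0 _ B' g x) (mG _ B' g mg)
    (fun x _ => G0 _ B (opp f) x) (mG _ B _ (mN _ mf))).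
  apply: ae_ge0_le_integral => //.
  - by move=> x _; rewrite adde_ge0.
  - by apply: emeasurable_funD; apply: mG => //; exact: mN.
  - by move=> x _; rewrite adde_ge0.
  - by apply: emeasurable_funD; apply: mG => //; exact: mN.
  move: aef aeg; apply: filterS2 => x xf xg _.
  have := fg x xf xg; rewrite !gexpE.
  have := fin _ _ _ (mshift x mf) xf; have := fin _ _ _ (mshift x mg) xg.
  have := finN _ _ _ (mshift x mf) xf; have := finN _ _ _ (mshift x mg) xg.
  rewrite /pos /opp /shift.
  case: (glaw B _) => [?||]//; case: (glaw B _) => [?||]//.
  case: (glaw B' _) => [?||]//; case: (glaw B' _) => [?||]// _ _ _ _.
  by rewrite -!EFinB -!EFinD !lee_fin; lra.
move: h (fin _ _ _ mf fi) (fin _ _ _ mg gi) (finN _ _ _ mf fi) (finN _ _ _ mg gi).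
case: (glaw (row_mx a B) _) => [?||]//; case: (glaw (row_mx a B) _) => [?||]//.
case: (glaw (row_mx a B') _) => [?||]//; case: (glaw (row_mx a B') _) => [?||]//.
by rewrite -!EFinB -!EFinD !lee_fin => ? _ _ _ _; lra.
Qed.

End conditional_comparison.

Lemma incdiff_shift (R : realType) d (g : 'cV[R]_d -> R) b :
  incdiff g -> incdiff (fun x => g (b + x)).
Proof. by move=> gid x u w u0 w0; rewrite !addrA; exact: gid. Qed.

Lemma ray_convex_shift (R : realType) d (g : 'cV[R]_d -> R) b :
  ray_convex g -> ray_convex (fun x => g (b + x)).
Proof. by move=> grc x u p u0 p01; rewrite !addrA; exact: grc. Qed.

Lemma measurable_shift_real (R : realType) d (g : 'cV[R]_d -> R) b :
  measurable_fun setT g -> measurable_fun setT (fun x : 'cV[R]_d => g (b + x)).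
Proof.
move=> mg; apply/measurable_EFinP.
by apply: (measurable_shift_fun b (F := EFin \o g)); exact/measurable_EFinP.
Qed.

Section gaussian_dcx.
Context (R : realType) (d : nat).

(* If w >= 0 and A'^T w = 0, the inequality 0 <= w^T (A' A'^T - A A^T) w <= 0
   forces equality in the columns where w is positive. *)
Lemma gram_degenerate k n (A : 'M[R]_(d, k)) (A' : 'M[R]_(d, n)) (w : 'cV[R]_d) :
  (forall i j, (A *m A^T) i j <= (A' *m A'^T) i j) -> nnegv w ->
  A'^T *m w = 0 -> forall j, w j ord0 != 0 ->
  forall i, (A *m A^T) i j = (A' *m A'^T) i j.
Proof.
move=> AA' w0 A'w.
pose D := A' *m A'^T - A *m A^T.
have DE i j : D i j = (A' *m A'^T) i j - (A *m A^T) i j.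
  by rewrite /D; move: (A' *m A'^T) (A *m A^T) => M N; rewrite !mxE.
have D0 i j : 0 <= D i j by rewrite DE subr_ge0.
have Aw : A^T *m w = 0.
  apply: sqn_eq0; apply/eqP; rewrite eq_le sqn_ge0 andbT.
  have : 0 <= dot w (D *m w).
    by apply: dot_nneg => // i; rewrite mxE sumr_ge0// => j _; rewrite mulr_ge0.
  by rewrite mulmxBl dotDr dotNr !dot_gram A'w dot0l sub0r oppr_ge0.
have Dw : D *m w = 0 by rewrite mulmxBl -!mulmxA A'w Aw !mulmx0 subrr.
move=> j wj i.
have := congr1 (fun M : 'cV[R]_d => M i ord0) Dw; rewrite mxE [RHS]mxE => /eqP.
rewrite psumr_eq0 => [/allP h|l _]; last by rewrite mulr_ge0.
have := h j (mem_index_enum _); rewrite /= mulf_eq0 (negbTE wj) orbF => /eqP.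
by rewrite DE; lra.
Qed.

(** Two functions absorb different means, as f = h (mu + .) and g = h (mu' + .). The hypotheses are
    stable under a common shift, which is what conditioning produces. *)
Theorem gaussian_dcx k n (A : 'M[R]_(d, k)) (A' : 'M[R]_(d, n))
    (f g : 'cV[R]_d -> R) :
  measurable_fun setT f -> measurable_fun setT g -> (forall x, f x <= g x) ->
  incdiff g -> ray_convex g ->
  (forall i j, (A *m A^T) i j <= (A' *m A'^T) i j) ->
  gint A f -> gint A' g -> (gexp A f <= gexp A' g)%E.
Proof.
have [c] := ubnP #|nzrows A'|.
elim: c => // c IH in k n A A' f g *; rewrite ltnS => cA.
move=> mf mg fg gid grc AA' fA gA'.
case: (gordan A' (fun i => i \in nzrows A')) => [[u hu]|[w [w0 wI wn0 A'w]]].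
  apply: (gaussian_dcx_core (u0 := u)) => // i.
  have [/hu|] := boolP (i \in nzrows A'); first by right.
  by rewrite inE negbK => /eqP /gram_diag_eq0; left.
have [j wj] : exists j, w j ord0 != 0.
  apply/existsP; apply: contraNT wn0 => /existsPn h.
  by apply/eqP/matrixP => i q; rewrite (ord1 q) mxE; apply/eqP/negPn.
have AjE i : (A *m A^T) i j = (A' *m A'^T) i j := gram_degenerate AA' w0 A'w wj i.
have A'j : (A' *m A'^T) j j != 0.
  have : j \in nzrows A' by apply: contraNT wj => /wI ->.
  by rewrite inE.
have Aj : (A *m A^T) j j != 0 by rewrite AjE.
case: k => [|k] in A AA' fA AjE Aj *; first by rewrite mxE big_ord0 eqxx in Aj.
case: n => [|n] in A' cA AA' gA' wI A'w AjE A'j *.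
  by rewrite mxE big_ord0 eqxx in A'j.
have [a [B [aj Bj EA SA]]] := pivot_row A j.
have [a' [B' [aj' Bj' EA' SA']]] := pivot_row A' j.
have jE i : a i ord0 * a j ord0 = a' i ord0 * a' j ord0.
  have := AjE i; rewrite EA EA' mxE [in RHS]mxE.
  have sym m (C : 'M[R]_(d, m)) p q : (C *m C^T) p q = (C *m C^T) q p.
    by rewrite !mxE; apply: eq_bigr => l _; rewrite !mxE mulrC.
  rewrite (sym _ B) (sym _ B') (gram_row0 Bj) (gram_row0 Bj') !addr0.
  by rewrite mxE [in RHS]mxE !big_ord1 !mxE.
have abj : a j ord0 = a' j ord0.
  by apply/eqP; rewrite -(eqrXn2 (n := 2))// !expr2 jE.
have aj0 : a j ord0 != 0.
  apply: contra Aj => /eqP aj0.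
  by rewrite EA mxE (gram_row0 Bj) addr0 mxE big_ord1 mxE aj0 mul0r.
have ab : a = a'.
  apply/matrixP => i q; rewrite (ord1 q); apply: (mulIf aj0).
  by rewrite jE abj.
subst a'.
have fB := samelaw_gint mf SA fA; have gB' := samelaw_gint mg SA' gA'.
rewrite (samelaw_gexp mf SA) (samelaw_gexp mg SA').
apply: conditional_le => // x fx gx.
apply: IH => //.
- by apply: leq_trans cA; exact: nzrows_proper A'j EA' Bj'.
- exact: measurable_shift_real.
- exact: measurable_shift_real.
- exact: incdiff_shift.
- exact: ray_convex_shift.
- move=> p q; have := AA' p q; rewrite EA EA' mxE [leRHS]mxE.
  by rewrite lerD2l.
Qed.

End gaussian_dcx.

(** * Normal vectors *)

Section moments.
Context (R : realType).

Lemma gint_quadratic d k (A : 'M[R]_(d, k)) (f : 'cV[R]_d -> R) (C : R) :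
  measurable_fun setT f -> 0 <= C ->
  (forall z, `|f (A *m z)| <= C * (1 + sqn z)) -> gint A f.
Proof.
move=> mf C0 hf.
have h01 : 0 <= (1 / 2 : R) < 1 by lra.
have := integrableZl measurableT (C * (1 + (1 / 4)^-1)) (integrable_exp_sqn k h01).
apply: le_integrable => //; first exact: measurable_gfun.
move=> z _; rewrite -EFinM /= lee_fin.
apply: le_trans (hf z) _; apply: le_trans (ler_norm _).
rewrite -mulrA; apply: ler_wpM2l => //.
have := le1D_expR (eta := 1 / 4) ltac:(lra) (sqn_ge0 z).
rewrite (_ : 1 / 4 * sqn z = 1 / 2 * (sqn z / 2))//; lra.
Qed.

(* This number is 1, but only its positivity matters: it relates covariances
   to Gram matrices by the same factor for both vectors. *)
Definition second_moment : R :=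
  fine (gexp (1%:M : 'M[R]_1) (fun x => x ord0 ord0 ^+ 2)).

Let measurable_sqr1 : measurable_fun setT (fun x : 'cV[R]_1 => x ord0 ord0 ^+ 2).
Proof. by apply: measurable_funX; exact: measurable_coord. Qed.

Let gint_sqr1 : gint (1%:M : 'M[R]_1) (fun x => x ord0 ord0 ^+ 2).
Proof.
apply: (@gint_quadratic _ _ _ _ 1) => // z.
by rewrite mul1mx mul1r ger0_norm ?sqr_ge0// (le_trans (sqn_coord z ord0))// lerDr.
Qed.

Lemma second_momentE :
  gexp (1%:M : 'M[R]_1) (fun x => x ord0 ord0 ^+ 2) = second_moment%:E.
Proof. by rewrite fineK//; exact: integrable_fin_num. Qed.

(** On the box [1, 3], which has positive mass, the square is at least 1. *)
Lemma second_moment_gt0 : 0 < second_moment.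
Proof.
rewrite -lte_fin -second_momentE.
pose b : set 'cV[R]_1 := box (const_mx 2) 1.
have mb : measurable b by exact: measurable_box.
apply: (@lt_le_trans _ _ (gamma R 1 b)); first exact: gamma_box_gt0.
have := @integral_indic _ _ _ (gamma R 1) _ measurableT b mb.
rewrite setIT => <-; apply: ge0_le_integral => //.
- by apply/measurable_EFinP; exact: measurable_indic.
- exact: (measurable_gfun 1%:M measurable_sqr1).
- move=> z _; rewrite lee_fin mul1mx indicE.
  case: (boolP (z \in b)) => [|_]; last exact: sqr_ge0.
  rewrite inE => /(_ ord0); rewrite mxE in_itv/= => /andP[h _].
  by apply: exprn_ege1; lra.
Qed.

Context (d k : nat) (A : 'M[R]_(d, k)).

Lemma gint_coord i : gint A (fun x => x i ord0).
Proof.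
have [L L0 hL] := mulmx_coord_bound A.
by apply: (@gint_quadratic _ _ _ _ L) => //; exact: measurable_coord.
Qed.

(** [A] and [- A] have the same law, so the mean equals its opposite. *)
Lemma gexp_coord i : gexp A (fun x => x i ord0) = 0%E.
Proof.
have mc := @measurable_coord R d i.
have S : samelaw A (- A).
  by apply: gram_samelaw; rewrite linearN/= mulNmx mulmxN opprK.
have := samelaw_gexp mc S.
have -> : gexp (- A) (fun x => x i ord0) = ((-1)%:E * gexp A (fun x => x i ord0))%E.
  rewrite /gexp -(integralZl measurableT (gint_coord i)).
  by apply: eq_integral => z _; rewrite mulNmx mxE -EFinM mulN1r.
have : gexp A (fun x => x i ord0) \is a fin_num.
  exact: (integrable_fin_num measurableT (gint_coord i)).
case: (gexp A _) => [r||]// _ [] h.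
by have -> : r = 0 by lra.
Qed.

Lemma measurable_dot n (l : 'cV[R]_n) : measurable_fun setT (dot l).
Proof.
have -> : dot l = (fun y : 'cV[R]_1 => y ord0 ord0) \o (mulmx l^T) by [].
apply: measurableT_comp; first exact: measurable_coord.
exact: measurable_mulmx.
Qed.

Lemma gint_dot_sqr (l : 'cV[R]_d) : gint A (fun x => dot l x ^+ 2).
Proof.
apply: (@gint_quadratic _ _ _ _ (sqn (A^T *m l))).
- by apply: measurable_funX; exact: measurable_dot.
- exact: sqn_ge0.
move=> z; rewrite ger0_norm ?sqr_ge0// dot_mulr.
apply: le_trans (cauchy_schwarz _ _) _.
by rewrite ler_wpM2l ?sqn_ge0// lerDr.
Qed.

(** The row [l^T *m A] has the same law as the 1 x 1 matrix whose entry is its Euclidean norm. *)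
Lemma gexp_dot_sqr (l : 'cV[R]_d) :
  gexp A (fun x => dot l x ^+ 2) = (second_moment * dot l (A *m A^T *m l))%:E.
Proof.
pose q := dot l (A *m A^T *m l).
have q0 : 0 <= q by rewrite /q dot_gram sqn_ge0.
pose f (x : 'cV[R]_1) := x ord0 ord0 ^+ 2.
have -> : gexp A (fun x => dot l x ^+ 2) = gexp (l^T *m A) f.
  by apply: eq_integral => z _; rewrite /f /dot mulmxA.
rewrite (@samelaw_gexp _ _ _ _ _ ((Num.sqrt q)%:M : 'M[R]_1))//; last first.
  apply: gram_samelaw; rewrite tr_scalar_mx -scalar_mxM -expr2 sqr_sqrtr//.
  rewrite trmx_mul trmxK -!mulmxA [LHS]mx11_scalar; congr (_%:M).
  by rewrite /q /dot !mulmxA.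
transitivity (\int[gamma R 1]_z (q%:E * (z ord0 ord0 ^+ 2)%:E))%E.
  apply: eq_integral => z _; rewrite /f mul_scalar_mx mxE exprMn sqr_sqrtr//.
have i1 : (gamma R 1).-integrable setT (fun z => (z ord0 ord0 ^+ 2)%:E).
  by have := gint_sqr1; apply: eq_integrable => // z _; rewrite mul1mx.
rewrite integralZl// -[in RHS]/q mulrC EFinM; congr (_ * _)%E.
by rewrite -second_momentE; apply: eq_integral => z _; rewrite mul1mx.
Qed.

(** Polarisation of [gexp_dot_sqr]. *)
Lemma gexp_coordM i j : gexp A (fun x => x i ord0 * x j ord0) =
  (second_moment * (A *m A^T) i j)%:E.
Proof.
pose e i : 'cV[R]_d := delta_mx i ord0.
have i1 := gint_dot_sqr (e i + e j); have i2 := gint_dot_sqr (e i).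
have i3 := gint_dot_sqr (e j).
pose f (x : 'cV[R]_d) := 
  (dot (e i + e j) x ^+ 2 - (dot (e i) x ^+ 2 + dot (e j) x ^+ 2)).
have fE (x : 'cV[R]_d) : x i ord0 * x j ord0 = 2^-1 * f x.
  by rewrite /f dotDl !dot_deltal; field.
transitivity (\int[gamma R k]_z ((2^-1)%:E * (f (A *m z))%:E))%E.
  by apply: eq_integral => z _; rewrite fE.
have i23 := integrableD measurableT i2 i3.
have i123 := integrableB measurableT i1 i23.
have E := @gexp_dot_sqr; rewrite /gexp in E.
rewrite (integralZl measurableT i123).
have -> := integralB measurableT i1 i23; have -> := integralD measurableT i2 i3.
rewrite !E -EFinD -EFinM; congr EFin.
rewrite mulmxDr dotDl !dotDr !dot_deltal -!colE ![col _ _ _ _]mxE.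
have -> : (A *m A^T) j i = (A *m A^T) i j.
  by rewrite !mxE; apply: eq_bigr => l _; rewrite !mxE mulrC.
by field.
Qed.

End moments.

Section normal_law.
Context (R : realType) (d : nat) (dT : measure_display) (T : measurableType dT)
  (P : probability T R) (X : {RV P >-> 'cV[R]_d}).

Section affine_law.
Context (k : nat) (A : 'M[R]_(d, k)) (b : 'cV[R]_d).
Hypothesis law : forall B : set 'cV[R]_d, measurable B ->
  distribution P X B = gamma R k [set z | B (A *m z + b)].

Lemma ge0_integral_law (F : 'cV[R]_d -> \bar R) : measurable_fun setT F ->
  (forall x, 0 <= F x)%E ->
  (\int[P]_t F (X t) = glaw A (fun x => F (b + x)%R))%E.
Proof.
move=> mF F0.
have mX : measurable_fun setT X by [].
pose phi (z : 'cV[R]_k) : 'cV[R]_d := A *m z + b.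
have mphi : measurable_fun setT phi by exact: measurable_affine.
pose phi' : {mfun 'cV[R]_k >-> 'cV[R]_d} :=
  HB.pack phi (isMeasurableFun.Build _ _ _ _ _ mphi).
transitivity (\int[distribution P X]_y F y)%E.
  by rewrite /distribution ge0_integral_pushforward.
transitivity (\int[distribution (gamma R k) phi']_y F y)%E.
  by apply: eq_measure_integral => B mB _; exact: law.
rewrite ge0_integral_pushforward//.
by apply: eq_integral => z _; rewrite /= addrC.
Qed.

Lemma integral_law (f : 'cV[R]_d -> R) : measurable_fun setT f ->
  (\int[P]_t (f (X t))%:E = gexp A (fun x => f (b + x)%R))%E.
Proof.
move=> mf; have mF : measurable_fun setT (EFin \o f) by exact/measurable_EFinP.
rewrite /gexp integralE [RHS]integralE; congr (_ - _)%E.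
  transitivity (\int[P]_t ((EFin \o f)^\+ (X t)))%E.
    by apply: eq_integral => t _; rewrite !funeposE.
  rewrite (ge0_integral_law (measurable_funepos mF))//.
  by apply: eq_integral => t _; rewrite !funeposE.
transitivity (\int[P]_t ((EFin \o f)^\- (X t)))%E.
  by apply: eq_integral => t _; rewrite !funenegE.
rewrite (ge0_integral_law (measurable_funeneg mF))//.
by apply: eq_integral => t _; rewrite !funenegE.
Qed.

Lemma integrable_law (f : 'cV[R]_d -> R) : measurable_fun setT f ->
  P.-integrable setT (fun t => (f (X t))%:E) -> gint A (fun x => f (b + x)).
Proof.
move=> mf /integrableP[_ fi]; apply/gintP; first exact: measurable_shift_real.
have mF : measurable_fun setT (fun x => `|f x|%:E).
  by apply/measurable_EFinP; exact: measurableT_comp.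
by have := ge0_integral_law mF (fun=> normr_ge0 _) => <-.
Qed.

End affine_law.

(** The given standard law is replaced by [gamma]. The mean then forces b = mu, and centred products
    identify the Gram matrix up to [second_moment]. *)
Lemma normal_vector_law (mu : 'cV[R]_d) (Sigma : 'M[R]_d) :
  normal_vector X mu Sigma -> exists k (A : 'M[R]_(d, k)),
  [/\ Sigma = second_moment R *: (A *m A^T),
    forall f, measurable_fun setT f ->
      P.-integrable setT (fun t => (f (X t))%:E) -> gint A (fun x => f (mu + x)) &
    forall f, measurable_fun setT f ->
      ('E_P[fun t => f (X t)] = gexp A (fun x => f (mu + x)%R))%E].
Proof.
move=> [[k [A [b [g [gs hg]]]]] hmu hS].
have mset (B : set 'cV[R]_d) : measurable B ->
    measurable [set z : 'cV[R]_k | B (A *m z + b)].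
  move=> mB; rewrite -[X in measurable X]setTI.
  exact: (measurable_affine A b (@measurable_id _ _ setT)).
have law (B : set 'cV[R]_d) : measurable B ->
    distribution P X B = gamma R k [set z | B (A *m z + b)].
  move=> mB; rewrite hg//; apply: standard_normal_unique => //.
    exact: gamma_standard.
  exact: mset.
have EX (f : 'cV[R]_d -> R) : measurable_fun setT f ->
    ('E_P[fun t => f (X t)] = gexp A (fun x => f (b + x)%R))%E.
  by move=> mf; rewrite unlock; exact: integral_law.
have bmu : b = mu.
  apply/matrixP => i q; rewrite (ord1 q); apply: EFin_inj; rewrite -hmu.
  rewrite (EX _ (@measurable_coord R d i)).
  rewrite /gexp; under eq_integral do rewrite mxE EFinD.
  rewrite integralD//; last exact: gint_coord; last first.
    exact: finite_measure_integrable_cst.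
  rewrite integral_gamma_cst.
  by have := gexp_coord A i; rewrite /gexp => ->; rewrite adde0.
subst b.
exists k, A; split.
- apply/matrixP => i j; apply: EFin_inj; rewrite -hS unlock.
  rewrite !hmu /=.
  pose f (x : 'cV[R]_d) := (x i ord0 - mu i ord0) * (x j ord0 - mu j ord0).
  have mf : measurable_fun setT f.
    by apply: measurable_funM; apply: measurable_funB => //; exact: measurable_coord.
  transitivity ('E_P[fun t => f (X t)])%E; first by [].
  rewrite EX// mxE -gexp_coordM; apply: eq_integral => z _.
  rewrite /f; congr EFin; move: (A *m z) => y; rewrite !mxE; ring.
- by move=> f mf; exact: integrable_law.
- exact: EX.
Qed.

End normal_law.

(** The hypothesis on [f] and [g] combines midpoint convexity with a shift of the mean. *)
Lemma gaussian_cx (R : realType) d k n (A : 'M[R]_(d, k)) (A' : 'M[R]_(d, n))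
    (f g : 'cV[R]_d -> R) :
  measurable_fun setT f -> measurable_fun setT g ->
  (forall x u, f x + f x <= g (x + u) + g (x - u)) ->
  psd (A' *m A'^T - A *m A^T) ->
  gint A f -> gint A' g -> (gexp A f <= gexp A' g)%E.
Proof.
move=> mf mg fg /psd_factor[l [C CE]] fA gA'.
have AC : A' *m A'^T = A *m A^T + C *m C^T by rewrite -CE addrC subrK.
pose A0 := row_mx A (0 : 'M[R]_(d, l)).
have A0A : samelaw A0 A by apply: gram_samelaw; rewrite gram_row_mx mul0mx addr0.
have B1 : samelaw (row_mx A C) A' by apply: gram_samelaw; rewrite gram_row_mx AC.
have B2 : samelaw (row_mx A (- C)) A'.
  by apply: gram_samelaw; rewrite gram_row_mx AC linearN/= mulNmx mulmxN opprK.
apply: (four_points_le mf mg A0A A0A B1 B2) => // z.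
rewrite -[z]vsubmxK !mul_row_col mul0mx addr0 mulNmx; exact: fg.
Qed.

Lemma convex_fct_spread (R : realType) d (f : 'cV[R]_d -> R) (x u : 'cV[R]_d) :
  convex_fct f -> f x + f x <= f (x + u) + f (x - u).
Proof.
move=> cf; have h0 : (0 : R) <= 1 / 2 by lra.
have h1 : (1 / 2 : R) <= 1 by lra.
have : f ((1 / 2) *: (x + u) + (1 - 1 / 2) *: (x - u)) <=
    1 / 2 * f (x + u) + (1 - 1 / 2) * f (x - u).
  by have := cf (Itv01 h0 h1) (x + u) (x - u); rewrite !inE => /(_ I I).
have -> : (1 / 2) *: (x + u) + (1 - 1 / 2) *: (x - u) = x.
  by apply/matrixP => i j; rewrite !mxE; field.
lra.
Qed.

Theorem corollary2p11 (R : realType) (d : nat)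
    (dT : measure_display) (T : measurableType dT) (P : probability T R)
    (dU : measure_display) (U : measurableType dU) (Q : probability U R)
    (N : {RV P >-> 'cV[R]_d}) (N' : {RV Q >-> 'cV[R]_d})
    (mu mu' : 'cV[R]_d) (Sigma Sigma' : 'M[R]_d)
    (hN : normal_vector N mu Sigma) (hN' : normal_vector N' mu' Sigma') :
  [/\ le_vec mu mu' -> Sigma = Sigma' -> le_st N N',
      mu = mu' -> le_psd Sigma Sigma' -> le_cx N N',
      mu = mu' -> (forall i j, Sigma i j <= Sigma' i j) -> le_dcx N N',
      le_vec mu mu' -> le_psd Sigma Sigma' -> le_icx N N'
    & le_vec mu mu' -> (forall i j, Sigma i j <= Sigma' i j) -> le_idcx N N'].
Proof.
have [k [A [SE Ai AE]]] := normal_vector_law hN.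
have [n [A' [SE' Ai' AE']]] := normal_vector_law hN'.
have s0 := second_moment_gt0 R.
have le_mu f : increasing_fct f -> le_vec mu mu' -> forall x, f (mu + x) <= f (mu' + x).
  by move=> fi hmu x; apply: fi => i; rewrite !mxE lerD2r.
(* Serves the second and the fourth claim: [fmu] is trivial for equal means and follows from
   monotonicity otherwise. *)
have cx f : (forall x, f (mu + x) <= f (mu' + x)) -> le_psd Sigma Sigma' ->
    convex_fct f -> measurable_fun setT f ->
    P.-integrable setT (fun t => (f (N t))%:E) ->
    Q.-integrable setT (fun u => (f (N' u))%:E) ->
    ('E_P[fun t => f (N t)] <= 'E_Q[fun u => f (N' u)])%E.
  move=> fmu S cf mf fN fN'; rewrite AE// AE'//.
  apply: gaussian_cx; [exact: measurable_shift_real..| | |exact: Ai|exact: Ai'].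
  - move=> x u; have := convex_fct_spread (mu' + x) u cf.
    by have := fmu x; rewrite !addrA; lra.
  - have -> : A' *m A'^T - A *m A^T = (second_moment R)^-1 *: (Sigma' - Sigma).
      by rewrite SE SE' -scalerBr scalerA mulVf ?scale1r// gt_eqF.
    by apply: psdZ => //; rewrite invr_ge0 ltW.
(* The same device for the third and the fifth claim. *)
have dcx f : (forall x, f (mu + x) <= f (mu' + x)) ->
    (forall i j, Sigma i j <= Sigma' i j) ->
    dir_convex f -> measurable_fun setT f ->
    P.-integrable setT (fun t => (f (N t))%:E) ->
    Q.-integrable setT (fun u => (f (N' u))%:E) ->
    ('E_P[fun t => f (N t)] <= 'E_Q[fun u => f (N' u)])%E.
  move=> fmu S df mf fN fN'; rewrite AE// AE'//.
  apply: gaussian_dcx; [exact: measurable_shift_real..|exact: fmu| | | | |].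
  - exact: (incdiff_shift _ (dcx_incdiff df)).
  - exact: (ray_convex_shift _ (dcx_ray_convex df)).
  - by move=> i j; have := S i j; rewrite SE SE' mxE [leRHS]mxE ler_pM2l.
  - exact: Ai.
  - exact: Ai'.
split.
- move=> hmu SS f fi mf fN fN'; rewrite AE// AE'//.
  have AA' : samelaw A' A.
    apply: gram_samelaw; apply: (@scalerI _ _ (second_moment R)).
      by rewrite gt_eqF.
    by rewrite -SE -SE'.
  have mf' := measurable_shift_real mu' mf.
  rewrite (samelaw_gexp mf' AA'); apply: le_gexp; first exact: Ai.
    by apply: (samelaw_gint mf' AA'); exact: Ai'.
  exact: le_mu.
- by move=> hmu S f cf; apply: cx => // x; rewrite hmu.
- by move=> hmu S f cf; apply: dcx => // x; rewrite hmu.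
- by move=> hmu S f [fi cf]; apply: cx => //; exact: le_mu.
- by move=> hmu S f [fi cf]; apply: dcx => //; exact: le_mu.
Qed.
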